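(* For any $w\in C^2(\mathbb{R}^d)$ there exists a sequence $(u_j)_j$ of functions in $\mathrm{CPWL}(\mathbb{R}^d)$ such that $u_j\to w$ in the $L^\infty_{\mathrm{loc}}(\mathbb{R}^d)$ topology and such that for any bounded open set $\Omega\subseteq\mathbb{R}^d$ with $\mathscr{L}^d(\partial\Omega)=0$ one has $$\lim_{j\to\infty}|\mathrm{D}^2_1u_j|(\Omega)=|\mathrm{D}^2_1w|(\Omega).$$
   Context: $\mathscr{L}^d$ is Lebesgue measure on $\mathbb{R}^d$. Schatten norms: for $M\in\mathbb{R}^{d\times d}$ and $p\in[1,\infty]$, $|M|_p$ is the $\ell^p$ norm of the vector of singular values of $M$ (counted with multiplicity). Hessian--Schatten variation: for $p\in[1,\infty]$ with conjugate exponent $p^*$ ($1/p+1/p^*=1$), $f\in L^1_{\mathrm{loc}}(\mathbb{R}^d)$ and $A\subseteq\mathbb{R}^d$ open, $$|\mathrm{D}^2_pf|(A):=\sup\Big\{\int_A\sum_{i,j=1}^d f\,\partial_i\partial_jF_{i,j}\,d\mathscr{L}^d:\ F\in C_c^\infty(A)^{d\times d},\ \sup_{x}|F(x)|_{p^*}\le1\Big\}.$$ (If $w\in C^2$, then $|\mathrm{D}^2_1w|(A)=\int_A|\nabla^2w|_1\,d\mathscr{L}^d$.) CPWL functions: a simplex in $\mathbb{R}^d$ is the convex hull of $d+1$ points (its vertices) not lying on a hyperplane; a face of a simplex is the convex hull of a subset of its vertices. For $\Omega\subseteq\mathbb{R}^d$ open, $f\in C(\Omega)$ belongs to $\mathrm{CPWL}(\Omega)$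 if there is a decomposition of $\mathbb{R}^d$ into $d$-dimensional simplexes $\{P_k\}_{k\in\mathbb{N}}$ such that (i) $P_k\cap P_h$ is either empty or a common face of $P_k$ and $P_h$ for every $h\neq k$; (ii) for every $k$ the restriction of $f$ to $P_k\cap\Omega$ is affine; (iii) every ball intersects only finitely many $P_k$. *)

(* Defs.v *)
From HB Require Import structures.
From mathcomp Require Import all_boot all_order all_algebra spectral.
From mathcomp Require complex.
From mathcomp Require Import all_classical all_reals all_analysis.

Set Implicit Arguments.
Unset Strict Implicit.
Unset Printing Implicit Defensive.

Import Order.TTheory GRing.Theory Num.Theory.
Import numFieldNormedType.Exports.

Local Open Scope classical_set_scope.
Local Open Scope ring_scope.

Definition rV_display : measure_display.
Proof. exact: default_measure_display. Qed.

Section measurable_rV.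
Context {R : realType}.
Variable n : nat.

Let coor : 'I_n -> 'rV[R]_n -> R := fun i x => x ord0 i.

Let rV_set0 : g_sigma_preimage coor set0.
Proof. exact: sigma_algebra0. Qed.

Let rV_setC A : g_sigma_preimage coor A -> g_sigma_preimage coor (~` A).
Proof. exact: sigma_algebraC. Qed.

Let rV_bigcup (F : _^nat) : (forall i, g_sigma_preimage coor (F i)) ->
  g_sigma_preimage coor (\bigcup_i (F i)).
Proof. exact: sigma_algebra_bigcup. Qed.

(* The sigma-algebra generated by the coordinates, as for the library's
   n.-tuple T; R^n being second countable, it is the Borel sigma-algebra. *)
HB.instance Definition _ := @isMeasurable.Build rV_display
  'rV[R]_n (g_sigma_preimage coor) rV_set0 rV_setC rV_bigcup.

End measurable_rV.

Section lebesgue_rV.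
Context {R : realType}.

Definition cons_rV n (p : R * 'rV[R]_n) : 'rV[R]_n.+1 :=
  row_mx (p.1%:M : 'rV[R]_1) p.2.

(* The n-fold product of the one-dimensional Lebesgue measure. *)
Fixpoint lebesgue_rV n : set 'rV[R]_n -> \bar R :=
  match n with
  | 0 => \d_ (0 : 'rV[R]_0)
  | m.+1 => pushforward (lebesgue_measure \x @lebesgue_rV m)%E (@cons_rV m)
  end.

Lemma measurable_coor n (i : 'I_n) :
  measurable_fun setT (fun x : 'rV[R]_n => x ord0 i).
Proof.
move=> _ Y mY; rewrite setTI; apply: sub_sigma_algebra => /=.
rewrite -bigcup_seq/=; exists i => /=; first by rewrite mem_index_enum.
by exists Y => //; rewrite setTI.
Qed.

Lemma measurable_fun_rVP d (T : measurableType d) n (f : T -> 'rV[R]_n) :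
  (forall i, measurable_fun setT (fun x => f x ord0 i)) ->
  measurable_fun setT f.
Proof.
move=> mf _ A mA; rewrite setTI.
move: A mA; apply: smallest_sub.
  split => [|A mA|F mF]; first by rewrite preimage_set0.
  - by rewrite setTD preimage_setC; exact: measurableC.
  - by rewrite preimage_bigcup; exact: bigcup_measurable.
rewrite -bigcup_seq => A [i _ [B mB <-]].
by rewrite setTI -[X in measurable X]setTI; exact: mf.
Qed.

Lemma cons_rV0 n (p : R * 'rV[R]_n) : cons_rV p ord0 ord0 = p.1.
Proof.
rewrite -(_ : lshift n ord0 = ord0 :> 'I_(1 + n)); last exact/val_inj.
by rewrite /cons_rV (row_mxEl (p.1%:M : 'rV[R]_1)) mxE mulr1n.
Qed.

Lemma cons_rVS n (p : R * 'rV[R]_n) (i : 'I_n) :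
  cons_rV p ord0 (lift ord0 i) = p.2 ord0 i.
Proof.
rewrite -(_ : rshift 1 i = lift ord0 i :> 'I_(1 + n)); last exact/val_inj.
by rewrite /cons_rV (row_mxEr (p.1%:M : 'rV[R]_1)).
Qed.

Lemma measurable_cons_rV n : measurable_fun setT (@cons_rV n).
Proof.
apply: measurable_fun_rVP => i; have [j ->|->] := unliftP ord0 i.
  apply: (eq_measurable_fun ((fun x : 'rV[R]_n => x ord0 j) \o snd)).
    by move=> p _; rewrite cons_rVS.
  by apply: measurableT_comp => //; exact: measurable_coor.
by apply: (eq_measurable_fun fst) => // p _; rewrite cons_rV0.
Qed.

Lemma measurable_uncons_rV n (A : set R) (B : set 'rV[R]_n) :
  measurable A -> measurable B ->
  measurable [set x : 'rV[R]_n.+1 |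
    A (x ord0 ord0) /\ B (\row_i x ord0 (lift ord0 i))].
Proof.
move=> mA mB; apply: measurableI.
  by rewrite -[X in measurable X]setTI; exact: measurable_coor.
rewrite -[X in measurable X]setTI; apply: measurable_fun_rVP => // i.
by under eq_fun do rewrite mxE; exact: measurable_coor.
Qed.

Let bundle d (T : measurableType d) (mu : set T -> \bar R) :
  mu set0 = 0%E -> (forall A, 0 <= mu A)%E -> semi_sigma_additive mu ->
  sigma_finite setT mu ->
  exists m : {sigma_finite_measure set T -> \bar R}, mu = m.
Proof.
move=> mu0 mu_ge0 mu_add mu_fin.
pose muM : {measure set T -> \bar R} :=
  HB.pack mu (isMeasure.Build _ _ _ mu mu0 mu_ge0 mu_add).
pose m : {sigma_finite_measure set T -> \bar R} :=
  HB.pack (Measure.sort muM)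
    (Measure_isSigmaFinite.Build _ _ _ (Measure.sort muM) mu_fin).
by exists m.
Qed.

Let lebesgue_rV_subproof n :
  exists m : {sigma_finite_measure set 'rV[R]_n -> \bar R}, @lebesgue_rV n = m.
Proof.
elim: n => [|n [m mE]]; first by eexists (\d_ (0 : 'rV[R]_0)).
have mc := @measurable_cons_rV n.
pose pm := pushforward (lebesgue_measure \x m)%E (@cons_rV n).
have pm0 : pm set0 = 0%E by rewrite /pm /pushforward preimage_set0 measure0.
have pmge0 A : (0 <= pm A)%E by apply: integral_ge0.
have pmsigma : semi_sigma_additive pm.
  exact: (@measure_semi_sigma_additive _ _ _ (pushforward _ _)).
have pMfin : sigma_finite setT pm.
  have /sigma_finiteP[F [TF ndF Foo]] := sigma_finiteT (@lebesgue_measure R).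
  have /sigma_finiteP[G [TG ndG Goo]] := sigma_finiteT m.
  exists (fun k => [set x : 'rV[R]_n.+1 |
    F k (x ord0 ord0) /\ G k (\row_i x ord0 (lift ord0 i))]).
    apply/esym/seteqP; split => // x _.
    have : setT (x ord0 ord0) by []; rewrite TF => -[i _ Fi].
    have : setT (\row_i x ord0 (lift ord0 i)) by [].
    rewrite TG => -[j _ Gj]; exists (maxn i j) => //; split.
    - by move: Fi; exact/subsetPset/ndF/leq_maxl.
    - by move: Gj; exact/subsetPset/ndG/leq_maxr.
  move=> k; have [mF Fk] := Foo k; have [mG Gk] := Goo k.
  split; first exact: measurable_uncons_rV.
  rewrite /pm /pushforward (_ : _ @^-1` _ = F k `*` G k).
    by rewrite product_measure1E// lte_mul_pinfty// ge0_fin_numE.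
  apply/seteqP; split => -[x y] /=; rewrite cons_rV0/=.
    move=> -[Fx]; rewrite (_ : \row_i _ = y)//.
    by apply/rowP => i; rewrite mxE cons_rVS.
  move=> -[Fx Gy]; split => //; rewrite (_ : \row_i _ = y)//.
  by apply/rowP => i; rewrite mxE cons_rVS.
by have [m' pmE] := bundle pm0 pmge0 pmsigma pMfin; exists m'; rewrite /= mE.
Qed.

Let lebesgue_rV0 n : @lebesgue_rV n set0 = 0%E.
Proof. by have [m ->] := lebesgue_rV_subproof n; exact: measure0. Qed.

Let lebesgue_rV_ge0 n A : (0 <= @lebesgue_rV n A)%E.
Proof. by have [m ->] := lebesgue_rV_subproof n; exact: measure_ge0. Qed.

Let lebesgue_rV_sigma_additive n : semi_sigma_additive (@lebesgue_rV n).
Proof.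
by have [m ->] := lebesgue_rV_subproof n; exact: measure_semi_sigma_additive.
Qed.

HB.instance Definition _ n := isMeasure.Build _ _ _ (@lebesgue_rV n)
  (@lebesgue_rV0 n) (@lebesgue_rV_ge0 n) (@lebesgue_rV_sigma_additive n).

Let lebesgue_rV_sigma_finite n : sigma_finite setT (@lebesgue_rV n).
Proof. by have [m ->] := lebesgue_rV_subproof n; exact: sigma_finiteT. Qed.

HB.instance Definition _ n := Measure_isSigmaFinite.Build _ _ _ (@lebesgue_rV n)
  (@lebesgue_rV_sigma_finite n).

Lemma lebesgue_rV_box n (A : 'I_n -> set R) :
  (forall i, measurable (A i)) ->
  @lebesgue_rV n [set x | forall i, A i (x ord0 i)] =
  (\prod_(i < n) lebesgue_measure (A i))%E.
Proof.
elim: n A => [|n IH] A mA.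
  rewrite big_ord0 /= diracE mem_set//= => -[]//.
rewrite big_ord_recl /= /pushforward.
pose B := [set x : 'rV[R]_n | forall i, A (lift ord0 i) (x ord0 i)].
rewrite -(IH (fun i => A (lift ord0 i)))// -/B.
rewrite (_ : _ @^-1` _ = A ord0 `*` B); last first.
  apply/seteqP; split => -[x y] /=.
    move=> Axy; split=> [|i]; first by have := Axy ord0; rewrite cons_rV0.
    by have := Axy (lift ord0 i); rewrite cons_rVS.
  move=> [Ax By] i; have [j ->|->] := unliftP ord0 i; last by rewrite cons_rV0.
  by rewrite cons_rVS; exact: By.
rewrite product_measure1E//; first exact: mA.
suff -> : B = \big[setI/setT]_(i < n)
    ((fun x : 'rV[R]_n => x ord0 i) @^-1` A (lift ord0 i)).
  apply: bigsetI_measurable => i _.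
  by rewrite -[X in measurable X]setTI; exact: measurable_coor.
rewrite -bigcap_seq; apply/seteqP; split => [x Bx i _|x Bx i]; first exact: Bx.
by apply: (Bx i); rewrite /= mem_index_enum.
Qed.

End lebesgue_rV.
Arguments lebesgue_rV {R} n.

Definition partial {R : realType} d (i : 'I_d) (f : 'rV[R]_d -> R) :
  'rV[R]_d -> R := fun x => 'D_(delta_mx 0 i) f x.

Fixpoint Ck {R : realType} d (k : nat) (f : 'rV[R]_d -> R) : Prop :=
  continuous f /\
  match k with
  | 0 => True
  | k'.+1 => forall i : 'I_d,
      (forall x, derivable f x (delta_mx 0 i)) /\ Ck k' (partial i f)
  end.

(* C_c^oo(A), its elements being extended by 0 outside of A. *)
Definition test_function {R : realType} d (A : set 'rV[R]_d)
    (phi : 'rV[R]_d -> R) :=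
  [/\ forall k, Ck k phi,
      compact (closure [set x | phi x != 0]) &
      closure [set x | phi x != 0] `<=` A].

(* s lists the square roots of the eigenvalues of M^T M, counted with algebraic
   multiplicity, in no particular order. *)
Definition is_singular_values {R : realType} d (M : 'M[R]_d) (s : 'rV[R]_d) :=
  (forall i, 0 <= s ord0 i) /\
  char_poly (M^T *m M) = \prod_i ('X - (s ord0 i ^+ 2)%:P).

Definition singular_values {R : realType} d (M : 'M[R]_d) : 'rV[R]_d :=
  get (is_singular_values M).

Section singular_values_exist.
Import complex.
Local Open Scope sesquilinear_scope.

Lemma singular_valuesP {R : realType} d (M : 'M[R]_d) :
  is_singular_values M (singular_values M).
Proof.
apply: getPex.
pose toC := real_complex R.
pose Mc := map_mx toC M; pose A := Mc^T *m Mc.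
have McE : map_mx Num.conj Mc = Mc.
  by apply/matrixP => i j; rewrite !mxE; exact: conjc_real.
have Anormal : A \is normalmx.
  apply/normalmxP; rewrite (_ : A ^t* = A)//.
  by rewrite /A trmx_mul trmxK map_mxM -map_trmx McE.
have /orthomx_spectralP := Anormal.
set P := spectralmx A; set D := spectral_diag A => AE.
have Pu : P \is unitarymx by exact: spectral_unitarymx.
have Pun : P \in unitmx by exact: unitarymx_unit.
have DE : diag_mx D = P *m A *m P ^t*.
  by rewrite AE -invmx_unitary// !mulmxA mulmxV// mul1mx -mulmxA mulmxV// mulmx1.
have D_ge0 i : 0 <= D ord0 i.
  have -> : D ord0 i = diag_mx D i i by rewrite mxE eqxx.
  rewrite DE /A (_ : _ *m _ = (P *m Mc^T) *m (P *m Mc^T) ^t*).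
    rewrite mxE; apply: sumr_ge0 => k _; rewrite !mxE.
    exact: mul_conjC_ge0.
  by rewrite trmx_mul trmxK map_mxM McE !mulmxA.
exists (\row_i Num.sqrt (Re (D ord0 i))); split=> [i|].
  by rewrite mxE sqrtr_ge0.
apply: (map_poly_inj toC); rewrite map_char_poly rmorph_prod/=.
rewrite map_mxM/= -map_trmx -/Mc -/A.
have -> : char_poly A = char_poly (diag_mx D).
  have : P *m A = diag_mx D *m P.
    by rewrite [in LHS]AE !mulmxA mulmxV// mul1mx.
  move=> /(congr1 (map_mx polyC)); rewrite (map_mxM _ P A) (map_mxM _ (diag_mx D) P) => PA.
  have : map_mx polyC P *m char_poly_mx A = char_poly_mx (diag_mx D) *m map_mx polyC P.
    by rewrite mulmxBr mulmxBl PA scalar_mxC.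
  move=> /(congr1 determinant); rewrite !det_mulmx mulrC => /mulIf; apply.
  by rewrite det_map_mx polyC_eq0 -unitfE -unitmxE.
rewrite char_poly_trig ?diag_mx_is_trig//; apply: eq_bigr => i _.
have ReD : 0 <= Re (D ord0 i) /\ toC (Re (D ord0 i)) = D ord0 i.
  by move: (D_ge0 i); case: (D ord0 i) => a b; rewrite lecE/= => /andP[/eqP ->].
rewrite rmorphB/= map_polyX map_polyC/= !mxE eqxx mulr1n.
by rewrite sqr_sqrtr; [have := ReD.2; rewrite /toC => ->|exact: ReD.1].
Qed.


End singular_values_exist.

Definition lp_norm {R : realType} (p : \bar R) d (s : 'rV[R]_d) : R :=
  match p with
  | r%:E => (\sum_i `|s ord0 i| `^ r) `^ r^-1
  | +oo%E => \big[Num.max/0]_i `|s ord0 i|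
  | -oo%E => 0
  end.

Definition schatten_norm {R : realType} (p : \bar R) d (M : 'M[R]_d) : R :=
  lp_norm p (singular_values M).

Definition hessian_schatten_variation {R : realType} (p : \bar R) d
    (f : 'rV[R]_d -> R) (A : set 'rV[R]_d) : \bar R :=
  ereal_sup
    [set (\int[lebesgue_rV d]_(x in A)
            (\sum_(i < d) \sum_(j < d)
               f x * partial i (partial j (fun y => F y i j)) x)%:E)%E
    | F in [set F : 'rV[R]_d -> 'M[R]_d |
        (forall i j, test_function A (fun y => F y i j)) /\
        (forall x, schatten_norm (hoelder_conjugate p) (F x) <= 1)]].

Definition convex_hull {R : realType} d (A : set 'rV[R]_d) : set 'rV[R]_d :=
  smallest (@convex_set R 'rV[R]_d) A.

Definition dotp {R : realType} d (u v : 'rV[R]_d) : R :=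
  \sum_(i < d) u ord0 i * v ord0 i.

Definition on_hyperplane {R : realType} d (A : set 'rV[R]_d) :=
  exists (a : 'rV[R]_d) (c : R), a != 0 /\ (forall x, A x -> dotp a x = c).

Definition is_simplex_vertices {R : realType} d (v : 'I_d.+1 -> 'rV[R]_d) :=
  ~ on_hyperplane (range v).

Definition simplex {R : realType} d (v : 'I_d.+1 -> 'rV[R]_d) :=
  convex_hull (range v).

Definition is_face {R : realType} d (v : 'I_d.+1 -> 'rV[R]_d)
    (F : set 'rV[R]_d) :=
  exists2 S, S `<=` range v & F = convex_hull S.

Definition affine_on {R : realType} d (A : set 'rV[R]_d) (f : 'rV[R]_d -> R) :=
  exists (a : 'rV[R]_d) (c : R), forall x, A x -> f x = dotp a x + c.

(* R^d carries the sup norm of the library; only the shape of the balls in the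
   local finiteness condition is affected. *)
Definition CPWL {R : realType} d (Omega : set 'rV[R]_d) (f : 'rV[R]_d -> R) :=
  {within Omega, continuous f} /\
  exists v : nat -> 'I_d.+1 -> 'rV[R]_d,
    let P k := simplex (v k) in
    [/\ (forall k, is_simplex_vertices (v k)) /\ \bigcup_k P k = setT,
        forall h k, h <> k ->
          P k `&` P h = set0 \/
          (is_face (v k) (P k `&` P h) /\ is_face (v h) (P k `&` P h)),
        forall k, affine_on (P k `&` Omega) f &
        forall x r, finite_set [set k | (P k `&` ball x r) !=set0]].

(* Convergence in L^oo(K) for every compact K. *)
Definition cvg_Linfty_loc {R : realType} d (u : nat -> 'rV[R]_d -> R)
    (w : 'rV[R]_d -> R) :=
  forall K : set 'rV[R]_d, compact K ->
    Lnorm (lebesgue_rV d) +oo%E (fun x => (\1_K x * (u j x - w x))%:E)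
      @[j --> \oo] --> 0%E.

Definition boundary {T : topologicalType} (A : set T) :=
  closure A `\` interior A.

(* Main.v *)
(* On a small cube Q_k write w = A_k - B_k with A_k and B_k convex on a large
   box, where the Hessian of B_k on Q_k is close to the negative part of the
   Hessian of w at the center of Q_k; then the Laplacian of A_k + B_k is, on
   Q_k, close to |D^2 w|_1. Maxima of finitely many tangent planes give
   piecewise affine Ah_k and Bh_k, and u is the maximum over k of Ah_k - Bh_k
   minus a small convex penalty that vanishes on the core of Q_k and is
   positive on the other cores, so that u = Ah_k - Bh_k on the core of Q_k.
   For G convex and Phi positive semidefinite the pairing of G with the
   second derivatives of Phi is nonnegative (log-sum-exp smoothing), hence
   the variation of a difference G - H of convex functions is at most the
   mass of the Laplacian of G + H. This bounds the variation of u on the core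
   of Q_k by the variation of w there, up to small errors; the complement of
   the cores has small measure, and there u is the difference of two fixed
   convex functions up to small errors. Cubes meeting the boundary of Omega
   contribute at most a constant times the measure of a neighborhood of it.
   The lower bound is the lower semicontinuity of the variation.

   A compactly supported function that is affine wherever finitely many
   affine forms have constant signs is CPWL: starting from Kuhn's
   triangulation of R^d, every edge crossing one of the hyperplanes is
   removed by a stellar subdivision at the crossing point. *)
Require Import Defs.
From mathcomp Require Import all_boot all_order all_algebra.
From mathcomp Require Import perm spectral.
From mathcomp Require complex.
From mathcomp Require Import all_classical all_reals all_analysis.
From mathcomp Require Import measurable_realfun ess_sup_inf.
From mathcomp Require Import ring lra.

Import Order.TTheory GRing.Theory Num.Theory.
Import numFieldNormedType.Exports.
Local Open Scope classical_set_scope.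
Local Open Scope ring_scope.

Set Implicit Arguments.
Unset Strict Implicit.
Unset Printing Implicit Defensive.

(** For a convex function uniform convergence is enough: its variation is the mass of its Laplacian,
    and pairing it with the Laplacian of a cut-off involves only its values. Hence no adapted mesh
    is needed, and excess variation can only come from the splitting w = A - B, for which A + B must
    have the least possible Laplacian. The best splitting follows the eigenvectors of the Hessian
    and varies from point to point; the obstacle is to glue one splitting per cube without leaving
    the differences of convex functions. A maximum does this, at the price of constants that grow
    with the number of cubes. The order of the choices makes them harmless: the cubes, then all the
    B_k, which bounds the Laplacian of w + 2 sum_k B_k by some C0, then the width of the gaps, so
    that C0 times their measure is small, and only then the precision of the tangent planes, small
    against the second derivatives of the cut-offs. As the maximum is global, every B_k has to be
    convex on the whole box. Finally [u] is built before Omega is given, so that one sequence serves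
    all Omega. *)

Section row_vectors.
Context {R : realType} {d : nat}.
Implicit Types (x y : 'rV[R]_d) (r : R).

Lemma rV_ballP x r y : ball x r y <-> 0 < r /\ forall l, `|x 0 l - y 0 l| < r.
Proof.
split=> -[r0 h]; split=> //; first by move=> l; exact: h.
by move=> i j; rewrite ord1; exact: h.
Qed.

Lemma rV_norm_le x r : 0 <= r -> (`|x| <= r) = [forall l, `|x 0 l| <= r].
Proof.
move=> r0; rewrite [`|x|]/Num.norm /= mx_normrE; apply/idP/forallP => [h l|h].
  by apply: le_trans h; exact: (le_bigmax _ (fun i : 'I_1 * 'I_d => `|x i.1 i.2|) (0, l)).
by apply: bigmax_le => // -[i j] _ /=; rewrite ord1.
Qed.

Lemma le_rV_norm x l : `|x 0 l| <= `|x|.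
Proof. by have := lexx `|x|; rewrite rV_norm_le// => /forallP. Qed.

Definition box r : set 'rV[R]_d := [set x | forall l, `|x 0 l| <= r].

Lemma box_compact r : compact (box r).
Proof.
rewrite (_ : box r = [set v : 'rV[R]_d | forall i, [set` `[- r, r]] (v ord0 i)]).
  by apply: (@rV_compact _ _ (fun=> `[- r, r]%classic)) => i; exact: segment_compact.
by apply/seteqP; split => x h l; have := h l; rewrite /= in_itv/= ler_norml.
Qed.

Lemma coor_continuous (l : 'I_d) : continuous (fun x : 'rV[R]_d => x 0 l).
Proof. exact: coord_continuous. Qed.

Lemma compact_bound (K : set 'rV[R]_d) (f : 'rV[R]_d -> R) :
  compact K -> continuous f -> exists2 M : R, 0 < M & forall x, K x -> `|f x| <= M.
Proof.
move=> cK cf; have : compact (f @` K).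
  by apply: continuous_compact => //; exact: continuous_subspaceT.
move=> /compact_bounded[M [Mr HM]].
exists (Num.max (M + 1) 1) => [|x Kx]; first by rewrite lt_max ltr01 orbT.
apply: (HM (Num.max (M + 1) 1)); last by exists x.
by rewrite lt_max ltrDl ltr01.
Qed.

Lemma box_bounded r : 0 <= r -> box r `<=` ball 0 (r + 1).
Proof.
move=> r0 x h; apply/rV_ballP; split=> [|l]; first by rewrite ltr_wpDl.
by rewrite mxE sub0r normrN (le_lt_trans (h l))// ltrDl.
Qed.

Lemma bounded_subbox (A : set 'rV[R]_d) : bounded_set A -> exists n : nat, A `<=` box n%:R.
Proof.
move=> [M [Mr HM]].
have [n Mn] : exists n : nat, M + 1 <= n%:R.
  exists (Num.bound (M + 1)); have [h|h] := leP 0 (M + 1).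
    by rewrite ltW// archi_boundP.
  by rewrite (le_trans (ltW h)).
exists n => x Kx l; apply: le_trans (le_rV_norm x l) _; apply: le_trans Mn.
by apply: (HM (M + 1)) => //; rewrite ltrDl.
Qed.

Lemma compact_subbox (K : set 'rV[R]_d) : compact K -> exists n : nat, K `<=` box n%:R.
Proof. by move=> /compact_bounded/bounded_subbox. Qed.

End row_vectors.

Section continuity.
Context {R : realType} {T : topologicalType}.
Implicit Types f g : T -> R.

Lemma continuous_add f g : continuous f -> continuous g ->
  continuous (fun x => f x + g x).
Proof. by move=> cf cg x; apply: (@continuousD _ R^o _ f g x); [exact: cf|exact: cg]. Qed.

Lemma continuous_mul f g : continuous f -> continuous g ->
  continuous (fun x => f x * g x).
Proof. by move=> cf cg x; apply: (@continuousM _ _ f g x); [exact: cf|exact: cg]. Qed.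

Lemma continuous_opp f : continuous f -> continuous (fun x => - f x).
Proof. by move=> cf x; apply: (@cvgN R R^o T (nbhs x) _ f (f x)); exact: cf. Qed.

Lemma continuous_sub f g : continuous f -> continuous g ->
  continuous (fun x => f x - g x).
Proof. by move=> cf /continuous_opp; exact: continuous_add. Qed.

Lemma continuous_sum (I : Type) (s : seq I) (F : I -> T -> R) :
  (forall i, continuous (F i)) -> continuous (fun x => \sum_(i <- s) F i x).
Proof.
move=> H; elim: s => [|i s IH].
  rewrite (_ : (fun x => _) = (fun=> 0)); first exact: cst_continuous.
  by apply/funext => x; rewrite big_nil.
rewrite (_ : (fun x => _) = (fun x => F i x + \sum_(j <- s) F j x)); first exact: continuous_add.
by apply/funext => x; rewrite big_cons.
Qed.

End continuity.

Lemma continuous_to_rV {R : realType} {d : nat} {T : topologicalType} (g : T -> 'rV[R]_d) :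
  (forall l, continuous (fun x => g x 0 l)) -> continuous g.
Proof.
move=> cg x; apply/cvg_ballP => e e0.
have : \forall t \near nbhs x, forall l, `|g x 0 l - g t 0 l| < e.
  apply: filter_forall => l; have /cvg_ballP/(_ e e0) := cg l x.
  by apply: filterS.
by apply: filterS => t H; apply/rV_ballP.
Qed.

Section derive_comp_affine.
Context {R : realType} {U V W : normedModType R}.
Variables (phi : U -> V) (f : V -> W) (x u : U) (v : V).
Hypothesis phiE : forall s : R, phi (s *: u + x) = s *: v + phi x.

Let quotientE : (fun h : R => h^-1 *: (((f \o phi) \o shift x) (h *: u) - (f \o phi) x)) =
  (fun h : R => h^-1 *: ((f \o shift (phi x)) (h *: v) - f (phi x))).
Proof. by apply/funext => h; rewrite /= phiE. Qed.

(** The difference quotients of [f \o phi] and [f] are the same function of the increment, so that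
    no differentiability is involved. This serves for lines [s *: v + x] and for the slices
    [cons_rV]. *)
Lemma derivable_comp_affine : derivable (f \o phi) x u <-> derivable f (phi x) v.
Proof. by rewrite /derivable quotientE. Qed.

Lemma derive_comp_affine : 'D_u (f \o phi) x = 'D_v f (phi x).
Proof. by rewrite /derive quotientE. Qed.

End derive_comp_affine.

(** * Simplicial complexes and piecewise affine functions *)

Lemma sum_delta (R : pzRingType) (I : finType) (i0 : I) (f : I -> R) :
  \sum_i (i == i0)%:R * f i = f i0.
Proof.
rewrite (bigD1 i0)//= eqxx mul1r big1 ?addr0// => i /negbTE ->.
by rewrite mul0r.
Qed.

Lemma sum_delta_scale (R : pzRingType) (V : lmodType R) (I : finType) (i0 : I)
  (f : I -> V) : \sum_i (i == i0)%:R *: f i = f i0.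
Proof.
rewrite (bigD1 i0)//= eqxx scale1r big1 ?addr0// => i /negbTE ->.
by rewrite scale0r.
Qed.

Section barycentric.
Context {R : realType} {d : nat}.
Implicit Types (v : 'I_d.+1 -> 'rV[R]_d) (al : 'I_d.+1 -> R).

Definition bary_coords al := (forall i, 0 <= al i) /\ \sum_i al i = 1.

Definition bary v al : 'rV[R]_d := \sum_i al i *: v i.

(** Indexed by points rather than by vertex numbers, so that the coordinates of a point in two
    different simplexes can be compared. *)
Definition bary_weight v al (p : 'rV[R]_d) : R :=
  \sum_i al i * (v i == p)%:R.

Lemma convex_set_bary (A : set 'rV[R]_d) v (s : seq 'I_d.+1) al :
  convex_set A -> (forall i, 0 <= al i) ->
  (forall i, al i != 0 -> A (v i)) -> 0 < \sum_(i <- s) al i ->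
  A ((\sum_(i <- s) al i)^-1 *: \sum_(i <- s) al i *: v i).
Proof.
move=> cA al0 Av; elim: s => [|i s IH]; first by rewrite big_nil ltxx.
rewrite !big_cons.
have [ai0|ai0] := eqVneq (al i) 0.
  by rewrite ai0 scale0r !add0r.
have aip : 0 < al i by rewrite lt_neqAle eq_sym ai0 al0.
have [s0|s0] := eqVneq (\sum_(j <- s) al j) 0.
  move=> _; have z j : j \in s -> al j = 0.
    move=> js; apply/eqP; move: s0 => /eqP; rewrite psumr_eq0// => /allP.
    by move=> /(_ _ js).
  rewrite s0 addr0 [X in _ + X]big_seq big1 ?addr0; last first.
    by move=> j js; rewrite z// scale0r.
  by rewrite scalerA mulVf// scale1r; exact: Av.
move=> tp; set S := \sum_(j <- s) al j in s0 tp IH *.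
have Sp : 0 < S by rewrite lt_neqAle eq_sym s0 sumr_ge0.
have r0 : 0 <= al i / (al i + S) by rewrite divr_ge0// ltW.
have r1 : al i / (al i + S) <= 1 by rewrite ler_pdivrMr// mul1r lerDl ltW.
have := cA _ _ (Itv01 r0 r1) (mem_set (Av _ ai0)) (mem_set (IH Sp)).
move=> /set_mem; set T := \sum_(j <- s) _ *: v j.
rewrite (_ : (al i + S)^-1 *: (al i *: v i + T) =
  (al i / (al i + S)) *: v i + (1 - al i / (al i + S)) *: (S^-1 *: T))//.
rewrite scalerDr !scalerA [(al i + S)^-1 * _]mulrC; congr (_ + _ *: _).
by field; rewrite !gt_eqF.
Qed.

Lemma bary_coords_delta (i0 : 'I_d.+1) :
  bary_coords (fun i => (i == i0)%:R : R).
Proof.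
by split=> // ; have := sum_delta i0 (fun=> 1 : R); under eq_bigr do rewrite mulr1.
Qed.

Lemma convex_hull_subP v (S : set 'rV[R]_d) x : S `<=` range v ->
  convex_hull S x <->
  exists al, [/\ bary_coords al, x = bary v al & forall i, al i != 0 -> S (v i)].
Proof.
move=> Sv; split.
- have : convex_hull S `<=` [set x | exists al,
      [/\ bary_coords al, x = bary v al & forall i, al i != 0 -> S (v i)]].
    apply: smallest_sub.
      move=> y z l /set_mem/= [al [[a0 a1] -> aS]] /set_mem/= [be [[b0 b1] -> bS]].
      apply/mem_set => /=.
      have l0 : 0 <= l%:num by [].
      have l1 : 0 <= 1 - l%:num by rewrite subr_ge0.
      exists (fun i => l%:num * al i + (1 - l%:num) * be i); split.
      + split=> [i|]; first by rewrite addr_ge0// mulr_ge0.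
        by rewrite big_split/= -!mulr_sumr a1 b1; ring.
      + rewrite /conv/= /bary !scaler_sumr -big_split/=; apply: eq_bigr => i _.
        by rewrite [RHS]scalerDl -!scalerA.
      + move=> i; have [->|+ _] := eqVneq (al i) 0; last exact: aS.
        by have [->|+ _] := eqVneq (be i) 0; [rewrite !mulr0 addr0 eqxx|exact: bS].
    move=> p Sp; have [i _ ip] := Sv _ Sp.
    exists (fun j => (j == i)%:R); split; first exact: bary_coords_delta.
      by rewrite /bary sum_delta_scale.
    by move=> j; have [->|_] := eqVneq j i; rewrite ?eqxx// ip.
  by apply.
- move=> [al [[a0 a1] -> aS]] A [cA SA].
  have := @convex_set_bary A v (index_enum _) al cA a0 (fun i h => SA _ (aS i h)).
  by rewrite a1 invr1 scale1r; apply; exact: ltr01.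
Qed.

Lemma simplexP v x :
  simplex v x <-> exists2 al, bary_coords al & x = bary v al.
Proof.
have sv : range v `<=` range v by []. rewrite /simplex (convex_hull_subP _ sv); split.
  by move=> [al [? ? _]]; exists al.
by move=> [al ? ?]; exists al; split => // i _; exists i.
Qed.

Lemma bary_weight_ge0 v al p : bary_coords al -> 0 <= bary_weight v al p.
Proof. by move=> [a0 _]; apply: sumr_ge0 => i _; rewrite mulr_ge0. Qed.

Lemma bary_weight_gt0 v al i : bary_coords al -> al i != 0 ->
  0 < bary_weight v al (v i).
Proof.
move=> [a0 _] ai; rewrite /bary_weight (bigD1 i)//= eqxx mulr1.
rewrite ltr_pwDl//; first by rewrite lt_neqAle eq_sym ai a0.
by apply: sumr_ge0 => j _; rewrite mulr_ge0.
Qed.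

Lemma bary_weight_neq0 v al p : bary_weight v al p != 0 -> exists i,
  al i != 0 /\ v i = p.
Proof.
move=> /eqP wp; apply: contrapT => h; apply: wp; apply: big1 => i _.
have [vp|] := eqVneq (v i) p; last by rewrite mulr0.
have [->|ai] := eqVneq (al i) 0; first by rewrite mul0r.
by exfalso; apply: h; exists i.
Qed.

Lemma bary_weight_delta v i p :
  bary_weight v (fun j => (j == i)%:R) p = (v i == p)%:R.
Proof. by rewrite /bary_weight sum_delta. Qed.

(* Encodes a face-to-face simplicial complex by its barycentric coordinates:
   [W x p] is the coordinate of [x] at the vertex [p], whichever simplex
   containing [x] it is computed in. *)
Definition triangulation (T : nat -> 'I_d.+1 -> 'rV[R]_d)
    (W : 'rV[R]_d -> 'rV[R]_d -> R) :=
  [/\ forall k, is_simplex_vertices (T k),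
      forall x, exists k, simplex (T k) x,
      forall k al, bary_coords al ->
        bary_weight (T k) al = W (bary (T k) al) &
      forall x r, finite_set [set k | (simplex (T k) `&` ball x r) !=set0]].

(** The intersection is spanned by the common vertices: the weight of [x] at a point is the same in
    both simplexes, so a vertex with nonzero weight in one is a vertex of the other. *)
Lemma triangulation_face T W h k : triangulation T W ->
  is_face (T k) (simplex (T k) `&` simplex (T h)).
Proof.
move=> [_ _ wW _]; exists (range (T k) `&` range (T h)) => [x []//|].
have Sk : range (T k) `&` range (T h) `<=` range (T k) by move=> x [].
have Sh : range (T k) `&` range (T h) `<=` range (T h) by move=> x [].
apply/seteqP; split=> [x [/simplexP[al ca xa] /simplexP[be cb xb]]|x Sx].
  apply/(convex_hull_subP _ Sk); exists al; split=> // i ai.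
  have := bary_weight_gt0 (T k) ca ai.
  rewrite wW// -xa xb -wW// => /lt0r_neq0/bary_weight_neq0 [j [_ jE]].
  by split; [exists i|exists j].
split; apply/simplexP.
  by have /(convex_hull_subP _ Sk)[al [? ? _]] := Sx; exists al.
by have /(convex_hull_subP _ Sh)[al [? ? _]] := Sx; exists al.
Qed.

End barycentric.

(** * Stellar subdivision at a point of an edge *)

Section stellar.
Context {R : realType} {d : nat}.
Implicit Types (v : 'I_d.+1 -> 'rV[R]_d) (al : 'I_d.+1 -> R) (a b c p : 'rV[R]_d).

Definition replace_vertex v a c : 'I_d.+1 -> 'rV[R]_d :=
  fun i => if v i == a then c else v i.

Definition has_vertex v a := [exists i, v i == a].

Lemma has_vertexP v a : reflect (exists i, v i = a) (has_vertex v a).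
Proof. by apply: (iffP existsP) => -[i /eqP]; exists i => //; apply/eqP. Qed.

(** The coefficient [g] carried by [c] is redistributed: [(1 - t) * g] goes to [a] and [t * g] to
    [b]. *)
Lemma replace_vertex_coords v a b c (t : R) al :
  0 < t -> t < 1 -> c = (1 - t) *: a + t *: b ->
  has_vertex v a -> has_vertex v b -> bary_coords al ->
  let g := \sum_i al i * (v i == a)%:R in
  exists be, [/\ bary_coords be, bary v be = bary (replace_vertex v a c) al &
    forall p, bary_weight v be p =
      \sum_(i | v i != a) al i * (v i == p)%:R +
      (1 - t) * g * (a == p)%:R + t * g * (b == p)%:R].
Proof.
move=> t0 t1 cE /has_vertexP[ia iaE] /has_vertexP[ib ibE] [al0 al1] g.
have g0 : 0 <= g by apply: sumr_ge0 => i _; rewrite mulr_ge0.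
exists (fun i => al i * (v i != a)%:R +
   ((i == ia)%:R * ((1 - t) * g) + (i == ib)%:R * (t * g))); split.
- split=> [i|].
    by rewrite !addr_ge0// !mulr_ge0// ?subr_ge0 ltW.
  rewrite !big_split/= !sum_delta -mulrDl subrK mul1r /g -big_split/= -[RHS]al1.
  apply: eq_bigr => i _; rewrite -mulrDr.
  by case: (v i == a); rewrite ?addr0 ?add0r mulr1.
- rewrite /bary.
  have -> : \sum_i al i *: replace_vertex v a c i =
      \sum_i (al i * (v i != a)%:R) *: v i + g *: c.
    rewrite /g scaler_suml -big_split/=; apply: eq_bigr => i _.
    rewrite /replace_vertex; case: (v i == a).
      by rewrite mulr0 mulr1 scale0r add0r.
    by rewrite mulr0 mulr1 scale0r addr0.
  under eq_bigr do rewrite !scalerDl -!scalerA.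
  rewrite !big_split/= !sum_delta_scale iaE ibE; congr (_ + _).
    by apply: eq_bigr => i _; rewrite scalerA.
  by rewrite cE scalerDr !scalerA [g * _]mulrC [g * t]mulrC.
- move=> p; rewrite /bary_weight; under eq_bigr do rewrite !mulrDl -[_ * _ * (v _ == p)%:R]mulrA -![(_ == ia)%:R * _ * _]mulrA -![(_ == ib)%:R * _ * _]mulrA.
  rewrite !big_split/= !sum_delta iaE ibE -addrA; congr (_ + _); last by ring.
  rewrite [RHS]big_mkcond/=; apply: eq_bigr => i _.
  by case: (v i == a); rewrite ?mul0r ?mulr0 ?mul1r.
Qed.

(** The coordinates after subdivision at [c = (1 - t) *: a + t *: b]. The weight [g] at [c] is the
    largest one that can be split off while the weights left at [a] and [b] stay nonnegative; the
    term attaining the minimum tells which of the two halves contains the point. *)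
Definition split_weight a b c (t : R) (W : 'rV[R]_d -> R) p : R :=
  let g := Num.min (W a / (1 - t)) (W b / t) in
  if p == c then g else if p == a then W a - (1 - t) * g
  else if p == b then W b - t * g else W p.

Lemma split_weight_sym a b c (t : R) W : a != b ->
  split_weight a b c t W = split_weight b a c (1 - t) W.
Proof.
move=> ab; apply/funext => p; rewrite /split_weight.
rewrite (_ : 1 - (1 - t) = t); last by ring.
rewrite [X in _ = if _ then X else _]minC.
case: eqP => // _; case: (eqVneq p a) => [->|//].
  by rewrite (negbTE ab) minC.
by case: eqVneq => // _; rewrite minC.
Qed.

(** In the half where [c] replaces [a], all the weight at [a] comes from [c]; so the first term
    attains the minimum in [split_weight] and equals the coefficient at [c]. *)
Lemma replace_vertex_weight v a b c (t : R) al W :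
  a != b -> 0 < t -> t < 1 -> c = (1 - t) *: a + t *: b ->
  has_vertex v a -> has_vertex v b -> ~~ has_vertex v c ->
  bary_coords al ->
  (forall be, bary_coords be -> bary_weight v be = W (bary v be)) ->
  bary_weight (replace_vertex v a c) al =
    split_weight a b c t (W (bary (replace_vertex v a c) al)).
Proof.
move=> ab t0 t1 cE va vb /has_vertexP vc cal wW.
have [be [cbe bE wE]] := replace_vertex_coords t0 t1 cE va vb cal.
set g := \sum_i al i * (v i == a)%:R in wE.
have g0 : 0 <= g by apply: sumr_ge0 => i _; rewrite mulr_ge0//; case: cal.
have ca : c != a.
  apply/eqP => ca; have : t *: (b - a) = 0.
    have /eqP : c - a = 0 by rewrite ca subrr.
    by rewrite cE scalerBl scale1r => /eqP <-; rewrite scalerBr addrAC [a - _]addrC addrK addrC.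
  by move/eqP; rewrite scaler_eq0 subr_eq0 [b == a]eq_sym (negbTE ab) gt_eqF.
have cb : c != b.
  by apply/eqP => cb; case/has_vertexP : vb => i ib; apply: vc; exists i; rewrite cb.
rewrite -bE -wW//.
set B := \sum_(i | v i != a) al i * (v i == b)%:R.
have B0 : 0 <= B by apply: sumr_ge0 => i _; rewrite mulr_ge0//; case: cal.
have Wa : bary_weight v be a = (1 - t) * g.
  rewrite wE eqxx [b == a]eq_sym (negbTE ab) mulr0 addr0 mulr1 big1 ?add0r//.
  by move=> i /negbTE ->; rewrite mulr0.
have Wb : bary_weight v be b = B + t * g.
  by rewrite wE eqxx (negbTE ab) mulr0 addr0 mulr1.
have t1' : 1 - t != 0 by rewrite subr_eq0 gt_eqF.
have t0' : t != 0 by rewrite gt_eqF.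
have gE : Num.min (bary_weight v be a / (1 - t)) (bary_weight v be b / t) = g.
  rewrite Wa Wb (_ : (1 - t) * g / (1 - t) = g); last by field.
  rewrite (_ : (B + t * g) / t = g + B / t); last by field.
  by apply/min_idPl; rewrite lerDl divr_ge0// ltW.
apply/funext => p; rewrite /split_weight gE.
have wr : bary_weight (replace_vertex v a c) al p =
    g * (c == p)%:R + \sum_(i | v i != a) al i * (v i == p)%:R.
  rewrite [X in _ + X]big_mkcond mulr_suml -big_split/=; apply: eq_bigr => i _.
  rewrite /replace_vertex; case: (v i == a) => /=; first by rewrite mulr1 addr0.
  by rewrite mulr0 mul0r add0r.
rewrite wr eq_sym; case: eqVneq => [->|pc].
  rewrite mulr1 big1 ?addr0// => i _; case: eqP; rewrite ?mulr0// => vic.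
  by exfalso; apply: vc; exists i.
rewrite mulr0 add0r; case: eqVneq => [->|pa].
  rewrite Wa subrr big1// => i /negbTE ->; exact: mulr0.
case: eqVneq => [->|pb]; first by rewrite Wb addrK.
by rewrite wE ![_ == p]eq_sym (negbTE pa) (negbTE pb) !mulr0 !addr0.
Qed.

Lemma replace_vertex_sub v a b c (t : R) :
  0 < t -> t < 1 -> c = (1 - t) *: a + t *: b ->
  has_vertex v a -> has_vertex v b ->
  simplex (replace_vertex v a c) `<=` simplex v.
Proof.
move=> t0 t1 cE va vb x /simplexP[al cal ->].
have [be [cbe bE _]] := replace_vertex_coords t0 t1 cE va vb cal.
by apply/simplexP; exists be.
Qed.

(** A hyperplane through [b] and [c] contains their line, hence [a]. *)
Lemma replace_vertex_nondeg v a b c (t : R) :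
  a != b -> t < 1 -> c = (1 - t) *: a + t *: b ->
  has_vertex v a -> has_vertex v b ->
  is_simplex_vertices v -> is_simplex_vertices (replace_vertex v a c).
Proof.
move=> ab t1 cE /has_vertexP[ia iaE] /has_vertexP[ib ibE] nv [n [r [n0 H]]].
apply: nv; exists n, r; split=> // x [i _ <-].
have Hc : dotp n c = r.
  by apply: H; exists ia => //; rewrite /replace_vertex iaE eqxx.
have Hb : dotp n b = r.
  by apply: H; exists ib => //; rewrite /replace_vertex ibE eq_sym (negbTE ab).
have dE : dotp n c = (1 - t) * dotp n a + t * dotp n b.
  rewrite cE /dotp !mulr_sumr -big_split/=; apply: eq_bigr => j _.
  by rewrite !mxE; ring.
have Ha : dotp n a = r.
  have t1' : 1 - t != 0 by rewrite subr_eq0 gt_eqF.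
  apply: (mulfI t1'); move: dE; rewrite Hc Hb => dE.
  by rewrite [RHS]mulrBl mul1r; apply/esym/eqP; rewrite subr_eq -dE.
have [->//|va] := eqVneq (v i) a.
by apply: H; exists i => //; rewrite /replace_vertex (negbTE va).
Qed.

Lemma split_simplex_cover v a b c (t : R) :
  a != b -> 0 < t -> t < 1 -> c = (1 - t) *: a + t *: b ->
  has_vertex v a -> has_vertex v b ->
  simplex v `<=` simplex (replace_vertex v a c) `|` simplex (replace_vertex v b c).
Proof.
move=> ab t0 t1 cE va vb x /simplexP[al cal ->].
pose A := \sum_i al i * (v i == a)%:R; pose B := \sum_i al i * (v i == b)%:R.
(* Exchanging [a] and [b] turns [t] into [1 - t]. The inequality says that the weight at [a] is
   exhausted first when multiples of [c] are split off. *)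
wlog AB : a b c t ab t0 t1 cE va vb @A @B / t * A <= (1 - t) * B.
  move=> wl; have [h|/ltW h] := leP (t * A) ((1 - t) * B); first exact: (wl a b c t).
  rewrite setUC; apply: (wl b a c (1 - t)) => //.
  - by rewrite eq_sym.
  - by rewrite subr_gt0.
  - by rewrite ltrBlDr ltrDl.
  - by rewrite subKr addrC.
  - by rewrite subKr.
left; apply/simplexP; have [al0 al1] := cal.
have A0 : 0 <= A by apply: sumr_ge0 => i _; rewrite mulr_ge0.
case/has_vertexP : va => ia iaE; case/has_vertexP : vb => ib ibE.
have t1' : 1 - t != 0 by rewrite subr_eq0 gt_eqF.
have t1p : 0 < 1 - t by rewrite subr_gt0.
pose g := A / (1 - t).
have g0 : 0 <= g by rewrite divr_ge0// ltW.
have gE : A = (1 - t) * g by rewrite /g; field.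
clearbody g.
have Btg : 0 <= B - t * g.
  rewrite subr_ge0 -(ler_pM2l t1p); apply: le_trans AB.
  by rewrite mulrCA -gE.
pose h i : R := (v i != a)%:R * (v i != b)%:R.
have hE i : h i + (v i == a)%:R + (v i == b)%:R = 1.
  rewrite /h; case: (eqVneq (v i) a) => [->|]; last by case: (v i == b); rewrite ?mul1r ?mulr0 ?addr0 ?add0r.
  by rewrite (negbTE ab) mul0r add0r addr0.
have h0 i : 0 <= h i by rewrite mulr_ge0.
exists (fun i => al i * h i + ((i == ia)%:R * g + (i == ib)%:R * (B - t * g))).
  split=> [i|].
    apply: addr_ge0; first exact: mulr_ge0.
    by apply: addr_ge0; exact: mulr_ge0.
  rewrite !big_split/= !sum_delta -[RHS]al1 (_ : g + _ = A + B); last by rewrite gE; ring.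
  rewrite /A /B -!big_split/=; apply: eq_bigr => i _.
  by rewrite -!mulrDr addrA hE mulr1.
rewrite /bary.
under [RHS]eq_bigr do rewrite !scalerDl -!scalerA.
rewrite !big_split/= !sum_delta_scale /replace_vertex iaE eqxx ibE [b == a]eq_sym (negbTE ab).
rewrite (_ : g *: c + _ = A *: a + B *: b); last first.
  rewrite gE cE; apply/rowP => j; rewrite !mxE; ring.
rewrite /A /B !scaler_suml -!big_split/=; apply: eq_bigr => i _.
rewrite [LHS](_ : _ = (al i * h i) *: v i +
  ((al i * (v i == a)%:R) *: v i + (al i * (v i == b)%:R) *: v i)); last first.
  by rewrite -!scalerDl -!mulrDr addrA hE mulr1.
congr (_ + (_ + _)).
- rewrite /h -!scalerA; congr (_ *: _); case: (eqVneq (v i) a) => [_|//].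
  by rewrite !scale0r.
- rewrite -!scalerA; congr (_ *: _); case: eqVneq => [->|] //; by rewrite !scale0r.
- rewrite -!scalerA; congr (_ *: _); case: eqVneq => [->|] //; by rewrite !scale0r.
Qed.

End stellar.

(** * Removing the edges that cross hyperplanes *)

Section refinement.
Context {R : realType} {d : nat}.
Implicit Types (T : nat -> 'I_d.+1 -> 'rV[R]_d) (a b c p : 'rV[R]_d).

Lemma bary_weight_notin (v : 'I_d.+1 -> 'rV[R]_d) al p :
  ~~ has_vertex v p -> bary_weight v al p = 0.
Proof.
move=> /has_vertexP vp; apply: big1 => i _; case: eqP => [vi|]; last by rewrite mulr0.
by exfalso; apply: vp; exists i.
Qed.

(** If [c] were a vertex, its weight at [a] would be 0, whereas the simplex containing the edge
    gives [1 - t]. *)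
Lemma triangulation_fresh T W k h a b c (t : R) :
  triangulation T W -> a != b -> 0 < t -> t < 1 -> c = (1 - t) *: a + t *: b ->
  has_vertex (T k) a -> has_vertex (T k) b -> ~~ has_vertex (T h) c.
Proof.
move=> [_ _ wW _] ab t0 t1 cE /has_vertexP[ia iaE] /has_vertexP[ib ibE].
apply/has_vertexP => -[i iE].
have ca : c != a.
  apply/eqP => ca; have : t *: (b - a) = 0.
    have /eqP : c - a = 0 by rewrite ca subrr.
    by rewrite cE scalerBl scale1r => /eqP <-; rewrite scalerBr addrAC [a - _]addrC addrK addrC.
  by move/eqP; rewrite scaler_eq0 subr_eq0 [b == a]eq_sym (negbTE ab) gt_eqF.
pose al j : R := (j == ia)%:R * (1 - t) + (j == ib)%:R * t.
have cal : bary_coords al.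
  split=> [j|]; last by rewrite big_split/= !sum_delta subrK.
  by rewrite /al addr_ge0// mulr_ge0// ?subr_ge0 ltW.
have bE : bary (T k) al = c.
  rewrite /bary; under eq_bigr do rewrite scalerDl -!scalerA.
  by rewrite big_split/= !sum_delta_scale iaE ibE cE.
have := wW k al cal; rewrite bE => /(congr1 (@^~ a)).
have := wW h _ (bary_coords_delta i).
rewrite /bary sum_delta_scale iE => <-; rewrite bary_weight_delta iE (negbTE ca).
rewrite /bary_weight; under eq_bigr do rewrite mulrDl -!mulrA.
rewrite big_split/= !sum_delta iaE ibE eqxx [b == a]eq_sym (negbTE ab).
by rewrite mulr1 mulr0 addr0 => /eqP; rewrite subr_eq0 gt_eqF.
Qed.

(** The conclusion is what an induction on edges requires: apart from those ending at [c], no edge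
    is created, and the edge from [a] to [b] is gone. *)
Lemma stellar_subdivision T W a b c (t : R) :
  triangulation T W -> a != b -> 0 < t -> t < 1 -> c = (1 - t) *: a + t *: b ->
  exists T' W', triangulation T' W' /\ forall n, exists k,
    [/\ simplex (T' n) `<=` simplex (T k),
        forall p, has_vertex (T' n) p -> p = c \/ has_vertex (T k) p &
        ~ (has_vertex (T' n) a /\ has_vertex (T' n) b)].
Proof.
move=> tT ab t0 t1 cE.
(* When no simplex contains the edge, [c] may already be a vertex; then nothing is subdivided. *)
have [[k0 /andP[k0a k0b]]|nok] := pselect (exists k, has_vertex (T k) a && has_vertex (T k) b); last first.
  exists T, W; split=> // n; exists n; split=> //; first by right.
  by move=> /andP h; apply: nok; exists n.
have fresh h := triangulation_fresh h tT ab t0 t1 cE k0a k0b.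
have ba : b != a by rewrite eq_sym.
have t0' : 0 < 1 - t by rewrite subr_gt0.
have t1' : 1 - t < 1 by rewrite ltrBlDr ltrDl.
have cE' : c = (1 - (1 - t)) *: b + (1 - t) *: a by rewrite subKr addrC.
have vc v p q : has_vertex v a -> has_vertex (replace_vertex v p c) q ->
    q = c \/ has_vertex v q.
  move=> va /has_vertexP[i]; rewrite /replace_vertex.
  by case: ifP => _ <-; [left|right; apply/has_vertexP; exists i].
have vn (v : 'I_d.+1 -> 'rV[R]_d) p : ~~ has_vertex v c -> has_vertex v p ->
    ~~ has_vertex (replace_vertex v p c) p.
  move=> vc0 /has_vertexP[j jE]; apply/has_vertexP => -[i]; rewrite /replace_vertex.
  case: (eqVneq (v i) p) => [_ cp|/eqP//].
  by case/has_vertexP : vc0; exists j; rewrite jE.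
case: (tT) => nT cT wW fT.
(* Halving the index leaves two slots for each simplex, one for each half. A simplex without the
   edge is listed twice, which is harmless since a simplex is a face of itself. *)
pose T' n := let v := T n./2 in
  if has_vertex v a && has_vertex v b then
    (if odd n then replace_vertex v a c else replace_vertex v b c) else v.
have subT n : simplex (T' n) `<=` simplex (T n./2).
  rewrite /T' /=; case: ifPn => [/andP[va vb]|_ x //]; case: ifP => _.
    exact: replace_vertex_sub t0 t1 cE va vb.
  exact: replace_vertex_sub t0' t1' cE' vb va.
exists T', (fun x => split_weight a b c t (W x)); split; last first.
  move=> n; exists n./2; split => // [p|].
    rewrite /T'; case: ifP => [/andP[va vb]|_ ?]; last by right.
    by case: ifP => _; exact: vc.
  rewrite /T'; case: ifP => [/andP[va vb]|nab [va vb]]; last by rewrite va vb in nab.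
  case: ifP => _ [h1 h2].
    by have := vn _ a (fresh n./2) va; rewrite h1.
  by have := vn _ b (fresh n./2) vb; rewrite h2.
split.
- move=> n; rewrite /T'; case: ifP => // /andP[va vb]; case: ifP => _.
    exact: replace_vertex_nondeg ab t1 cE va vb (nT _).
  exact: replace_vertex_nondeg ba t1' cE' vb va (nT _).
- move=> x; have [k xk] := cT x.
  have [/andP[va vb]|nab] := boolP (has_vertex (T k) a && has_vertex (T k) b).
    have [h|h] := split_simplex_cover ab t0 t1 cE va vb xk.
      by exists k.*2.+1; rewrite /T' /= uphalf_double va vb odd_double.
    by exists k.*2; rewrite /T' doubleK va vb odd_double.
  by exists k.*2; rewrite /T' doubleK (negbTE nab).
- move=> n al cal; rewrite /T'; case: ifPn => [/andP[va vb]|nab].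
    case: ifP => _.
      by apply: (replace_vertex_weight ab t0 t1 cE va vb (fresh _) cal) => be; exact: wW.
    rewrite split_weight_sym//.
    by apply: (replace_vertex_weight ba t0' t1' cE' vb va (fresh _) cal) => be; exact: wW.
  rewrite -wW//; apply/funext => p; rewrite /split_weight.
  set g := Num.min _ _.
  have -> : g = 0.
    rewrite /g; have w0 q := bary_weight_ge0 (T n./2) q cal.
    move: nab; rewrite negb_and => /orP[] h; rewrite (bary_weight_notin al h) mul0r.
      by apply/min_idPl; rewrite divr_ge0// ltW.
    by apply/min_idPr; rewrite divr_ge0// ltW.
  rewrite !mulr0 !subr0; case: eqVneq => [->|_]; first by rewrite bary_weight_notin.
  by do 2 (case: eqVneq => [->//|_]).
- move=> x r; have := fT x r; set F := [set k | _] => fF.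
  apply: (@sub_finite_set _ _ ((double @` F) `|` ((fun k => k.*2.+1) @` F))); last first.
    by rewrite finite_setU; split; exact: finite_image.
  move=> n /= [y [Ty By]].
  have Fn : F n./2 by exists y; split => //; exact: subT Ty.
  have [on|on] := boolP (odd n).
    by right; exists n./2 => //; rewrite -[RHS]odd_double_half on add1n.
  by left; exists n./2 => //; rewrite -[RHS]odd_double_half (negbTE on) add0n.
Qed.

Definition affine_form (l : 'rV[R]_d * R) (x : 'rV[R]_d) : R := dotp l.1 x + l.2.

Lemma affine_form_conv l a b (t : R) :
  affine_form l ((1 - t) *: a + t *: b) =
  (1 - t) * affine_form l a + t * affine_form l b.
Proof.
rewrite /affine_form (_ : dotp _ _ = (1 - t) * dotp l.1 a + t * dotp l.1 b); first by ring.
rewrite /dotp !mulr_sumr -big_split/=; apply: eq_bigr => i _; rewrite !mxE; ring.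
Qed.

Lemma affine_form_bary l (v : 'I_d.+1 -> 'rV[R]_d) al : bary_coords al ->
  affine_form l (bary v al) = \sum_i al i * affine_form l (v i).
Proof.
move=> [_ al1]; rewrite /affine_form; under eq_bigr do rewrite mulrDr.
rewrite big_split/= -mulr_suml al1 mul1r; congr (_ + _).
rewrite /dotp /bary; under [LHS]eq_bigr do rewrite summxE mulr_sumr.
rewrite exchange_big/=; apply: eq_bigr => i _; rewrite mulr_sumr.
by apply: eq_bigr => j _; rewrite !mxE; ring.
Qed.

Definition sign_on (A : set 'rV[R]_d) (f : 'rV[R]_d -> R) :=
  (forall x, A x -> 0 <= f x) \/ (forall x, A x -> f x <= 0).

(** Induction on a list [s] of all crossing edges, oriented from negative to positive. Subdividing
    at the zero of the form produces a vertex on the hyperplane, which is never an end of a crossing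
    edge, so the list loses its head and gains nothing. The set [C] keeps the list finite. *)
Lemma refine_edges l (C : set 'rV[R]_d) (s : seq ('rV[R]_d * 'rV[R]_d)) T W :
  triangulation T W ->
  (forall k a b, simplex (T k) `&` C !=set0 -> has_vertex (T k) a ->
     has_vertex (T k) b -> affine_form l a < 0 -> 0 < affine_form l b ->
     (a, b) \in s) ->
  exists T' W', [/\ triangulation T' W',
    forall n, exists k, simplex (T' n) `<=` simplex (T k) &
    forall n, simplex (T' n) `&` C !=set0 ->
      sign_on (simplex (T' n)) (affine_form l)].
Proof.
elim: s T W => [|[a b] s IH] T W tT H.
  exists T, W; split=> // n; first by exists n.
  move=> Cn.
  have [h|] := pselect (forall i, affine_form l (T n i) <= 0).
    right=> x /simplexP[al cal ->]; rewrite affine_form_bary//.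
    by apply: sumr_le0 => i _; rewrite mulr_ge0_le0//; case: cal.
  move=> /existsNP[i /negP]; rewrite -ltNge => li.
  left=> x /simplexP[al cal ->]; rewrite affine_form_bary//.
  apply: sumr_ge0 => j _; rewrite mulr_ge0//; first by case: cal.
  rewrite leNgt; apply/negP => lj.
  have vv k : has_vertex (T n) (T n k) by apply/has_vertexP; exists k.
  by have := H n (T n j) (T n i) Cn (vv _) (vv _) lj li.
have [/andP[la lb]|nab] := boolP ((affine_form l a < 0) && (0 < affine_form l b)); last first.
  apply: (IH T W) => // k p q Ck kp kq lp lq.
  have := H k p q Ck kp kq lp lq; rewrite inE => /orP[/eqP[pa qb]|//].
  by move: nab; rewrite -pa -qb lp lq.
have ab : a != b by apply/eqP => ab; move: la; rewrite ab ltNge ltW.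
have lba : 0 < affine_form l b - affine_form l a.
  by rewrite subr_gt0 (lt_trans la).
pose t := - affine_form l a / (affine_form l b - affine_form l a).
have t0 : 0 < t by rewrite divr_gt0// oppr_gt0.
have t1 : t < 1 by rewrite ltr_pdivrMr// mul1r ltrDr.
pose c := (1 - t) *: a + t *: b.
have lc : affine_form l c = 0.
  by rewrite affine_form_conv /t; field; rewrite gt_eqF.
have [T1 [W1 [tT1 H1]]] := stellar_subdivision tT ab t0 t1 (erefl c).
have [|T' [W' [tT' rT' sT']]] := IH T1 W1 tT1.
  move=> k p q [x [kx Cx]] kp kq lp lq.
  have [h [sub vs nab]] := H1 k.
  have hp : has_vertex (T h) p.
    by have [pc|//] := vs p kp; rewrite pc lc ltxx in lp.
  have hq : has_vertex (T h) q.
    by have [pc|//] := vs q kq; rewrite pc lc ltxx in lq.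
  have := H h p q _ hp hq lp lq; rewrite inE => /(_ _)/orP[].
  - by exists x; split => //; exact: sub.
  - by move=> /eqP[pa qb]; exfalso; apply: nab; rewrite -pa -qb.
  - by [].
exists T', W'; split=> // n; have [k kn] := rT' n.
by have [h [hk _ _]] := H1 k; exists h; exact: subset_trans kn hk.
Qed.

Lemma refine_hyperplane l (C : set 'rV[R]_d) x0 (r : R) T W : C `<=` ball x0 r ->
  triangulation T W ->
  exists T' W', [/\ triangulation T' W',
    forall n, exists k, simplex (T' n) `<=` simplex (T k) &
    forall n, simplex (T' n) `&` C !=set0 ->
      sign_on (simplex (T' n)) (affine_form l)].
Proof.
move=> Cr tT; have [_ _ _ /(_ x0 r)/finite_seqP[s sE]] := tT.
apply: (@refine_edges _ _ [seq (T k.1 k.2.1, T k.1 k.2.2) |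
  k <- [seq (k, ij) | k <- s, ij <- enum {: 'I_d.+1 * 'I_d.+1}]] _ _ tT).
move=> k a b [x [kx Cx]] /has_vertexP[i iE] /has_vertexP[j jE] _ _.
apply/mapP; exists (k, (i, j)); last by rewrite /= iE jE.
apply/allpairsP; exists (k, (i, j)); split => //=; last by rewrite mem_enum.
have : [set` s] k by rewrite -sE /=; exists x; split => //; exact: Cr.
by [].
Qed.

Lemma refine_hyperplanes (ls : seq ('rV[R]_d * R)) (C : set 'rV[R]_d) x0 (r : R) T W :
  C `<=` ball x0 r -> triangulation T W ->
  exists T' W', triangulation T' W' /\
    forall n l, simplex (T' n) `&` C !=set0 -> l \in ls ->
      sign_on (simplex (T' n)) (affine_form l).
Proof.
move=> Cr tT; elim: ls => [|l ls [T1 [W1 [tT1 H1]]]]; first by exists T, W.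
have [T' [W' [tT' rT' sT']]] := refine_hyperplane l Cr tT1.
exists T', W'; split => // n h Cn; rewrite inE => /orP[/eqP ->|hls]; first exact: sT'.
have [k kn] := rT' n.
have Ck : simplex (T1 k) `&` C !=set0.
  by case: Cn => x [nx Cx]; exists x; split => //; exact: kn.
have [h1|h1] := H1 k h Ck hls; [left|right] => x /kn; exact: h1.
Qed.

End refinement.

(** * Kuhn's triangulation *)

Section kuhn.
Context {R : realType} {d : nat}.

(** The monotone path from the corner [z] of a unit cube to the opposite one, in which coordinate
    [l] is raised at step [tau l]. *)
Definition kuhn_vertices (z : 'rV[int]_d) (tau : 'S_d) (i : 'I_d.+1) : 'rV[R]_d :=
  \row_l ((z 0 l)%:~R + (tau l < i)%N%:R).

Definition tail_sum (al : 'I_d.+1 -> R) (n : nat) : R := \sum_(i < d.+1 | (n <= i)%N) al i.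

Lemma bary_kuhn z tau al l : bary_coords al ->
  bary (kuhn_vertices z tau) al 0 l = (z 0 l)%:~R + tail_sum al (tau l).+1.
Proof.
move=> [_ al1]; rewrite /bary summxE; under eq_bigr do rewrite !mxE mulrDr.
rewrite big_split/= -mulr_suml al1 mul1r; congr (_ + _).
rewrite /tail_sum [RHS]big_mkcond/=; apply: eq_bigr => i _.
by case: ltnP; rewrite ?mulr1 ?mulr0.
Qed.

Lemma tail_sum0 al : bary_coords al -> tail_sum al 0 = 1.
Proof. by move=> [_ <-]. Qed.

Lemma tail_sumS al (i : 'I_d.+1) : tail_sum al i = al i + tail_sum al i.+1.
Proof.
rewrite /tail_sum (bigD1 i)//=; congr (_ + _); apply: eq_bigl => j.
by rewrite ltn_neqAle andbC eq_sym.
Qed.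

Lemma tail_sum_anti al m n : (m <= n)%N -> bary_coords al ->
  tail_sum al n <= tail_sum al m.
Proof.
move=> mn [al0 _]; rewrite /tail_sum big_mkcond [leRHS]big_mkcond/=.
apply: ler_sum => i _; case: ifP => ni; first by rewrite (leq_trans mn ni).
by case: ifP.
Qed.

Lemma tail_sum_ge al n : (d < n)%N -> tail_sum al n = 0.
Proof.
move=> dn; rewrite /tail_sum big1// => i; rewrite leqNgt => /negP[].
by rewrite (leq_trans _ dn)// ltn_ord.
Qed.

(** Coordinate [l] carries over once [th] reaches [1 - tail_sum al (tau l).+1], so on the i-th
    interval exactly the coordinates of rank below [i] have done so. That interval has length
    [al i]. *)
Lemma floor_kuhn z tau al (i : 'I_d.+1) (th : R) l : bary_coords al ->
  1 - tail_sum al i <= th -> th < 1 - tail_sum al i.+1 -> 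
  (Num.floor (bary (kuhn_vertices z tau) al 0 l + th))%:~R =
  kuhn_vertices z tau i 0 l :> R.
Proof.
move=> cal h1 h2; rewrite mxE bary_kuhn//.
set t := tail_sum al (tau l).+1.
have t0 : 0 <= t by apply: sumr_ge0 => j _; case: cal.
have t1 : t <= 1 by rewrite -(tail_sum0 cal) tail_sum_anti.
have ti : 0 <= tail_sum al i.+1 by apply: sumr_ge0 => j _; case: cal.
have ti1 : tail_sum al i <= 1 by rewrite -(tail_sum0 cal) tail_sum_anti.
suff -> : Num.floor ((z 0 l)%:~R + t + th) = (z 0 l + (tau l < i)%N%:R)%R.
  by rewrite intrD; case: (_ < _)%N.
apply: floor_def; case: (ltnP (tau l) i) => li.
  have := tail_sum_anti li cal; rewrite -/t => h.
  rewrite mulr1n !intrD; apply/andP; split; lra.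
have := @tail_sum_anti al i.+1 (tau l).+1 li cal; rewrite -/t => h.
rewrite mulr0n addr0 !intrD; apply/andP; split; lra.
Qed.

Lemma kuhn_vertices_inj z tau : injective (kuhn_vertices z tau).
Proof.
suff h (i j : 'I_d.+1) : (i < j)%N -> kuhn_vertices z tau i != kuhn_vertices z tau j.
  move=> i j ij; apply/val_inj; case: (ltngtP i j) => // /h; rewrite ij eqxx//.
move=> ij; apply/eqP; have id : (i < d)%N by rewrite (leq_trans ij)// -ltnS ltn_ord.
move=> /rowP/(_ (tau^-1%g (Ordinal id))); rewrite !mxE permKV /= ltnn ij.
by move=> /addrI/eqP; rewrite eq_sym oner_eq0.
Qed.

(** As [th] runs over [0, 1), rounding down [x + th (1, ..., 1)] visits the vertices of a Kuhn
    simplex containing [x], each for a time equal to its barycentric coordinate. The formula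
    mentions no simplex, which is how the triangulation is seen to be face-to-face. *)
Definition kuhn_weight (x p : 'rV[R]_d) : R :=
  fine (lebesgue_measure [set th : R | 0 <= th < 1 /\
    forall l, (Num.floor (x 0 l + th))%:~R = p 0 l]).

Lemma kuhn_interval al (th : R) : bary_coords al -> 0 <= th < 1 ->
  exists i : 'I_d.+1, 1 - tail_sum al i <= th < 1 - tail_sum al i.+1.
Proof.
move=> cal /andP[th0 th1].
have ex0 : exists n, (n <= d)%N && (1 - tail_sum al n <= th).
  by exists 0%N; rewrite tail_sum0// subrr.
have bd n : (n <= d)%N && (1 - tail_sum al n <= th) -> (n <= d)%N by case/andP.
have [n /andP[nd nth] nmax] := ex_maxnP ex0 bd.
exists (Ordinal (nd : (n < d.+1)%N)); rewrite nth /= ltNge; apply/negP => h.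
move: nd; rewrite leq_eqVlt => /orP[/eqP nd|nd].
  by move: h; rewrite tail_sum_ge ?nd// subr0 leNgt th1.
by have := nmax n.+1; rewrite nd h ltnn => /(_ isT).
Qed.

Lemma kuhn_weightE z tau al : bary_coords al ->
  bary_weight (kuhn_vertices z tau) al = kuhn_weight (bary (kuhn_vertices z tau) al).
Proof.
move=> cal; apply/funext => p; rewrite /kuhn_weight.
have [/existsP[i /eqP <-]|vp] := boolP [exists i, kuhn_vertices z tau i == p]; last first.
  rewrite bary_weight_notin//; set U := [set _ | _].
  suff -> : U = set0 by rewrite measure0.
  apply/seteqP; split => // th [th01 thp].
  have [i /andP[i1 i2]] := kuhn_interval cal th01.
  move/negP : vp; apply; apply/existsP; exists i; apply/eqP/rowP => l.
  by rewrite -thp -(floor_kuhn z tau l cal i1 i2).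
rewrite (_ : [set _ | _] = [set` `[1 - tail_sum al i, 1 - tail_sum al i.+1[]); last first.
  apply/seteqP; split => th /=.
    move=> [th01 thp]; have [j /andP[j1 j2]] := kuhn_interval cal th01.
    suff -> : i = j by rewrite in_itv/= j1.
    apply: (@kuhn_vertices_inj z tau); apply/rowP => l.
    by rewrite -thp -(floor_kuhn z tau l cal j1 j2).
  rewrite in_itv/= => /andP[i1 i2]; split; last by move=> l; rewrite (floor_kuhn _ _ _ cal i1 i2).
  have ti : 0 <= tail_sum al i.+1 by apply: sumr_ge0 => j _; case: cal.
  have ti1 : tail_sum al i <= 1 by rewrite -(tail_sum0 cal) tail_sum_anti.
  by apply/andP; split; lra.
rewrite lebesgue_measure_itv/= lte_fin tail_sumS.
have ai : 0 <= al i by case: cal.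
have -> : bary_weight (kuhn_vertices z tau) al (kuhn_vertices z tau i) = al i.
  rewrite /bary_weight; under eq_bigr do rewrite mulrC (inj_eq (@kuhn_vertices_inj z tau)).
  by rewrite sum_delta.
by case: ltP => h /=; [ring|lra].
Qed.

Lemma kuhn_vertices_nondeg z tau : is_simplex_vertices (kuhn_vertices z tau).
Proof.
move=> [n [r [/eqP n0 H]]]; apply: n0; apply/rowP => l; rewrite mxE.
have h i : dotp n (kuhn_vertices z tau i) = r by apply: H; exists i.
have i1 : (tau l < d.+1)%N by rewrite ltnW// ltnS.
have i2 : ((tau l).+1 < d.+1)%N by rewrite ltnS.
have /eqP : dotp n (kuhn_vertices z tau (Ordinal i2)) - dotp n (kuhn_vertices z tau (Ordinal i1)) = 0.
  by rewrite !h subrr.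
rewrite /dotp -sumrB (bigD1 l)//= big1 ?addr0 => [|k kl].
  rewrite !mxE/= ltnSn ltnn mulr1n mulr0n => /eqP; rewrite -mulrBr opprD addrACA subrr add0r subr0 mulr1; exact.
rewrite !mxE/= ltnS leq_eqVlt (_ : (tau k == tau l :> nat) = false) ?subrr//.
by apply/eqP => /val_inj/perm_inj/eqP; rewrite (negbTE kl).
Qed.

Lemma kuhn_cover x : exists z tau, simplex (kuhn_vertices z tau) x.
Proof.
pose z : 'rV[int]_d := \row_l Num.floor (x 0 l).
pose f (l : 'I_d) : R := x 0 l - (z 0 l)%:~R.
have f0 l : 0 <= f l by rewrite /f mxE subr_ge0 floor_le.
have f1 l : f l < 1.
  by rewrite /f mxE ltrBlDr addrC; have := floorD1_gt (x 0 l); rewrite intrD.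
pose t := [tuple f l | l < d].
have /tuple_permP[sg sE] : perm_eq (sort >=%R t) t by rewrite perm_sort.
pose s := sort >=%R t; rewrite -/s in sE.
have ss : sorted >=%R s by apply: sort_sorted => a b; exact: le_total.
have szs : size s = d by rewrite size_sort size_tuple.
have nths (l : 'I_d) : nth 0 s l = f (sg l).
  rewrite sE -tnth_nth; by rewrite !tnth_mktuple.
(* With [1] in front and the default [0] behind, the fractional parts in decreasing order run from 1
   to 0, and their successive differences are the barycentric coordinates. *)
pose G n := nth 0 (1 :: s) n.
have s01 y : y \in s -> 0 <= y <= 1.
  rewrite mem_sort => /mapP[l _ ->]; by rewrite f0 ltW.
have GS n : G n.+1 <= G n.
  rewrite /G; case: n => [|n] /=.
    have [d0|d0] := ltnP 0 (size s); last by rewrite nth_default.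
    by have /andP[] := s01 _ (mem_nth 0 d0).
  have [h|h] := ltnP n.+1 (size s); first by have /(sortedP 0)/(_ n h) := ss.
  rewrite [X in X <= _]nth_default//.
  have [h'|h'] := ltnP n (size s); last by rewrite nth_default.
  by have /andP[] := s01 _ (mem_nth 0 h').
have Gd : G d.+1 = 0 by rewrite /G /= nth_default// szs.
pose al (i : 'I_d.+1) := G i - G i.+1.
have tE n : (n <= d.+1)%N -> tail_sum al n = G n.
  move=> nd; rewrite /tail_sum /al.
  rewrite -(big_geq_mkord n d.+1 xpredT (fun i => G i - G i.+1)).
  rewrite (eq_bigr (fun i => - (G i.+1 - G i))) => [|i _]; last by rewrite opprB.
  by rewrite sumrN telescope_sumr// Gd sub0r opprK.
have cal : bary_coords al.
  split=> [i|]; first by rewrite subr_ge0.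
  by have := tE 0%N; rewrite /tail_sum /= => ->.
exists z, sg^-1%g; apply/simplexP; exists al => //; apply/rowP => l.
rewrite bary_kuhn// tE; last by rewrite ltnS ltnW// ltnS.
by rewrite /G /= nths permKV /f addrC subrK.
Qed.

Lemma kuhn_box z tau x l : simplex (kuhn_vertices z tau) x ->
  (z 0 l)%:~R <= x 0 l <= (z 0 l)%:~R + 1.
Proof.
move=> /simplexP[al cal ->]; rewrite bary_kuhn// lerDl lerD2l; apply/andP; split.
  by apply: sumr_ge0 => j _; case: cal.
by rewrite -(tail_sum0 cal) tail_sum_anti.
Qed.

(** Numbers that encode no pair are sent to the cube at [(n, ..., n)], which leaves every ball as
    [n] grows: repeating one fixed simplex there could break local finiteness. *)
Definition kuhn_enum (n : nat) : 'I_d.+1 -> 'rV[R]_d :=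
  if @pickle_inv ('rV[int]_d * 'S_d)%type n is Some zt then kuhn_vertices zt.1 zt.2
  else kuhn_vertices (const_mx n%:Z) 1%g.

Lemma kuhn_triangulation : (0 < d)%N -> triangulation kuhn_enum kuhn_weight.
Proof.
move=> d0; split.
- move=> k; rewrite /kuhn_enum; case: pickle_inv => [[z tau]|]; exact: kuhn_vertices_nondeg.
- move=> x; have [z [tau xz]] := kuhn_cover x.
  by exists (pickle (z, tau)); rewrite /kuhn_enum pickleK_inv.
- move=> k al cal; rewrite /kuhn_enum; case: pickle_inv => [[z tau]|]; exact: kuhn_weightE.
- move=> x r.
  pose B := \sum_l `|x 0 l| + `|r| + 1.
  have [N BN] : exists N : nat, B <= N%:R.
    by exists (Num.bound B); rewrite ltW// archi_boundP// !addr_ge0// sumr_ge0.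
  have zB z tau : (simplex (kuhn_vertices z tau) `&` ball x r) !=set0 ->
      forall l, (`|z 0 l| <= N%:Z)%R.
    move=> [y [yz xy]] l; have /andP[h1 h2] := kuhn_box l yz.
    have [_ /(_ ord0 l)] := xy; rewrite /ball/= => h3.
    have h4 : `|x 0 l| <= \sum_l `|x 0 l| by rewrite (bigD1 l)//= lerDl sumr_ge0.
    have h5 : `|(z 0 l)%:~R| <= N%:R :> R.
      apply: le_trans BN; rewrite /B.
      have := ler_norm r; have := ler_norm (x 0 l); have := ler_norm (- x 0 l).
      rewrite normrN => q1 q2 q3; move: h3; rewrite ltr_norml ler_norml => /andP[p1 p2].
      by apply/andP; split; lra.
    by move: h5; rewrite -intr_norm -[N%:R]/(N%:Z%:~R) ler_int.
  pose F : set ('rV[int]_d * 'S_d) := [set zt : 'rV[int]_d * 'S_d | forall l, (`|zt.1 0 l| <= N%:Z)%R].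
  have fF : finite_set F.
    pose h (g : {ffun 'I_d -> 'I_(N + N).+1} * 'S_d) : 'rV[int]_d * 'S_d :=
      (\row_l ((g.1 l)%:Z - N%:Z), g.2).
    apply: (@sub_finite_set _ _ (h @` setT)); last first.
      by apply: finite_image; exact: finite_finset.
    move=> [z tau] /= zN.
    exists ([ffun l => inord (absz (z 0 l + N%:Z)%R)], tau) => //.
    rewrite /h /=; congr (_, _); apply/rowP => l; rewrite !mxE ffunE.
    have := zN l; rewrite ler_norml => /andP[a1 a2].
    have z0 : (0 <= z 0 l + N%:Z)%R by rewrite -lerBlDr sub0r.
    rewrite inordK; first by rewrite gez0_abs// addrK.
    by rewrite ltnS -lez_nat gez0_abs// PoszD lerD2r.
  apply: (@sub_finite_set _ _ ((@pickle ('rV[int]_d * 'S_d)%type) @` F `|` `I_N.+1)); last first.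
    by rewrite finite_setU; split; [exact: finite_image|exact: finite_II].
  move=> k /=; rewrite /kuhn_enum.
  have := @pickle_invK ('rV[int]_d * 'S_d)%type k; rewrite /oapp.
  case: pickle_inv => [[z tau]|_].
    by move=> <- /zB zN; left; exists (z, tau).
  move=> /zB/(_ (Ordinal d0)); rewrite mxE; right => //=.
Qed.

End kuhn.

(** * Functions that are affine on the cells of finitely many hyperplanes *)

Section piecewise_affine.
Context {R : realType} {d : nat}.
Implicit Types (f g : 'rV[R]_d -> R) (l p q : 'rV[R]_d * R).

(* [S] lists affine forms whose signs decide which of the affine pieces listed
   in [P] represents [f]. *)
Definition piecewise_affine f := continuous f /\
  exists S P : seq ('rV[R]_d * R), forall A : set 'rV[R]_d,
    (forall l, l \in S -> sign_on A (affine_form l)) ->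
    exists2 p, p \in P & forall x, A x -> f x = affine_form p x.

Lemma affine_form_continuous l : continuous (@affine_form R d l).
Proof.
apply: continuous_add; last exact: cst_continuous.
apply: continuous_sum => i; apply: continuous_mul; first exact: cst_continuous.
exact: coor_continuous.
Qed.

Lemma affine_formD l p x :
  affine_form (l.1 + p.1, l.2 + p.2) x = affine_form l x + affine_form p x.
Proof.
rewrite /affine_form /dotp /= addrACA; congr (_ + _).
by rewrite -big_split/=; apply: eq_bigr => i _; rewrite mxE mulrDl.
Qed.

Lemma affine_formZ (c : R) l x :
  affine_form (c *: l.1, c * l.2) x = c * affine_form l x.
Proof.
rewrite /affine_form /dotp /= mulrDr mulr_sumr; congr (_ + _).
by apply: eq_bigr => i _; rewrite mxE mulrA.
Qed.

Lemma piecewise_affine_form l : piecewise_affine (affine_form l).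
Proof.
split; first exact: affine_form_continuous.
by exists [::], [:: l] => A _; exists l; rewrite ?mem_head.
Qed.

Lemma piecewise_affine_cst (c : R) : piecewise_affine (fun=> c).
Proof.
rewrite (_ : (fun=> c) = affine_form (0 : 'rV[R]_d, c)); first exact: piecewise_affine_form.
apply/funext => x; rewrite /affine_form /dotp big1 ?add0r// => i _.
by rewrite mxE mul0r.
Qed.

Lemma piecewise_affineD f g : piecewise_affine f -> piecewise_affine g ->
  piecewise_affine (fun x => f x + g x).
Proof.
move=> [cf [Sf [Pf Hf]]] [cg [Sg [Pg Hg]]]; split.
  exact: continuous_add.
exists (Sf ++ Sg), [seq (p.1 + q.1, p.2 + q.2) | p <- Pf, q <- Pg] => A H.
have [p pP Hp] : exists2 p, p \in Pf & forall x, A x -> f x = affine_form p x.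
  by apply: Hf => l lS; apply: H; rewrite mem_cat lS.
have [q qP Hq] : exists2 p, p \in Pg & forall x, A x -> g x = affine_form p x.
  by apply: Hg => l lS; apply: H; rewrite mem_cat lS orbT.
exists (p.1 + q.1, p.2 + q.2); first by apply/allpairsP; exists (p, q).
by move=> x Ax; rewrite affine_formD Hp// Hq.
Qed.

Lemma piecewise_affineZ (c : R) f : piecewise_affine f ->
  piecewise_affine (fun x => c * f x).
Proof.
move=> [cf [Sf [Pf Hf]]]; split.
  by apply: continuous_mul => //; exact: cst_continuous.
exists Sf, [seq (c *: p.1, c * p.2) | p <- Pf] => A /Hf[p pP Hp].
exists (c *: p.1, c * p.2); first by apply/mapP; exists p.
by move=> x Ax; rewrite affine_formZ Hp.
Qed.

Lemma piecewise_affineB f g : piecewise_affine f -> piecewise_affine g ->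
  piecewise_affine (fun x => f x - g x).
Proof.
move=> hf /(piecewise_affineZ (-1)) hg; have := piecewise_affineD hf hg.
by under eq_fun do rewrite mulN1r.
Qed.

(** The signs of all differences of pieces are added to the list, so that on a cell it is known
    which piece is the larger one. *)
Lemma piecewise_affine_max f g : piecewise_affine f -> piecewise_affine g ->
  piecewise_affine (fun x => Num.max (f x) (g x)).
Proof.
move=> [cf [Sf [Pf Hf]]] [cg [Sg [Pg Hg]]]; split.
  by move=> x; apply: continuous_max; [exact: cf|exact: cg].
exists (Sf ++ Sg ++ [seq (p.1 + -1 *: q.1, p.2 + -1 * q.2) | p <- Pf, q <- Pg]), (Pf ++ Pg) => A H.
have [p pP Hp] : exists2 p, p \in Pf & forall x, A x -> f x = affine_form p x.
  by apply: Hf => l lS; apply: H; rewrite mem_cat lS.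
have [q qP Hq] : exists2 p, p \in Pg & forall x, A x -> g x = affine_form p x.
  by apply: Hg => l lS; apply: H; rewrite !mem_cat lS orbT.
have [|h|h] := H (p.1 + -1 *: q.1, p.2 + -1 * q.2).
- by rewrite !mem_cat; apply/orP; right; apply/orP; right; apply/allpairsP; exists (p, q).
- exists p; first by rewrite mem_cat pP.
  move=> x Ax; have := h x Ax.
  rewrite (affine_formD p (-1 *: q.1, -1 * q.2)) affine_formZ mulN1r subr_ge0 => h'.
  by rewrite Hp// Hq//; apply/max_idPl.
- exists q; first by rewrite mem_cat qP orbT.
  move=> x Ax; have := h x Ax.
  rewrite (affine_formD p (-1 *: q.1, -1 * q.2)) affine_formZ mulN1r subr_le0 => h'.
  by rewrite Hp// Hq//; apply/max_idPr.
Qed.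

Lemma piecewise_affine_min f g : piecewise_affine f -> piecewise_affine g ->
  piecewise_affine (fun x => Num.min (f x) (g x)).
Proof.
move=> /(piecewise_affineZ (-1)) hf /(piecewise_affineZ (-1)) hg.
have /(piecewise_affineZ (-1)) := piecewise_affine_max hf hg.
by under eq_fun do rewrite !mulN1r oppr_max !opprK.
Qed.

Lemma piecewise_affine_sum (I : Type) (s : seq I) (F : I -> 'rV[R]_d -> R) :
  (forall i, piecewise_affine (F i)) -> piecewise_affine (fun x => \sum_(i <- s) F i x).
Proof.
move=> H; elim: s => [|i s IH].
  by under eq_fun do rewrite big_nil; exact: piecewise_affine_cst.
by under eq_fun do rewrite big_cons; exact: piecewise_affineD.
Qed.

(** Only the simplexes that meet the box are adapted to the hyperplanes; on the others [f] vanishes,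
    which makes it affine there as well. *)
Lemma piecewise_affine_CPWL f (r : R) : (0 < d)%N -> piecewise_affine f ->
  (forall x, ~ box r x -> f x = 0) -> CPWL setT f.
Proof.
move=> d0 [cf [S [P H]]] f0; split; first exact: continuous_subspaceT.
have Cb : box r `<=` ball (0 : 'rV[R]_d) (`|r| + 1).
  apply: subset_trans (box_bounded (normr_ge0 r)) => x h l.
  by rewrite (le_trans (h l))// ler_norm.
have [T [W [tT HT]]] := refine_hyperplanes S Cb (kuhn_triangulation (R := R) d0).
exists T; have [nT cT wT fT] := tT; split.
- by split=> //; apply/seteqP; split=> // x _; have [k] := cT x; exists k.
- move=> h k _; right; split; first exact: triangulation_face tT.
  by rewrite setIC; exact: triangulation_face tT.
- move=> k; rewrite setIT.
  have [Ck|Ck] := pselect (simplex (T k) `&` box r !=set0).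
    have [p _ Hp] := H (simplex (T k)) (fun l lS => HT k l Ck lS).
    by exists p.1, p.2.
  exists 0, 0 => x xk; rewrite f0.
    by rewrite /dotp big1 ?addr0// => i _; rewrite mxE mul0r.
  by move=> bx; apply: Ck; exists x.
- exact: fT.
Qed.

Lemma piecewise_affine_coor (i : 'I_d) : piecewise_affine (fun x => x 0 i).
Proof.
rewrite (_ : (fun _ => _) = affine_form (delta_mx 0 i, 0)); first exact: piecewise_affine_form.
apply/funext => x; rewrite /affine_form /dotp addr0.
under eq_bigr do rewrite mxE eqxx/=; by rewrite (sum_delta i (fun j => x 0 j)).
Qed.

(** Truncates [f] between [- q] and [q], where [q] is a piecewise affine cut-off equal to a bound of
    [f] on the box and to 0 outside the larger one; [N] adds up the amounts by which the coordinates
    leave the box. *)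
Lemma piecewise_affine_clip f (r : R) : piecewise_affine f -> exists2 u,
  piecewise_affine u & (forall x, box r x -> u x = f x) /\
  (forall x, ~ box (r + 1) x -> u x = 0).
Proof.
move=> pf; have [cf _] := pf.
have [M M0 HM] := compact_bound (@box_compact R d r) cf.
pose N (x : 'rV[R]_d) : R := \sum_(l : 'I_d) Num.max 0 (Num.max (x 0 l) (-1 * x 0 l) - r).
have pN : piecewise_affine N.
  apply: piecewise_affine_sum => l; apply: piecewise_affine_max; first exact: piecewise_affine_cst.
  apply: piecewise_affineB; last exact: piecewise_affine_cst.
  apply: piecewise_affine_max; first exact: piecewise_affine_coor.
  by apply: piecewise_affineZ; exact: piecewise_affine_coor.
have NE x : N x = \sum_(l : 'I_d) Num.max 0 (`|x 0 l| - r).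
  apply: eq_bigr => l _; rewrite mulN1r; congr (Num.max _ (_ - _)).
  have [h|h] := leP 0 (x 0 l).
    by rewrite ger0_norm//; apply/max_idPl; rewrite (le_trans _ h)// oppr_le0.
  by rewrite ltr0_norm//; apply/max_idPr; rewrite (le_trans (ltW h))// oppr_ge0 ltW.
pose q x := Num.max 0 (M * (1 - N x)).
have pq : piecewise_affine q.
  apply: piecewise_affine_max; first exact: piecewise_affine_cst.
  apply: piecewise_affineZ; apply: piecewise_affineB => //; exact: piecewise_affine_cst.
exists (fun x => Num.max (Num.min (f x) (q x)) (-1 * q x)).
  by apply: piecewise_affine_max; [exact: piecewise_affine_min|exact: piecewise_affineZ].
split=> x bx.
  have -> : q x = M.
    rewrite /q NE big1 ?subr0 ?mulr1; first by apply/max_idPr; exact: ltW.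
    by move=> l _; apply/max_idPl; rewrite subr_le0.
  have := HM x bx; rewrite ler_norml mulN1r => /andP[h1 h2].
  by rewrite (min_idPl h2); apply/max_idPl.
have -> : q x = 0.
  apply/max_idPl; rewrite pmulr_rle0// subr_le0.
  have /existsNP[l /negP] := bx; rewrite -ltNge => h.
  rewrite NE (bigD1 l)//= ler_wpDr//; first by apply: sumr_ge0 => i _; rewrite le_max lexx.
  by rewrite le_max; apply/orP; right; rewrite lerBrDl ltW.
by rewrite mulr0; apply/max_idPr; rewrite ge_min lexx orbT.
Qed.

End piecewise_affine.

(** * Integration of compactly supported functions *)

Section measurability.
Context {R : realType} {d : nat}.

Definition open_box (x : 'rV[R]_d) (r : R) : set 'rV[R]_d :=
  [set y | forall l, `|x 0 l - y 0 l| < r].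

Lemma measurable_forall_coor (A : 'I_d -> set R) : (forall l, measurable (A l)) ->
  measurable [set x : 'rV[R]_d | forall l, A l (x 0 l)].
Proof.
move=> mA; rewrite (_ : [set _ | _] = \big[setI/setT]_(l < d)
    ((fun x : 'rV[R]_d => x 0 l) @^-1` A l)).
  apply: bigsetI_measurable => l _.
  by rewrite -[X in measurable X]setTI; exact: measurable_coor.
rewrite -bigcap_seq; apply/seteqP; split => [x Ax l _|x Ax l]; first exact: Ax.
by apply: (Ax l); rewrite /= mem_index_enum.
Qed.

Lemma measurable_open_box x r : measurable (open_box x r).
Proof.
apply: (@measurable_forall_coor (fun l => [set t | `|x 0 l - t| < r])) => l.
rewrite (_ : [set _ | _] = `]x 0 l - r, x 0 l + r[%classic)//.
apply/seteqP; split => t /=; rewrite in_itv/= ltr_norml => /andP[h1 h2];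
  by apply/andP; split; lra.
Qed.

Lemma measurable_box r : measurable (@box R d r).
Proof.
rewrite (_ : box r = [set x : 'rV[R]_d | forall l, [set` `[- r, r]] (x 0 l)]).
  exact: (@measurable_forall_coor (fun=> `[- r, r]%classic)).
by apply/seteqP; split => x h l; have := h l; rewrite /= in_itv/= ler_norml.
Qed.

Lemma open_measurable_rV (U : set 'rV[R]_d) : open U -> measurable U.
Proof.
move=> oU.
pose q (z : 'rV[rat]_d) : 'rV[R]_d := \row_l ratr (z 0 l).
pose B n := if @unpickle ('rV[rat]_d * rat)%type n is Some (z, r) then
  (if pselect (open_box (q z) (ratr r) `<=` U) then open_box (q z) (ratr r) else set0)
  else set0.
suff -> : U = \bigcup_n B n.
  apply: bigcupT_measurable => n; rewrite /B; case: unpickle => [[z r]|//].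
  case: pselect => ? //=; exact: measurable_open_box.
apply/seteqP; split => [x Ux|x [n _]]; last first.
  by rewrite /B; case: unpickle => [[z r]|//]; case: pselect => // h; exact: h.
have /nbhs_ballP[e /= e0 eU] := open_nbhs_nbhs (conj oU Ux).
have e4 : 0 < e / 4 by rewrite divr_gt0.
(* The rational center will be within [e / 4] of [x] in each coordinate: a radius above [e / 4]
   catches [x], and one below [e / 2] keeps the box inside the ball of radius [e]. *)
have [r /andP[r1 r2]] : exists r : rat, e / 4 < ratr r < e / 2.
  have h : e / 4 < e / 2 by lra.
  by have [r] := rat_in_itvoo h; rewrite in_itv/= => hr; exists r.
have zq l : exists z : rat, x 0 l - e / 4 < ratr z < x 0 l + e / 4.
  have h : x 0 l - e / 4 < x 0 l + e / 4 by lra.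
  by have [z] := rat_in_itvoo h; rewrite in_itv/= => hz; exists z.
have [z Hz] := choice zq.
exists (pickle (\row_l z l, r)) => //; rewrite /B pickleK; case: pselect => [? l|].
  rewrite !mxE; have /andP[h1 h2] := Hz l.
  by rewrite ltr_norml; apply/andP; split; lra.
case=> y yb; apply: eU; apply/rV_ballP; split=> // l.
have := yb l; rewrite !mxE; have /andP[h1 h2] := Hz l.
by rewrite !ltr_norml => /andP[h3 h4]; apply/andP; split; lra.
Qed.

Lemma continuous_measurable_rV (f : 'rV[R]_d -> R) : continuous f ->
  measurable_fun setT f.
Proof.
move=> /continuousP cf; apply: (measurability _ (RGenOpens.measurableE R)).
move=> _ [_ [a [b ->] <-]]; rewrite setTI; apply: open_measurable_rV.
exact/cf/interval_open.
Qed.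

End measurability.

Section compactly_supported.
Context {R : realType} {d : nat}.
Implicit Types f g : 'rV[R]_d -> R.

Definition compactly_supported f :=
  continuous f /\ exists r : R, forall x, ~ box r x -> f x = 0.

Definition integral_rV f : R := \int[lebesgue_rV d]_x f x.

Lemma lebesgue_box (r : R) : 0 <= r ->
  lebesgue_rV d (box r) = ((2 * r) ^+ d)%:E.
Proof.
move=> r0; rewrite (_ : box r = [set x : 'rV[R]_d | forall l, [set` `[- r, r]] (x 0 l)]).
  rewrite (@lebesgue_rV_box R d (fun=> `[- r, r]%classic))//.
  rewrite (eq_bigr (fun=> (2 * r)%:E)) => [|i _].
    by rewrite prodEFin prodr_const card_ord.
  rewrite lebesgue_measure_itv/= lte_fin; case: ltP => h.
    by rewrite -EFinD opprK; congr EFin; ring.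
  by congr EFin; lra.
by apply/seteqP; split => x h l; have := h l; rewrite /= in_itv/= ler_norml.
Qed.

Lemma compactly_supported_box f : compactly_supported f -> exists r : R,
  0 <= r /\ forall x, ~ box r x -> f x = 0.
Proof.
move=> [_ [r H]]; exists `|r|; split=> // x bx; apply: H => bx'; apply: bx => l.
by apply: le_trans (bx' l) _; exact: ler_norm.
Qed.

Lemma compactly_supported_integrable f : compactly_supported f ->
  (lebesgue_rV d).-integrable setT (EFin \o f).
Proof.
move=> sf; have [r [r0 H]] := compactly_supported_box sf; have [cf _] := sf.
have mb := @measurable_box R d r.
have -> : EFin \o f = (EFin \o f) \_ (box r).
  by apply/funext => x; rewrite /patch; case: ifPn => //= /negP bx; rewrite H// => b; apply: bx; exact: mem_set.
apply/(integrable_mkcond _ mb); apply: measurable_bounded_integrable => //.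
- by rewrite [X in (X < _)%E]lebesgue_box// ltry.
- by apply: measurable_funTS; exact: continuous_measurable_rV.
have [M M0 HM] := compact_bound (@box_compact R d r) cf.
exists M; split; first exact: num_real.
move=> N MN x bx; exact: le_trans (HM x bx) (ltW MN).
Qed.

Lemma compactly_supportedD f g : compactly_supported f -> compactly_supported g ->
  compactly_supported (fun x => f x + g x).
Proof.
move=> sf sg; have [r [r0 H]] := compactly_supported_box sf; have [cf _] := sf.
have [s [s0 G]] := compactly_supported_box sg; have [cg _] := sg.
split; first exact: continuous_add.
exists (r + s) => x bx; rewrite H ?G ?addr0// => b; apply: bx => l;
  by rewrite (le_trans (b l))// ?lerDl ?lerDr.
Qed.

Lemma compactly_supportedMl f g : continuous f -> compactly_supported g ->
  compactly_supported (fun x => f x * g x).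
Proof.
move=> cf [cg [r H]]; split; first exact: continuous_mul.
by exists r => x bx; rewrite H// mulr0.
Qed.

Lemma compactly_supportedZ (c : R) f : compactly_supported f ->
  compactly_supported (fun x => c * f x).
Proof. by apply: compactly_supportedMl; exact: cst_continuous. Qed.

Lemma compactly_supported0 : compactly_supported (fun=> 0).
Proof. by split; [exact: cst_continuous|exists 0]. Qed.

Lemma compactly_supportedN f : compactly_supported f ->
  compactly_supported (fun x => - f x).
Proof.
by move=> /(compactly_supportedZ (-1)); under eq_fun do rewrite mulN1r.
Qed.

Lemma compactly_supported_sum (I : Type) (s : seq I) (F : I -> 'rV[R]_d -> R) :
  (forall i, compactly_supported (F i)) ->
  compactly_supported (fun x => \sum_(i <- s) F i x).
Proof.
move=> H; elim: s => [|i s IH].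
  rewrite (_ : (fun x => _) = (fun=> 0)); first exact: compactly_supported0.
  by apply/funext => x; rewrite big_nil.
rewrite (_ : (fun x => _) = (fun x => F i x + \sum_(j <- s) F j x)); first exact: compactly_supportedD.
by apply/funext => x; rewrite big_cons.
Qed.

Lemma integral_rVD f g : compactly_supported f -> compactly_supported g ->
  integral_rV (fun x => f x + g x) = integral_rV f + integral_rV g.
Proof.
by move=> sf sg; apply: RintegralD => //; exact: compactly_supported_integrable.
Qed.

Lemma integral_rVZ (c : R) f : compactly_supported f ->
  integral_rV (fun x => c * f x) = c * integral_rV f.
Proof.
by move=> sf; apply: RintegralZl => //; exact: compactly_supported_integrable.
Qed.

Lemma integral_rVN f : compactly_supported f ->
  integral_rV (fun x => - f x) = - integral_rV f.
Proof.
by move=> /(integral_rVZ (-1)); rewrite mulN1r => <-; under eq_fun do rewrite -mulN1r.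
Qed.

Lemma integral_rVB f g : compactly_supported f -> compactly_supported g ->
  integral_rV (fun x => f x - g x) = integral_rV f - integral_rV g.
Proof.
by move=> sf sg; rewrite integral_rVD ?integral_rVN//; exact: compactly_supportedN.
Qed.

Lemma integral_rV_sum (I : Type) (s : seq I) (F : I -> 'rV[R]_d -> R) :
  (forall i, compactly_supported (F i)) ->
  integral_rV (fun x => \sum_(i <- s) F i x) = \sum_(i <- s) integral_rV (F i).
Proof.
move=> H; elim: s => [|i s IH].
  rewrite big_nil -[RHS](mul0r (integral_rV (fun=> 0))) -integral_rVZ; last exact: compactly_supported0.
  by congr integral_rV; apply/funext => x; rewrite big_nil mul0r.
rewrite big_cons -IH -integral_rVD//; last exact: compactly_supported_sum.
by congr integral_rV; apply/funext => x; rewrite big_cons.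
Qed.

Lemma integral_rV_sum2 (F : 'I_d -> 'I_d -> 'rV[R]_d -> R) :
  (forall i j, compactly_supported (F i j)) ->
  integral_rV (fun x => \sum_i \sum_j F i j x) = \sum_i \sum_j integral_rV (F i j).
Proof.
move=> H.
rewrite (integral_rV_sum (index_enum 'I_d) (fun i => compactly_supported_sum (index_enum 'I_d) (H i))).
by apply: eq_bigr => i _; rewrite (integral_rV_sum (index_enum 'I_d) (H i)).
Qed.

Lemma integral_rV_le f g : compactly_supported f -> compactly_supported g ->
  (forall x, f x <= g x) -> integral_rV f <= integral_rV g.
Proof.
by move=> sf sg fg; apply: le_Rintegral => //; exact: compactly_supported_integrable.
Qed.

Lemma integral_rV_ge0 f : (forall x, 0 <= f x) -> 0 <= integral_rV f.
Proof. by move=> f0; apply: Rintegral_ge0. Qed.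

Lemma integral_rVE (A : set 'rV[R]_d) f : compactly_supported f ->
  (forall x, ~ A x -> f x = 0) ->
  (\int[lebesgue_rV d]_(x in A) (f x)%:E)%E = (integral_rV f)%:E.
Proof.
move=> sf fA; rewrite integral_mkcond /integral_rV /Rintegral fineK; last first.
  by apply: integrable_fin_num => //; exact: compactly_supported_integrable.
apply: eq_integral => x _; rewrite /patch; case: ifPn => //= /negP Ax.
by rewrite fA// => h; apply: Ax; exact: mem_set.
Qed.

End compactly_supported.

(** * Fubini and integration by parts *)

Section cons_rV.
Context {R : realType} {d : nat}.

Lemma continuous_cons_rV1 (y : 'rV[R]_d) : continuous (fun t : R => cons_rV (t, y)).
Proof.
apply: continuous_to_rV => j; have [k ->|->] := unliftP ord0 j.
  by under eq_fun do rewrite cons_rVS; exact: cst_continuous.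
by under eq_fun do rewrite cons_rV0; move=> t; exact: cvg_id.
Qed.

Lemma continuous_cons_rV2 (t : R) : continuous (fun y : 'rV[R]_d => cons_rV (t, y)).
Proof.
apply: continuous_to_rV => j; have [k ->|->] := unliftP ord0 j.
  by under eq_fun do rewrite cons_rVS; exact: coor_continuous.
by under eq_fun do rewrite cons_rV0; exact: cst_continuous.
Qed.

Lemma cons_rV_add0 (t h : R) (y : 'rV[R]_d) :
  cons_rV (h + t, y) = h *: delta_mx 0 ord0 + cons_rV (t, y).
Proof.
apply/rowP => j; rewrite [RHS]mxE [X in _ = X + _]mxE [X in _ = _ * X + _]mxE eqxx/=.
have [k ->|->] := unliftP ord0 j; last by rewrite !cons_rV0 eqxx mulr1.
by rewrite !cons_rVS/= mulr0 add0r.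
Qed.

Lemma cons_rV_addS (t h : R) (y : 'rV[R]_d) (i : 'I_d) :
  cons_rV (t, h *: delta_mx 0 i + y) = h *: delta_mx 0 (lift ord0 i) + cons_rV (t, y).
Proof.
apply/rowP => j; rewrite [RHS]mxE [X in _ = X + _]mxE [X in _ = _ * X + _]mxE eqxx/=.
have [k ->|->] := unliftP ord0 j.
  by rewrite !cons_rVS/= [LHS]mxE [X in X + _ = _]mxE [X in _ * X + _ = _]mxE eqxx/= (inj_eq (@lift_inj _ _)).
by rewrite !cons_rV0 (negbTE (neq_lift _ _)) mulr0 add0r.
Qed.

Lemma cons_rV_box (r t : R) (y : 'rV[R]_d) :
  box r (cons_rV (t, y)) <-> `|t| <= r /\ box r y.
Proof.
split=> [h|[h1 h2] j].
  split; first by have := h ord0; rewrite cons_rV0.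
  by move=> l; have := h (lift ord0 l); rewrite cons_rVS.
by have [k ->|->] := unliftP ord0 j; rewrite ?cons_rVS ?cons_rV0.
Qed.

End cons_rV.

Section integration_by_parts.
Context {R : realType}.

Lemma integral_derive_eq0 (h : R -> R) (r : R) : 0 < r ->
  (forall t, derivable h t 1) -> continuous (derive1 h) -> (forall t, r < `|t| -> h t = 0) ->
  (\int[lebesgue_measure]_t (derive1 h t)%:E)%E = 0%E.
Proof.
move=> r0 dh ch h0.
have cth : continuous h.
  by move=> t; apply: differentiable_continuous; exact/derivable1_diffP.
have h0' t : r + 1 < `|t| -> derive1 h t = 0.
  move=> rt; rewrite derive1E.
  rewrite (@near_eq_derive _ _ _ _ (fun=> 0)).
  - exact: derive_cst.
  - have : \forall s \near t, ball t 1 s by exact: nbhsx_ballx.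
    apply: filterS => s; rewrite /ball/= => ts; apply: h0.
    by have := lerB_dist t s; rewrite lerBlDr; lra.
have r1 : - (r + 2) < r + 2 by lra.
have hr (t : R) : `|t| = r + 2 -> h t = 0 by move=> tE; apply: h0; rewrite tE; lra.
have FTC : (\int[lebesgue_measure]_(t in `[(- (r + 2))%R, (r + 2)%R]) (derive1 h t)%:E = 0)%E.
  rewrite (@continuous_FTC2 _ (derive1 h) h _ _ r1).
  - by rewrite -EFinB !hr ?subrr// ?normrN gtr0_norm//; lra.
  - exact: continuous_subspaceT.
  - split; first by move=> *; exact: dh.
    + exact: cvg_at_right_filter (cth _).
    + exact: cvg_at_left_filter (cth _).
  - by [].
rewrite -[RHS]FTC.
rewrite [RHS]integral_mkcond; apply: eq_integral => t _; rewrite /patch.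
case: ifPn => //; rewrite notin_setE/= in_itv/= => /negP.
rewrite -ler_norml -ltNge => h1; rewrite h0'//; lra.
Qed.

Lemma near_box d (r : R) (x : 'rV[R]_d) : ~ box r x ->
  \forall y \near x, ~ box r y.
Proof.
move=> /existsNP[l /negP]; rewrite -ltNge => h.
have h' : 0 < `|x 0 l| - r by rewrite subr_gt0.
have : \forall y \near x, ball x (`|x 0 l| - r) y by exact: nbhsx_ballx.
apply: filterS => y /rV_ballP[_ /(_ l) xy] /(_ l) yl.
by have := lerB_dist (x 0 l) (y 0 l); rewrite lerBlDr; lra.
Qed.

Lemma partial_eq0_box d (i : 'I_d) (f : 'rV[R]_d -> R) (r : R) :
  (forall x, ~ box r x -> f x = 0) -> forall x, ~ box r x -> partial i f x = 0.
Proof.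
move=> f0 x bx; rewrite /partial (@near_eq_derive _ _ _ _ (fun=> 0)) ?derive_cst//.
by apply: filterS (near_box bx) => y; exact: f0.
Qed.

Lemma compactly_supported_partial d (i : 'I_d) (f : 'rV[R]_d -> R) :
  compactly_supported f -> continuous (partial i f) ->
  compactly_supported (partial i f).
Proof.
by move=> [_ [r H]] cp; split => //; exists r; exact: partial_eq0_box.
Qed.

(** Both orders are used for the integral of a partial derivative: the first coordinate is
    integrated first when the derivative is taken along it, and last when induction applies to the
    slices. *)
Lemma integral_rV_cons d (f : 'rV[R]_d.+1 -> R) : compactly_supported f ->
  ((integral_rV f)%:E = \int[lebesgue_measure]_t \int[lebesgue_rV d]_y (f (cons_rV (t, y)))%:E)%E /\
  ((integral_rV f)%:E = \int[lebesgue_rV d]_y \int[lebesgue_measure]_t (f (cons_rV (t, y)))%:E)%E.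
Proof.
move=> sf; have [cf _] := sf.
have mf : measurable_fun [set: 'rV[R]_d.+1] (EFin \o f : _ -> \bar R).
  by apply/measurable_EFinP; exact: continuous_measurable_rV.
have mc : measurable_fun [set: measurableTypeR R * 'rV[R]_d] (@cons_rV R d).
  exact: measurable_cons_rV.
pose mu : {measure set (measurableTypeR R * 'rV[R]_d) -> \bar R} := (lebesgue_measure \x @lebesgue_rV R d)%E.
have muE : lebesgue_rV d.+1 = pushforward mu (@cons_rV R d) :> (set _ -> _) by [].
have ig : mu.-integrable setT (EFin \o f \o @cons_rV R d).
  have /integrableP[_] := compactly_supported_integrable sf.
  rewrite muE (@ge0_integral_pushforward _ _ _ _ _ _ mc mu setT) // => [h|]; last first.
    by apply: measurableT_comp.
  apply/integrableP; split; first exact: measurableT_comp.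
  by move: h; rewrite preimage_setT.
have E : ((integral_rV f)%:E = \int[mu]_z (EFin \o f \o @cons_rV R d) z)%E.
  rewrite -(@integral_rVE _ _ setT) => [||x []]//.
  rewrite muE (@integral_pushforward _ _ _ _ _ _ mc mu setT (EFin \o f))//.
split; rewrite E.
  by rewrite -(@integral12_prod_meas1 _ _ _ _ _ lebesgue_measure (@lebesgue_rV R d)).
by rewrite -(@integral21_prod_meas1 _ _ _ _ _ lebesgue_measure (@lebesgue_rV R d)).
Qed.

Lemma integral_partial_eq0 d (i : 'I_d) (f : 'rV[R]_d -> R) :
  compactly_supported f -> (forall x, derivable f x (delta_mx 0 i)) ->
  continuous (partial i f) -> integral_rV (partial i f) = 0.
Proof.
elim: d i f => [[]//|d IH] i f sf df cp.
have sp := compactly_supported_partial sf cp.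
have [cf [r rE]] := sf.
have [E1 E2] := integral_rV_cons sp.
apply: (@EFin_inj R); have [j ij|i0] := unliftP ord0 i.
  rewrite E1; apply: integral0_eq => t _; subst i.
  have gE y (s : R) := cons_rV_addS t s y j.
  have pE : partial j (f \o (fun y => cons_rV (t, y))) =
      (fun y => partial (lift ord0 j) f (cons_rV (t, y))).
    by apply/funext => y; rewrite /partial (derive_comp_affine _ (gE y)).
  have sg : compactly_supported (f \o (fun y => cons_rV (t, y))).
    split; first by move=> y; apply: continuous_comp; [exact: continuous_cons_rV2|exact: cf].
    by exists r => y by_; apply: rE => /cons_rV_box[].
  have cg : continuous (partial j (f \o (fun y => cons_rV (t, y)))).
    rewrite pE => y; apply: (@continuous_comp _ _ _ (fun y => cons_rV (t, y))).
      exact: continuous_cons_rV2.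
    exact: cp.
  have := IH j (f \o (fun y => cons_rV (t, y))) sg _ cg.
  rewrite pE => I0; rewrite (integral_rVE (A := setT)) => [||x []//]; last first.
    by rewrite -pE; exact: compactly_supported_partial.
  rewrite I0 => [//|y]; exact: (derivable_comp_affine f (gE y)).2 (df _).
rewrite E2; apply: integral0_eq => y _; rewrite {}i0 in df cp sp E1 E2 *.
have gE t (s : R) : cons_rV (s *: 1 + t, y) = s *: delta_mx 0 ord0 + cons_rV (t, y).
  by rewrite -cons_rV_add0 [s *: 1]mulr1.
have pE : derive1 (f \o (fun t => cons_rV (t, y))) =
    (fun t => partial ord0 f (cons_rV (t, y))).
  by apply/funext => t; rewrite derive1E /partial (derive_comp_affine _ (gE t)).
have := @integral_derive_eq0 (f \o (fun t => cons_rV (t, y))) (`|r| + 1).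
rewrite pE; apply.
- by rewrite ltr_wpDl.
- by move=> t; apply/(derivable_comp_affine _ (gE t)); exact: df.
- move=> t; apply: (@continuous_comp _ _ _ (fun t => cons_rV (t, y))).
    exact: continuous_cons_rV1.
  exact: cp.
- move=> t rt; apply: rE => /cons_rV_box[h _].
  by have := ler_norm r; lra.
Qed.

End integration_by_parts.

(** * Functions of class C^k *)

Section one_variable.
Context {R : realType}.
Implicit Types g : R -> R.

Lemma derivable_continuous g : (forall t, derivable g t 1) -> continuous g.
Proof.
by move=> dg t; apply: differentiable_continuous; exact/derivable1_diffP.
Qed.

Lemma mean_value_le g (a b : R) : a <= b -> (forall t, derivable g t 1) ->
  exists2 c, a <= c <= b & g b - g a = derive1 g c * (b - a).
Proof.
move=> ab dg; have cg := derivable_continuous dg.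
have dg' (t : R) : is_derive t (1 : R) g (derive1 g t).
  by apply: DeriveDef; rewrite ?derive1E.
have [c] := MVT_segment ab (fun t _ => dg' t) (continuous_subspaceT cg).
by rewrite in_itv/= => cab gE; exists c.
Qed.

Lemma mean_value g (a b : R) : (forall t, derivable g t 1) ->
  exists2 c, `|c - a| <= `|b - a| & g b - g a = derive1 g c * (b - a).
Proof.
move=> dg; have [ab|/ltW ba] := leP a b.
  have [c /andP[h1 h2] gE] := mean_value_le ab dg; exists c => //.
  by rewrite !ger0_norm ?subr_ge0//; lra.
have [c /andP[h1 h2] gE] := mean_value_le ba dg; exists c.
  by rewrite !ler0_norm ?subr_le0//; lra.
by rewrite -[LHS]opprB gE -mulrN opprB.
Qed.

(** For the point 0, where [flat] and [pos_pow] are glued from two formulas. *)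
Lemma derive_quadratic g (C : R) : (forall h, `|h| <= 1 -> `|g h| <= C * h ^+ 2) ->
  derivable g 0 1 /\ derive1 g 0 = 0.
Proof.
move=> H; have g0 : g 0 = 0.
  by apply/eqP; rewrite -normr_le0 (le_trans (H 0 _)) ?normr0// expr0n mulr0.
rewrite derive1E.
suff cv : (fun h : R => h^-1 *: ((g \o shift 0) (h *: (1 : R)) - g 0)) @ 0^' --> (0 : R).
  by split; [apply/cvg_ex; eexists; exact: cv|exact: cvg_lim cv].
apply/cvgrPdist_le => eps eps0.
have C1 : 0 < `|C| + 1 by rewrite ltr_wpDl.
have : \forall h \near 0^', `|h : R| < eps / (`|C| + 1).
  apply: cvg_within; apply: filterS (nbhsx_ballx (0 : R) (eps / (`|C| + 1)) (divr_gt0 eps0 C1)) => h.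
  by rewrite /ball/= sub0r normrN.
have : \forall h \near 0^', `|h : R| < 1.
  apply: cvg_within; apply: filterS (nbhsx_ballx (0 : R) 1 ltr01) => h.
  by rewrite /ball/= sub0r normrN.
have : \forall h \near 0^', (h : R) != 0 by exact: nbhs_dnbhs_neq.
apply: filterS3 => h h0 /ltW h1 hr.
rewrite /= addr0 g0 subr0 sub0r normrN -[h *: 1]/(h * 1) mulr1 -[_ *: _]/(_ * _) normrM.
rewrite normfV ler_pdivrMl ?normr_gt0//.
apply: (le_trans (H h h1)); rewrite -real_normK ?num_real// expr2 mulrCA ler_wpM2l//.
apply: (@le_trans _ _ (`|h| * (`|C| + 1))); last by rewrite -ler_pdivlMr// ltW.
by rewrite mulrC ler_wpM2l// (le_trans (ler_norm _))// lerDl.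
Qed.

End one_variable.

Section chain_rule.
Context {R : realType} {V : normedModType R}.
Implicit Types (f : V -> R) (x v : V).

(** Restriction to the line through [x] reduces the claim to one variable, so directional
    derivability of [f] suffices. *)
Lemma derive_comp1 (phi : R -> R) f x v : derivable f x v -> derivable phi (f x) 1 ->
  derivable (fun y => phi (f y)) x v /\
  'D_v (fun y => phi (f y)) x = derive1 phi (f x) * 'D_v f x.
Proof.
move=> df dphi.
pose l (s : R) := s *: v + x.
have lE (s : R) : l (s *: 1 + 0) = s *: v + l 0.
  by rewrite /l addr0 scale0r add0r -[s *: 1]/(s * 1) mulr1.
have l0 : l 0 = x by rewrite /l scale0r add0r.
have dl : derivable (f \o l) 0 1 by apply/(derivable_comp_affine _ lE); rewrite l0.
have dphil : derivable phi ((f \o l) 0) 1 by rewrite /= l0.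
split.
  have h := (derivable_comp_affine (fun y => phi (f y)) lE).1; rewrite l0 in h; apply: h.
  change (derivable (phi \o (f \o l)) 0 1).
  by apply/derivable1_diffP; apply: differentiable_comp; apply/derivable1_diffP.
rewrite -{1}l0 -(derive_comp_affine (fun y => phi (f y)) lE) -derive1E.
change (derive1 (phi \o (f \o l)) 0 = derive1 phi (f x) * 'D_v f x).
rewrite derive1_comp//= l0; congr (_ * _).
by rewrite derive1E (derive_comp_affine f lE) l0.
Qed.

Lemma derivable_line f x v : (forall y, derivable f y v) ->
  forall t : R, derivable (fun s : R => f (s *: v + x)) t 1 /\
    derive1 (fun s : R => f (s *: v + x)) t = 'D_v f (t *: v + x).
Proof.
move=> df t; pose l (s : R) := s *: v + x.
have lE (s : R) : l (s *: 1 + t) = s *: v + l t.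
  by rewrite /l scalerDl addrA -[s *: 1]/(s * 1) mulr1.
split; last by rewrite derive1E -(derive_comp_affine f lE).
by apply/(derivable_comp_affine f lE).
Qed.

End chain_rule.

Section partial_derivatives.
Context {R : realType} {d : nat}.
Implicit Types (f g : 'rV[R]_d -> R) (x v : 'rV[R]_d).

(** The increment is split into [h *: v] followed by a step along the coordinate axis. The mean
    value theorem applies to the second step, and continuity of the partial derivative lets its
    intermediate point tend to [x]. Adding the axes one by one gives all directional derivatives of
    a C^1 function. *)
Lemma derive_addr f x v (i : 'I_d) (s : R) :
  derivable f x v -> (forall y, derivable f y (delta_mx 0 i)) ->
  continuous (partial i f) ->
  derivable f x (v + s *: delta_mx 0 i) /\
  'D_(v + s *: delta_mx 0 i) f x = 'D_v f x + s * partial i f x.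
Proof.
move=> dv di cp; set e := delta_mx 0 i.
suff H : (fun h : R => h^-1 *: ((f \o shift x) (h *: (v + s *: e)) - f x)) @ 0^' -->
    'D_v f x + s * partial i f x.
  by split; [apply/cvg_ex; eexists; exact: H|exact: cvg_lim H].
have -> : (fun h : R => h^-1 *: ((f \o shift x) (h *: (v + s *: e)) - f x)) =
    (fun h : R => h^-1 *: ((f \o shift x) (h *: v) - f x)) +
    (fun h : R => h^-1 *: (f (h *: (v + s *: e) + x) - f (h *: v + x))).
  by apply/funext => h; rewrite /GRing.add/= -scalerDr; congr (_ *: _); rewrite [RHS]addrC [RHS]addrA subrK.
apply: cvgD; first exact: dv.
apply/cvgrPdist_le => eps eps0.
pose eps1 := eps / (`|s| + 1).
have s1 : 0 < `|s| + 1 by rewrite ltr_wpDl.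
have eps10 : 0 < eps1 by rewrite divr_gt0.
have /cvgrPdist_le/(_ _ eps10)/nbhs_ballP[r /= r0 rH] := cp x.
have [M [M0 HM]] : exists M : R, 0 < M /\ `|v| + `|s *: e| < M.
  by exists (`|v| + `|s *: e| + 1); split; [rewrite ltr_wpDl// addr_ge0|rewrite ltrDl].
have : \forall h \near 0^', `|h : R| < r / M.
  apply: cvg_within; apply: filterS (nbhsx_ballx (0 : R) (r / M) (divr_gt0 r0 M0)) => h.
  by rewrite /ball/= sub0r normrN.
have : \forall h \near 0^', (h : R) != 0 by exact: nbhs_dnbhs_neq.
apply: filterS2 => h h0 hr.
have [c cH] := mean_value 0 (h * s) (fun t => (derivable_line (h *: v + x) di t).1).
rewrite (derivable_line _ di c).2 scale0r add0r subr0 => E.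
have -> : h *: (v + s *: e) + x = (h * s) *: e + (h *: v + x).
  by rewrite scalerDr scalerA [h *: v + (h * s) *: e]addrC addrA.
rewrite E [_ *: _]mulrC.
rewrite (_ : _ * (h * s) / h = s * partial i f (c *: e + (h *: v + x))); last first.
  by rewrite /partial -/e; field.
rewrite -mulrBr normrM.
rewrite !subr0 in cH.
have : `|partial i f x - partial i f (c *: e + (h *: v + x))| <= eps1.
  apply: rH; rewrite mx_norm_ball /ball_/= addrA opprD addrCA subrr addr0 normrN.
  apply: (@le_lt_trans _ _ (`|h| * (`|v| + `|s *: e|))).
    rewrite mulrDr [leRHS]addrC (le_trans (ler_normD _ _))// lerD//; last by rewrite normrZ.

    by rewrite !normrZ mulrA -normrM ler_wpM2r.
  rewrite (le_lt_trans _ (_ : `|h| * M < r))//; last by rewrite -ltr_pdivlMr.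
  by rewrite ler_wpM2l// ltW.
move=> /(ler_wpM2l (normr_ge0 s)) /le_trans; apply.
by rewrite /eps1 mulrA ler_pdivrMr// mulrC ler_pM2l// lerDl.
Qed.

Lemma Ck_continuous k f : Ck k f -> continuous f.
Proof. by case: k => [|k] []. Qed.

Lemma derive_partial f x v : Ck 1 f ->
  derivable f x v /\ 'D_v f x = \sum_i v 0 i * partial i f x.
Proof.
move=> [_ H].
have -> : v = \sum_i v 0 i *: delta_mx 0 i by rewrite [LHS]row_sum_delta.
suff G (s : seq 'I_d) : derivable f x (\sum_(i <- s) v 0 i *: delta_mx 0 i) /\
    'D_(\sum_(i <- s) v 0 i *: delta_mx 0 i) f x = \sum_(i <- s) v 0 i * partial i f x.
  have [G1 G2] := G (index_enum 'I_d); split => //; rewrite G2.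
  by apply: eq_bigr => i _; rewrite -row_sum_delta.
elim: s => [|i s [IH1 IH2]].
  rewrite !big_nil; split; first exact: derivable0.
  exact: derive0.
rewrite !big_cons addrC -IH2.
have [Hi1 [Hi2 _]] := H i.
by have [D1 D2] := derive_addr (v 0 i) IH1 Hi1 Hi2; split => //; rewrite D2 addrC.
Qed.

End partial_derivatives.

(** * Convexity from second derivatives *)

Section convexity.
Context {R : realType} {d : nat}.
Implicit Types (f : 'rV[R]_d -> R) (x y v : 'rV[R]_d).

Definition hess_form f x v : R :=
  \sum_i \sum_j v 0 i * v 0 j * partial j (partial i f) x.

Definition tangent f y x : R := f y + \sum_i (x 0 i - y 0 i) * partial i f y.

(** Two applications of the mean value theorem along the segment: the increment of [f] is the slope
    at some [c], and that slope exceeds the one at 0 by [c] times a value of the Hessian form. *)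
Lemma tangent_le f x y : Ck 2 f ->
  (forall t, 0 <= t <= 1 -> 0 <= hess_form f (t *: (x - y) + y) (x - y)) ->
  tangent f y x <= f x.
Proof.
move=> f2 H; set v := x - y in H.
have f1 : Ck 1 f by case: f2 => cf h; split => // i; have [h1 [h2 _]] := h i.
have p1 i : Ck 1 (partial i f) by case: f2 => _ /(_ i)[].
pose g (t : R) := f (t *: v + y).
have dg t := derivable_line y (fun z => (derive_partial z v f1).1) t.
have g1 : derive1 g = fun t => \sum_i v 0 i * partial i f (t *: v + y).
  by apply/funext => t; rewrite (dg t).2 (derive_partial _ _ f1).2.
have dpi i t := derivable_line y (fun z => (derive_partial z v (p1 i)).1) t.
have dg1 (t : R) : derivable (derive1 g) t 1 /\ derive1 (derive1 g) t = hess_form f (t *: v + y) v.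
  rewrite g1.
  have E : (fun t : R => \sum_i v 0 i * partial i f (t *: v + y)) =
      \sum_i (fun t : R => v 0 i * partial i f (t *: v + y)).
    by apply/funext => s; rewrite fct_sumE.
  have dM i : derivable (fun t : R => v 0 i * partial i f (t *: v + y)) t 1.
    by apply: derivableM; [exact: derivable_cst|exact: (dpi i t).1].
  rewrite E; split; first exact: derivable_sum.
  rewrite derive1E derive_sum//; apply: eq_bigr => i _.
  rewrite (@deriveMl _ _ (fun t : R => partial i f (t *: v + y)) (v 0 i)); last exact: (dpi i t).1.
  rewrite -derive1E (dpi i t).2 (derive_partial _ _ (p1 i)).2 mulr_sumr.
  by apply: eq_bigr => j _; rewrite mulrA.
have [c /andP[c0 c1]] := mean_value_le ler01 (fun t => (dg t).1).
rewrite -/g subr0 mulr1 /g scale1r scale0r add0r subrK => E.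
have [e /andP[e0 ec]] := mean_value_le c0 (fun t => (dg1 t).1).
rewrite (dg1 e).2 subr0 => E2.
have : 0 <= hess_form f (e *: v + y) v * c.
  by rewrite mulr_ge0// H// e0 (le_trans ec).
rewrite -E2 subr_ge0 -/g => h.
have -> : tangent f y x = f y + derive1 g 0.
  rewrite /tangent g1; congr (_ + _); apply: eq_bigr => i _.
  by rewrite scale0r add0r !mxE.
by rewrite -lerBrDl E.
Qed.

End convexity.

Section Ck_closure.
Context {R : realType} {d : nat}.
Implicit Types (f g : 'rV[R]_d -> R) (x : 'rV[R]_d) (k : nat).

Definition smooth f := forall k, Ck k f.

Lemma CkW k f : Ck k.+1 f -> Ck k f.
Proof.
elim: k f => [|k IH] f [cf H]; first by [].
by split=> // i; have [H1 H2] := H i; split => //; exact: IH.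
Qed.

Lemma Ck_derivable k i f x : Ck k.+1 f -> derivable f x (delta_mx 0 i).
Proof. by move=> [_ /(_ i)[]]. Qed.

Lemma Ck_partial k i f : Ck k.+1 f -> Ck k (partial i f).
Proof. by move=> [_ /(_ i)[]]. Qed.

Lemma Ck_cst k (c : R) : Ck k (fun _ : 'rV[R]_d => c).
Proof.
elim: k c => [|k IH] c; split => //; try exact: cst_continuous.
move=> i; split=> [x|]; first exact: derivable_cst.
rewrite (_ : partial i _ = fun=> 0)//; apply/funext => x.
exact: derive_cst.
Qed.

Lemma partialD i f g x : derivable f x (delta_mx 0 i) ->
  derivable g x (delta_mx 0 i) ->
  partial i (fun y => f y + g y) x = partial i f x + partial i g x.
Proof. exact: deriveD. Qed.

Lemma partialM i f g x : derivable f x (delta_mx 0 i) ->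
  derivable g x (delta_mx 0 i) ->
  partial i (fun y => f y * g y) x = f x * partial i g x + g x * partial i f x.
Proof. exact: deriveM. Qed.

Lemma partialZ i f x (c : R) : derivable f x (delta_mx 0 i) ->
  partial i (fun y => c * f y) x = c * partial i f x.
Proof.
move=> df; have dc : derivable (cst c : 'rV[R]_d -> R) x (delta_mx 0 i) by exact: derivable_cst.
by rewrite (partialM dc df) [partial i (cst c) x]derive_cst mulr0 addr0.
Qed.

Lemma CkD k f g : Ck k f -> Ck k g -> Ck k (fun x => f x + g x).
Proof.
elim: k f g => [|k IH] f g [cf Hf] [cg Hg]; split => //; try exact: continuous_add.
move=> i; have [f1 f2] := Hf i; have [g1 g2] := Hg i; split=> [x|].
  exact: derivableD.
rewrite (_ : partial i _ = fun x => partial i f x + partial i g x); first exact: IH.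
by apply/funext => x; rewrite partialD.
Qed.

Lemma CkM k f g : Ck k f -> Ck k g -> Ck k (fun x => f x * g x).
Proof.
elim: k f g => [|k IH] f g kf kg; have cf := Ck_continuous kf; have cg := Ck_continuous kg.
  by split => //; exact: continuous_mul.
split; first exact: continuous_mul.
move=> i; split=> [x|].
  by apply: derivableM; apply: Ck_derivable; [exact: kf|exact: kg].
rewrite (_ : partial i _ = fun x => f x * partial i g x + g x * partial i f x).
  by apply: CkD; apply: IH; by [exact: CkW|exact: Ck_partial].
by apply/funext => x; rewrite partialM//; apply: Ck_derivable; [exact: kf|exact: kg].
Qed.

Lemma CkZ k (c : R) f : Ck k f -> Ck k (fun x => c * f x).
Proof. by apply: CkM; exact: Ck_cst. Qed.

Lemma CkN k f : Ck k f -> Ck k (fun x => - f x).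
Proof. by move=> /(CkZ (-1)); under eq_fun do rewrite mulN1r. Qed.

Lemma CkB k f g : Ck k f -> Ck k g -> Ck k (fun x => f x - g x).
Proof. by move=> kf /CkN; exact: CkD. Qed.

Lemma Ck_sum k (I : Type) (s : seq I) (F : I -> 'rV[R]_d -> R) :
  (forall i, Ck k (F i)) -> Ck k (fun x => \sum_(i <- s) F i x).
Proof.
move=> H; elim: s => [|i s IH].
  rewrite (_ : (fun x => _) = (fun=> 0)); first exact: Ck_cst.
  by apply/funext => x; rewrite big_nil.
rewrite (_ : (fun x => _) = (fun x => F i x + \sum_(j <- s) F j x)); first exact: CkD.
by apply/funext => x; rewrite big_cons.
Qed.

Lemma Ck_prod k (I : Type) (s : seq I) (F : I -> 'rV[R]_d -> R) :
  (forall i, Ck k (F i)) -> Ck k (fun x => \prod_(i <- s) F i x).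
Proof.
move=> H; elim: s => [|i s IH].
  rewrite (_ : (fun x => _) = (fun=> 1)); first exact: Ck_cst.
  by apply/funext => x; rewrite big_nil.
rewrite (_ : (fun x => _) = (fun x => F i x * \prod_(j <- s) F j x)); first exact: CkM.
by apply/funext => x; rewrite big_cons.
Qed.

Lemma partial_sum i (I : Type) (s : seq I) (F : I -> 'rV[R]_d -> R) x :
  (forall j, Ck 1 (F j)) ->
  partial i (fun x => \sum_(j <- s) F j x) x = \sum_(j <- s) partial i (F j) x.
Proof.
move=> H; elim: s => [|j s IH].
  rewrite big_nil (_ : (fun x => _) = (fun=> 0)); first exact: derive_cst.
  by apply/funext => y; rewrite big_nil.
rewrite big_cons -IH -partialD; last first.
- by apply: (@Ck_derivable 0); exact: Ck_sum.
- by apply: (@Ck_derivable 0).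
by congr partial; apply/funext => y; rewrite big_cons.
Qed.

Lemma CkV k f : (forall x, f x != 0) -> Ck k f -> Ck k (fun x => (f x)^-1).
Proof.
move=> f0; elim: k => [|k IH] kf; have cf := Ck_continuous kf.
  by split=> // x; apply: (@continuousV _ _ f x (f0 x)); exact: cf.
split; first by move=> x; apply: (@continuousV _ _ f x (f0 x)); exact: cf.
move=> i; have fi x : derivable f x (delta_mx 0 i) by exact: Ck_derivable kf.
split=> [x|]; first exact: derivableV.
rewrite (_ : partial i _ = fun x => - ((f x)^-1 * (f x)^-1) * partial i f x).
  have kfV := IH (CkW kf).
  by apply: CkM; [apply: CkN; exact: CkM|exact: Ck_partial].
by apply/funext => x; rewrite /partial deriveV// -expr2 exprVn.
Qed.

Lemma derivable_coor i j x : derivable (fun y : 'rV[R]_d => y 0 j) x (delta_mx 0 i) /\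
  partial i (fun y => y 0 j) x = (i == j)%:R.
Proof.
suff cv : (fun h : R => h^-1 *: (((fun y : 'rV[R]_d => y 0 j) \o shift x) (h *: delta_mx 0 i) - x 0 j)) @ 0^'
    --> ((i == j)%:R : R).
  by split; [apply/cvg_ex; eexists; exact: cv|exact: cvg_lim cv].
rewrite (_ : (fun h : R => _) = fun h => h^-1 * (h * (i == j)%:R)); last first.
  by apply/funext => h; rewrite /= !mxE eqxx/= addrK -[_ *: _]/(_ * _) eq_sym.
have hc : (fun _ : R => (i == j)%:R : R) @ 0^' --> ((i == j)%:R : R) by exact: cvg_cst.
apply: (cvg_trans _ hc); apply: near_eq_cvg.
have : \forall h \near 0^', (h : R) != 0 by exact: nbhs_dnbhs_neq.
by apply: filterS => h h0; rewrite /= mulKf.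
Qed.

Lemma partial_coor i j x : partial i (fun y => y 0 j) x = (i == j)%:R.
Proof. exact: (derivable_coor i j x).2. Qed.

Lemma Ck_coor k j : Ck k (fun x : 'rV[R]_d => x 0 j).
Proof.
case: k => [|k]; first by split => //; exact: coor_continuous.
split; first exact: coor_continuous.
move=> i; split=> [x|]; first exact: (derivable_coor i j x).1.
rewrite (_ : partial i _ = fun=> (i == j)%:R); first exact: Ck_cst.
by apply/funext => x; rewrite partial_coor.
Qed.

End Ck_closure.

(** * Smooth cut-offs *)

Section flat_function.
Context {R : realType}.

(** The powers of [t^-1] make the family stable under differentiation: the derivative of [flat n] is
    a combination of [flat n.+1] and [flat n.+2]. Smoothness of all members then follows by one
    induction. *)
Definition flat (n : nat) (t : R) : R :=
  if 0 < t then t^-1 ^+ n * expR (- t^-1) else 0.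

Lemma flat_ge0 n t : 0 <= flat n t.
Proof.
rewrite /flat; case: ifP => // t0.
by rewrite mulr_ge0 ?expR_ge0// exprn_ge0// invr_ge0 ltW.
Qed.

Lemma flat_gt0 n t : 0 < t -> 0 < flat n t.
Proof. by move=> t0; rewrite /flat t0 mulr_gt0 ?expR_gt0// exprn_gt0// invr_gt0. Qed.

Lemma flat_eq0 n t : t <= 0 -> flat n t = 0.
Proof. by rewrite /flat leNgt => /negbTE ->. Qed.

(** With [y = h^-1], the exponential of [y] is the power [n.+2] of that of [y / n.+2], and the
    latter is at least [y / n.+2]. *)
Lemma flat_quadratic n h : `|flat n h| <= (n.+2)%:R ^+ n.+2 * h ^+ 2.
Proof.
have [h0|h0] := leP h 0.
  by rewrite flat_eq0// normr0 mulr_ge0 ?sqr_ge0// exprn_ge0.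
rewrite ger0_norm ?flat_ge0// /flat h0.
set y := h^-1; have y0 : 0 < y by rewrite invr_gt0.
have -> : h ^+ 2 = y ^- 2 by rewrite /y exprVn invrK.
rewrite ler_pdivlMr ?exprn_gt0// mulrAC -exprD addn2 expRN.
rewrite ler_pdivrMr ?expR_gt0//.
have N0 : 0 < n.+2%:R :> R by rewrite ltr0n.
have -> : expR y = expR (y / n.+2%:R) ^+ n.+2.
  by rewrite -expRM_natr -mulrA mulVf ?gt_eqF// mulr1.
have e0 : 0 <= n.+2%:R * expR (y / n.+2%:R) by rewrite mulr_ge0// expR_ge0.
rewrite -exprMn ler_pXn2r ?nnegrE ?(ltW y0)//.
rewrite [leRHS]mulrC -ler_pdivrMr//; apply: le_trans (expR_ge1Dx _).
by rewrite lerDr.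
Qed.

Lemma derive_flat n t : derivable (flat n) t 1 /\
  derive1 (flat n) t = - n%:R * flat n.+1 t + flat n.+2 t.
Proof.
have [t0|t0|->] := ltgtP t 0.
- have nE : \forall s \near t, flat n s = (fun=> 0) s.
    have h : \forall s \near t, s < 0 by exact: lt_nbhsl.
    by apply: filterS h => s s0; rewrite flat_eq0// ltW.
  split.
    apply: (@near_eq_derivable _ _ _ (fun=> 0)) => //.
    by apply: filterS nE => s ->.
  rewrite derive1E (near_eq_derive _ nE) derive_cst !flat_eq0 ?(ltW t0)//.
  by rewrite mulr0 addr0.
- pose g (s : R) : R := s^-1 ^+ n * expR (- s^-1).
  have nE : \forall s \near t, flat n s = g s.
    have h : \forall s \near t, 0 < s by exact: lt_nbhsr.
    by apply: filterS h => s s0; rewrite /flat s0.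
  have tn0 : t != 0 by rewrite gt_eqF.
  have dI : derivable (@id R) t 1 by exact: derivable_id.
  have dV : derivable (fun s : R => s^-1) t 1 by exact: (derivableV tn0 dI).
  have dVE : 'D_1 (fun s : R => s^-1) t = - t ^- 2.
    by rewrite (deriveV tn0 dI) derive_id [_ *: _]mulr1.
  pose psi (y : R) : R := y ^+ n * expR (- y).
  have dpsi (y : R) : is_derive y 1 psi (n%:R * y ^+ n.-1 * expR (- y) - y ^+ n * expR (- y)).
    have h1 := @is_deriveX _ _ (@id R) n y 1 1 (is_derive_id y 1).
    have h2 : is_derive y 1 (fun z : R => expR (- z)) (- expR (- y)).
      have dN : derivable (fun s : R => - s) y 1 by exact: derivableN.
      have [c1 c2] := derive_comp1 dN (@ex_derive _ _ _ _ _ _ _ (is_derive_expR (- y))).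
      apply: DeriveDef => //; rewrite c2 derive1E derive_val.
      by rewrite (@deriveN _ _ _ id _ _ (@derivable_id _ _ y 1)) derive_id mulrN1.
    have h3 := is_deriveM h1 h2.
    rewrite (_ : psi = (id ^+ n) * (fun z : R => expR (- z))); last first.
      by apply/funext => z; rewrite /psi /GRing.mul/= exprfctE.
    apply: (is_derive_eq h3); rewrite exprfctE -![_ *: _]/(_ * _) /=; ring.
  have [dg1 dg2] := derive_comp1 dV (@ex_derive _ _ _ _ _ _ _ (dpsi t^-1)).
  split; first by apply: (@near_eq_derivable _ _ _ g) => //; apply: filterS nE => s ->.
  rewrite derive1E (near_eq_derive _ nE) [LHS]dg2 dVE derive1E.
  rewrite (@derive_val _ _ _ _ _ _ _ (dpsi t^-1)) /flat t0.
  by case: n {psi dpsi dg1 dg2 nE g} => [|n]; rewrite /= ?exprS ?expr0; field.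
- have [h1 h2] := derive_quadratic (fun h _ => flat_quadratic n h).
  by split => //; rewrite h2 !flat_eq0// mulr0 addr0.
Qed.

End flat_function.

Section bumps.
Context {R : realType} {d : nat}.
Implicit Types (f g : 'rV[R]_d -> R) (x c : 'rV[R]_d) (k : nat).

Lemma partial_comp i (phi : R -> R) f x : derivable f x (delta_mx 0 i) ->
  derivable phi (f x) 1 ->
  derivable (fun y => phi (f y)) x (delta_mx 0 i) /\
  partial i (fun y => phi (f y)) x = derive1 phi (f x) * partial i f x.
Proof. by move=> df dphi; exact: derive_comp1. Qed.

Lemma Ck_flat k n f : Ck k f -> Ck k (fun x => flat n (f x)).
Proof.
have cflat m : continuous (@flat R m).
  by apply: derivable_continuous => t; exact: (derive_flat m t).1.
have ccomp m g : continuous g -> continuous (fun x => flat m (g x)).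
  by move=> cg x; apply: (@continuous_comp _ _ _ g (flat m)); [exact: cg|exact: cflat].
elim: k n f => [|k IH] n f kf; have cf := Ck_continuous kf.
  by split=> //; exact: ccomp.
split; first exact: ccomp.
move=> i; have H x := partial_comp (Ck_derivable (i := i) (x := x) kf) (derive_flat n (f x)).1.
split=> [x|]; first exact: (H x).1.
rewrite (_ : partial i _ = fun x =>
    (- n%:R * flat n.+1 (f x) + flat n.+2 (f x)) * partial i f x); last first.
  by apply/funext => x; rewrite (H x).2 (derive_flat n (f x)).2.
have kf' := CkW kf.
apply: CkM; last exact: Ck_partial.
by apply: CkD; [apply: CkZ|]; exact: IH.
Qed.

Definition smooth_step (t : R) : R := flat 0 t / (flat 0 t + flat 0 (1 - t)).

Lemma smooth_step_den t : 0 < flat 0 t + flat 0 (1 - t) :> R.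
Proof.
have [t0|t0] := leP t 0; first by rewrite ltr_wpDl ?flat_ge0// flat_gt0//; lra.
by rewrite ltr_pwDl ?flat_ge0// flat_gt0.
Qed.

Lemma smooth_step_ge0 t : 0 <= smooth_step t.
Proof. by rewrite divr_ge0 ?flat_ge0// ltW// smooth_step_den. Qed.

Lemma smooth_step_le1 t : smooth_step t <= 1.
Proof. by rewrite ler_pdivrMr ?smooth_step_den// mul1r lerDl flat_ge0. Qed.

Lemma smooth_step0 t : t <= 0 -> smooth_step t = 0.
Proof. by move=> t0; rewrite /smooth_step flat_eq0// mul0r. Qed.

Lemma smooth_step1 t : 1 <= t -> smooth_step t = 1.
Proof.
move=> t1; rewrite /smooth_step [flat 0 (1 - t)]flat_eq0 ?subr_le0// addr0.
by rewrite divff// gt_eqF// flat_gt0// (lt_le_trans ltr01).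
Qed.

Lemma Ck_smooth_step k f : Ck k f -> Ck k (fun x => smooth_step (f x)).
Proof.
move=> kf; apply: CkM; first exact: Ck_flat.
apply: CkV => [x|]; first by rewrite gt_eqF// smooth_step_den.
apply: CkD; first exact: Ck_flat.
by apply: Ck_flat; apply: CkB => //; exact: Ck_cst.
Qed.

Definition cube c (r : R) : set 'rV[R]_d := [set x | forall l, `|x 0 l - c 0 l| <= r].

Definition cube_bump c (r e : R) x : R :=
  \prod_l (smooth_step ((x 0 l - c 0 l + r) / e) * smooth_step ((c 0 l - x 0 l + r) / e)).

Lemma cube_bump_smooth c r e : smooth (cube_bump c r e).
Proof.
move=> k; apply: Ck_prod => l; apply: CkM; apply: Ck_smooth_step.
  apply: (@CkM _ _ _ _ (fun=> e^-1)); last exact: Ck_cst.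
  apply: CkD; last exact: Ck_cst.
  by apply: CkB; [exact: Ck_coor|exact: Ck_cst].
apply: (@CkM _ _ _ _ (fun=> e^-1)); last exact: Ck_cst.
apply: CkD; last exact: Ck_cst.
by apply: CkB; [exact: Ck_cst|exact: Ck_coor].
Qed.

Lemma cube_bump_ge0 c r e x : 0 <= cube_bump c r e x.
Proof. by apply: prodr_ge0 => l _; rewrite mulr_ge0// smooth_step_ge0. Qed.

Lemma cube_bump_le1 c r e x : cube_bump c r e x <= 1.
Proof.
apply: (@le_trans _ _ (\prod_(l < d) (1 : R))); last by rewrite big1.
apply: ler_prod => l _.
by rewrite mulr_ge0 ?smooth_step_ge0// mulr_ile1 ?smooth_step_ge0 ?smooth_step_le1.
Qed.

Lemma cube_bump_eq0 c r e x : 0 < e -> ~ cube c r x -> cube_bump c r e x = 0.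
Proof.
move=> e0 /existsNP[l /negP]; rewrite -ltNge => h.
rewrite /cube_bump (bigD1 l)//=; move: h; rewrite lter_normr => /orP[h|h].
  rewrite [smooth_step ((c 0 l - _ + _) / _)]smooth_step0 ?mulr0 ?mul0r//.
  by rewrite pmulr_lle0 ?invr_gt0//; lra.
rewrite [smooth_step ((x 0 l - _ + _) / _)]smooth_step0 ?mul0r//.
by rewrite pmulr_lle0 ?invr_gt0//; lra.
Qed.

Lemma cube_bump_eq1 c r e x : 0 < e -> cube c (r - e) x -> cube_bump c r e x = 1.
Proof.
move=> e0 h; rewrite /cube_bump big1// => l _; have := h l; rewrite ler_norml => /andP[h1 h2].
by rewrite !smooth_step1 ?mulr1// ler_pdivlMr// mul1r; lra.
Qed.

Lemma cube_compact c r : compact (cube c r).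
Proof.
rewrite (_ : cube c r = [set v : 'rV[R]_d | forall i, `[c 0 i - r, c 0 i + r]%classic (v ord0 i)]).
  by apply: (@rV_compact _ _ (fun i => `[c 0 i - r, c 0 i + r]%classic)) => i; exact: segment_compact.
by apply/seteqP; split => x h l; have := h l; rewrite /= in_itv/= ler_distl.
Qed.

Lemma cube_closed c r : closed (cube c r).
Proof. by apply: compact_closed; [exact: norm_hausdorff|exact: cube_compact]. Qed.

Lemma cube_test_function (A : set 'rV[R]_d) c r f : smooth f ->
  (forall x, ~ cube c r x -> f x = 0) -> cube c r `<=` A -> test_function A f.
Proof.
move=> sf f0 cA; have sub : closure [set x | f x != 0] `<=` cube c r.
  have /closure_id -> := @cube_closed c r.
  apply: closureS => x /= fx; apply: contrapT => /f0 fx0.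
  by rewrite fx0 eqxx in fx.
split => //; last exact: subset_trans sub cA.
exact: (subclosed_compact (@closed_closure _ _) (@cube_compact c r) sub).
Qed.

Lemma test_function_compactly_supported (A : set 'rV[R]_d) f : test_function A f ->
  compactly_supported f.
Proof.
move=> [sf cf _]; split; first exact: Ck_continuous (sf 0%N).
have [n sub] := compact_subbox cf; exists n%:R => x bx.
apply/eqP/negPn/negP => fx; apply: bx; apply: sub.
by apply: subset_closure.
Qed.

Lemma test_function_partial (A : set 'rV[R]_d) f i : test_function A f ->
  test_function A (partial i f).
Proof.
move=> [sf cf fA]; have sub : closure [set x | partial i f x != 0] `<=` closure [set x | f x != 0].
  have /closure_id -> := @closed_closure _ [set x | f x != 0].
  apply: closureS => x /= px; apply: contrapT => fx.
  move/eqP: px; apply; rewrite /partial (@near_eq_derive _ _ _ _ (fun=> 0)) ?derive_cst//.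
  have : open (~` closure [set x | f x != 0]) by apply: closed_openC; exact: closed_closure.
  rewrite openE => /(_ _ fx); apply: filterS => y fy.
  by apply/eqP/negPn/negP => fy0; apply: fy; exact: subset_closure.
split.
- by move=> k; apply: Ck_partial; exact: sf.
- exact: (subclosed_compact (@closed_closure _ _) cf sub).
- exact: subset_trans sub fA.
Qed.

Lemma test_function_out (A : set 'rV[R]_d) f x : test_function A f -> ~ A x -> f x = 0.
Proof.
move=> [_ _ fA] Ax; apply/eqP/negPn/negP => fx; apply: Ax; apply: fA.
exact: subset_closure.
Qed.

End bumps.

Section cubic.
Context {R : realType} {d : nat}.

(** The power [n.+1] of the positive part of [t]; as a product with [Num.max t 0] it is visibly
    continuous, also for [n = 0]. *)
Definition pos_pow (n : nat) (t : R) : R := t ^+ n * Num.max t 0.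

Lemma pos_powE n (t : R) : pos_pow n t = if 0 < t then t ^+ n.+1 else 0.
Proof.
rewrite /pos_pow; have [t0|t0] := leP t 0.
  by rewrite mulr0.
by rewrite exprSr.
Qed.

Lemma derive_pos_pow n (t : R) : derivable (pos_pow n.+1) t 1 /\
  derive1 (pos_pow n.+1) t = n.+2%:R * pos_pow n t.
Proof.
have [t0|t0|->] := ltgtP t 0.
- have nE : \forall s \near t, pos_pow n.+1 s = (fun=> 0) s.
    have h : \forall s \near t, s < 0 by exact: lt_nbhsl.
    by apply: filterS h => s s0; rewrite pos_powE ltNge ltW.
  split.
    apply: (@near_eq_derivable _ _ _ (fun=> 0)) => //.
    by apply: filterS nE => s ->.
  by rewrite derive1E (near_eq_derive _ nE) derive_cst pos_powE ltNge ltW// mulr0.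
- have nE : \forall s \near t, pos_pow n.+1 s = ((@id R) ^+ n.+2) s.
    have h : \forall s \near t, 0 < s by exact: lt_nbhsr.
    by apply: filterS h => s s0; rewrite pos_powE s0 exprfctE.
  have dX := @is_deriveX _ _ (@id R) n.+2 t 1 1 (is_derive_id t 1).
  split.
    apply: (@near_eq_derivable _ _ _ ((@id R) ^+ n.+2)) => //.
    by apply: filterS nE => s ->.
  by rewrite derive1E (near_eq_derive _ nE) derive_val pos_powE t0 /= [_ *: _]mulr1.
- have [h1 h2] : derivable (pos_pow n.+1) 0 1 /\ derive1 (pos_pow n.+1) (0 : R) = 0.
    apply: (@derive_quadratic _ _ 1) => h h1; rewrite mul1r pos_powE.
    case: ifP => h0; last by rewrite normr0 sqr_ge0.
    rewrite ger0_norm ?exprn_ge0// ?(ltW h0)//.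
    by apply: ler_wiXn2l => //; [exact: ltW|exact: le_trans (ler_norm h) h1].
  by split => //; rewrite h2 pos_powE ltxx mulr0.
Qed.

End cubic.

(** * Symmetric matrices and singular values *)

Section real_spectral_theorem.
Import complex.
Local Open Scope sesquilinear_scope.

(* Real and imaginary parts of a unitary eigenbasis of the complexified matrix:
   a resolution of the identity by real eigenvectors, which is all that is
   needed from the real spectral theorem. *)
Lemma symmetric_eigenvectors {R : realType} d (M : 'M[R]_d) : M^T = M ->
  exists (lam : 'I_d -> R) (a b : 'I_d -> 'rV[R]_d),
    [/\ forall k l, \sum_i (a i 0 k * a i 0 l + b i 0 k * b i 0 l) = (k == l)%:R,
        forall i, a i *m M = lam i *: a i &
        forall i, b i *m M = lam i *: b i].
Proof.
move=> Msym.
pose toC := real_complex R.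
pose A := map_mx toC M.
have AE : map_mx Num.conj A = A.
  by apply/matrixP => i j; rewrite !mxE; exact: conjc_real.
have AT : A^T = A by rewrite /A map_trmx Msym.
have Aherm : A \is hermsymmx.
  by apply/is_hermitianmxP; rewrite expr0 scale1r AT AE.
have /orthomx_spectralP := hermitian_normalmx Aherm.
have /mxOverP Dr := hermitian_spectral_diag_real Aherm.
set P := spectralmx A; set D := spectral_diag A in Dr * => AD.
have Pu : P \is unitarymx by exact: spectral_unitarymx.
have Pun : P \in unitmx by exact: unitarymx_unit.
have PA : P *m A = diag_mx D *m P by rewrite [in LHS]AD !mulmxA mulmxV// mul1mx.
have PP : P ^t* *m P = 1%:M by rewrite -invmx_unitary// mulVmx.
have ReD (x y : R[i]) : Re (x + y) = Re x + Re y by case: x y => [? ?] [? ?].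
have ImD (x y : R[i]) : Im (x + y) = Im x + Im y by case: x y => [? ?] [? ?].
have Re0 : Re (0 : R[i]) = 0 by [].
have Im0 : Im (0 : R[i]) = 0 by [].
have Resum (F : 'I_d -> R[i]) : Re (\sum_i F i) = \sum_i Re (F i) by exact: (big_morph (@Re R) ReD Re0).
have Imsum (F : 'I_d -> R[i]) : Im (\sum_i F i) = \sum_i Im (F i) by exact: (big_morph (@Im R) ImD Im0).
have ReMr (z : R[i]) (r : R) : Re (z * toC r) = Re z * r.
  by case: z => x y; rewrite /= mulr0 subr0.
have ImMr (z : R[i]) (r : R) : Im (z * toC r) = Im z * r.
  by case: z => x y; rewrite /= mulr0 add0r.
have DE i : D ord0 i = toC (Re (D ord0 i)) by rewrite [RHS]RRe_real.
have PE i k : \sum_j P i j * toC (M j k) = P i k * toC (Re (D ord0 i)).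
  have /matrixP/(_ i k) := PA; rewrite mul_diag_mx !mxE -DE mulrC => <-.
  by apply: eq_bigr => j _; rewrite mxE.
exists (fun i => Re (D ord0 i)), (fun i => \row_k Re (P i k)), (fun i => \row_k Im (P i k)); split.
- move=> k l; have /matrixP/(_ k l) := PP; rewrite !mxE => /(congr1 (@Re R)).
  rewrite Resum (_ : Re _ = (k == l)%:R); last by case: (k == l).
  move=> <-; apply: eq_bigr => i _; rewrite !mxE.
  by case: (P i k) => x y; case: (P i l) => z t; rewrite /= mulNr opprK.
- move=> i; apply/rowP => k; rewrite !mxE.
  have := congr1 (@Re R) (PE i k); rewrite Resum ReMr mulrC => <-.
  by apply: eq_bigr => j _; rewrite ReMr mxE.
- move=> i; apply/rowP => k; rewrite !mxE.
  have := congr1 (@Im R) (PE i k); rewrite Imsum ImMr mulrC => <-.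
  by apply: eq_bigr => j _; rewrite ImMr mxE.
Qed.

End real_spectral_theorem.

Section schatten.
Context {R : realType} {d : nat}.
Implicit Types (M : 'M[R]_d) (x y : 'rV[R]_d) (f lam : 'I_d -> R) (a b : 'I_d -> 'rV[R]_d).

Definition quad_form M x : R := \sum_k \sum_l M k l * x 0 k * x 0 l.

Definition resolution a b :=
  forall k l, \sum_i (a i 0 k * a i 0 l + b i 0 k * b i 0 l) = (k == l)%:R.

(** Functional calculus: if [a i] and [b i] are eigenvectors of M for [lam i], and [f i] is a
    function of [lam i], this is that function of M. The [2 * d] vectors form a tight frame rather
    than a basis. *)
Definition resolution_mx a b f : 'M[R]_d :=
  \matrix_(k, l) \sum_i f i * (a i 0 k * a i 0 l + b i 0 k * b i 0 l).

Lemma resolution_bilinear a b f x y :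
  \sum_k \sum_l resolution_mx a b f k l * x 0 k * y 0 l =
  \sum_i f i * (dotp (a i) x * dotp (a i) y + dotp (b i) x * dotp (b i) y).
Proof.
transitivity (\sum_k \sum_l \sum_i f i * (a i 0 k * x 0 k * (a i 0 l * y 0 l) +
    b i 0 k * x 0 k * (b i 0 l * y 0 l))).
  apply: eq_bigr => k _; apply: eq_bigr => l _; rewrite mxE !mulr_suml.
  by apply: eq_bigr => i _; ring.
under eq_bigr do rewrite exchange_big/=.
rewrite exchange_big/=; apply: eq_bigr => i _.
rewrite /dotp !mulr_suml -!big_split/= mulr_sumr; apply: eq_bigr => k _.
rewrite !mulr_sumr -big_split/= mulr_sumr; apply: eq_bigr => l _; ring.
Qed.

Lemma resolution_id a b x y : resolution a b ->
  \sum_i (dotp (a i) x * dotp (a i) y + dotp (b i) x * dotp (b i) y) = dotp x y.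
Proof.
move=> ab; transitivity (\sum_k \sum_l resolution_mx a b (fun=> 1) k l * x 0 k * y 0 l).
  by rewrite resolution_bilinear; apply: eq_bigr => i _; rewrite mul1r.
apply: eq_bigr => k _; rewrite (bigD1 k)//= [X in _ + X]big1 => [|l lk].
  rewrite mxE (eq_bigr (fun i => a i 0 k * a i 0 k + b i 0 k * b i 0 k)) => [|i _]; last by rewrite mul1r.
  by rewrite ab eqxx mul1r addr0.
rewrite mxE (eq_bigr (fun i => a i 0 k * a i 0 l + b i 0 k * b i 0 l)) => [|i _]; last by rewrite mul1r.
by rewrite ab eq_sym (negbTE lk) !mul0r.
Qed.

Lemma resolution_eigen a b lam M : resolution a b ->
  (forall i, a i *m M = lam i *: a i) -> (forall i, b i *m M = lam i *: b i) ->
  M = resolution_mx a b lam.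
Proof.
move=> ab aM bM; apply/matrixP => k l; rewrite mxE.
transitivity (\sum_j (k == j)%:R * M j l).
  by under eq_bigr do rewrite eq_sym; rewrite (sum_delta k (fun j => M j l)).
under eq_bigr do rewrite -ab mulr_suml.
rewrite exchange_big/=; apply: eq_bigr => i _.
have /rowP/(_ l) := aM i; rewrite !mxE => aE.
have /rowP/(_ l) := bM i; rewrite !mxE => bE.
rewrite mulrDr [lam i * (a i 0 k * _)]mulrCA [lam i * (b i 0 k * _)]mulrCA -aE -bE !mulr_sumr -big_split/=.
by apply: eq_bigr => j _; ring.
Qed.

(** The arithmetic-geometric inequality for each frame vector. It replaces an operator norm bound:
    unit vectors give the bound on entries, and choosing [y] as the image of [x] gives the bound on
    norms. *)
Lemma le_bilinear_resolution a b f x y : resolution a b -> (forall i, `|f i| <= 1) ->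
  `|\sum_k \sum_l resolution_mx a b f k l * x 0 k * y 0 l| <= 2^-1 * (dotp x x + dotp y y).
Proof.
move=> ab f1; rewrite resolution_bilinear -!(resolution_id _ _ ab) -big_split/= mulr_sumr.
apply: le_trans (ler_norm_sum _ _ _) _; apply: ler_sum => i _.
rewrite normrM; set p := dotp (a i) x; set q := dotp (a i) y.
set r := dotp (b i) x; set s := dotp (b i) y.
apply: (@le_trans _ _ (1 * `|p * q + r * s|)); first by rewrite ler_wpM2r.
rewrite mul1r ler_norml; apply/andP; split; rewrite -subr_ge0.
  have -> : p * q + r * s - - (2^-1 * (p * p + r * r + (q * q + s * s))) =
    2^-1 * ((p + q) ^+ 2 + (r + s) ^+ 2) by field.
  by rewrite mulr_ge0// addr_ge0// sqr_ge0.
have -> : 2^-1 * (p * p + r * r + (q * q + s * s)) - (p * q + r * s) =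
  2^-1 * ((p - q) ^+ 2 + (r - s) ^+ 2) by field.
by rewrite mulr_ge0// addr_ge0// sqr_ge0.
Qed.

Lemma dotp_ge0 x : 0 <= dotp x x.
Proof. by apply: sumr_ge0 => i _; rewrite -expr2 sqr_ge0. Qed.

Lemma dotp_eq0 x : dotp x x <= 0 -> x = 0.
Proof.
move=> h; have /eqP : dotp x x = 0 by apply/eqP; rewrite eq_le h dotp_ge0.
rewrite psumr_eq0 => [/allP H|i _]; last by rewrite -expr2 sqr_ge0.
apply/rowP => i; rewrite mxE; apply/eqP; rewrite -sqrf_eq0 expr2.
by apply: H; rewrite mem_index_enum.
Qed.

(** A singular value [s] has an eigenvector [v] of [M^T *m M] with [s ^ 2 |v|^2 = |v M^T|^2], and
    the hypothesis bounds the right-hand side by [|v|^2]. *)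
Lemma schatten_inf_le1 M : (forall x, dotp (x *m M^T) (x *m M^T) <= dotp x x) ->
  schatten_norm +oo%E M <= 1.
Proof.
move=> H; rewrite /schatten_norm /lp_norm; have [s0 sE] := singular_valuesP M.
set s := singular_values M in s0 sE *.
have s0' i : 0 <= s 0 i by exact: s0.
apply: bigmax_le => // i _; rewrite (ger0_norm (s0' i)).
have : root (char_poly (M^T *m M)) (s 0 i ^+ 2).
  by rewrite sE rootE horner_prod (bigD1 i)//= hornerXsubC subrr mul0r.
rewrite -eigenvalue_root_char => /eigenvalueP[v vE v0].
have : s 0 i ^+ 2 * dotp v v <= 1 * dotp v v.
  rewrite mul1r; apply: le_trans (H v).
  have -> : s 0 i ^+ 2 * dotp v v = dotp (v *m (M^T *m M)) v.
    by rewrite vE /dotp mulr_sumr; apply: eq_bigr => k _; rewrite mxE mulrA.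
  rewrite mulmxA /dotp le_eqVlt; apply/orP; left; apply/eqP.
  transitivity (\sum_k \sum_l (v *m M^T) 0 l * M l k * v 0 k).
    by apply: eq_bigr => k _; rewrite mxE mulr_suml.
  rewrite exchange_big/=; apply: eq_bigr => l _.
  rewrite [X in _ = _ * X]mxE mulr_sumr; apply: eq_bigr => k _.
  by rewrite [M^T k l]mxE mulrA mulrAC.
have vp : 0 < dotp v v.
  by rewrite ltNge; apply/negP => /dotp_eq0 h; rewrite h eqxx in v0.
by rewrite ler_pM2r// expr_le1.
Qed.

(** The eigenvalues of [M^T *m M] are at most 1, so M does not increase the Euclidean norm; then
    [|x . y| <= (|x|^2 + |y|^2) / 2] is applied to [x] and its image [y]. *)
Lemma schatten_inf_quad_form M x : schatten_norm +oo%E M <= 1 ->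
  `|quad_form M x| <= dotp x x.
Proof.
move=> H; have s1 i : singular_values M 0 i <= 1.
  apply: le_trans H; rewrite /schatten_norm /lp_norm.
  apply: le_trans (ler_norm _) _.
  exact: (le_bigmax _ (fun j => `|singular_values M 0 j|) i).
have [s0 sE] := singular_valuesP M; set s := singular_values M in s0 sE s1.
have Asym : (M^T *m M)^T = M^T *m M by rewrite trmx_mul trmxK.
have [lam [a [b [ab aA bA]]]] := symmetric_eigenvectors Asym.
have lam1 (v : 'rV[R]_d) i : v *m (M^T *m M) = lam i *: v -> v != 0 -> lam i <= 1.
  move=> vE v0; have : root (char_poly (M^T *m M)) (lam i).
    by rewrite -eigenvalue_root_char; apply/eigenvalueP; exists v.
  rewrite sE rootE horner_prod prodf_seq_eq0 => /hasP[j _ /=].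
  rewrite hornerXsubC subr_eq0 => /eqP ->.
  by rewrite exprn_ile1.
have key : dotp (x *m M^T) (x *m M^T) <= dotp x x.
  have -> : dotp (x *m M^T) (x *m M^T) = quad_form (M^T *m M) x.
    transitivity (\sum_j (\sum_k x 0 k * M j k) * (\sum_l x 0 l * M j l)).
      by apply: eq_bigr => j _; rewrite !mxE; congr (_ * _); apply: eq_bigr => k _; rewrite mxE.
    rewrite /quad_form; under [RHS]eq_bigr => k _ do under eq_bigr => l _ do rewrite !mxE !mulr_suml.
    under [RHS]eq_bigr do rewrite exchange_big/=.
    rewrite [RHS]exchange_big/=; apply: eq_bigr => j _; rewrite mulr_suml.
    apply: eq_bigr => k _; rewrite mulr_sumr; apply: eq_bigr => l _.
    by rewrite mxE; ring.
  rewrite /quad_form (resolution_eigen ab aA bA) resolution_bilinear -(resolution_id _ _ ab).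
  apply: ler_sum => i _; rewrite mulrDr -!expr2; apply: lerD.
    (* A frame vector may be zero and is then no eigenvector, but its term vanishes. *)
    have [a0|a0] := eqVneq (a i) 0; last by rewrite ler_piMl ?sqr_ge0// (lam1 (a i)).
    by rewrite a0 /dotp big1 ?expr0n ?mulr0// => k _; rewrite mxE mul0r.
  have [b0|b0] := eqVneq (b i) 0; last by rewrite ler_piMl ?sqr_ge0// (lam1 (b i)).
  by rewrite b0 /dotp big1 ?expr0n ?mulr0// => k _; rewrite mxE mul0r.
have -> : quad_form M x = dotp x (x *m M^T).
  apply: eq_bigr => k _; rewrite mxE mulr_sumr; apply: eq_bigr => l _.
  by rewrite mxE; ring.
apply: (@le_trans _ _ (2^-1 * (dotp x x + dotp (x *m M^T) (x *m M^T)))); last lra.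
rewrite /dotp -big_split/= mulr_sumr; apply: le_trans (ler_norm_sum _ _ _) _.
apply: ler_sum => k _; set p := x 0 k; set q := (x *m M^T) 0 k.
rewrite ler_norml; apply/andP; split; rewrite -subr_ge0.
  have -> : p * q - - (2^-1 * (p * p + q * q)) = 2^-1 * (p + q) ^+ 2 by field.
  by rewrite mulr_ge0// sqr_ge0.
have -> : 2^-1 * (p * p + q * q) - p * q = 2^-1 * (p - q) ^+ 2 by field.
by rewrite mulr_ge0// sqr_ge0.
Qed.

(** [S] is the negative part of M and [T] its sign. As [|lam| = lam + 2 max (0, - lam)], the pairing
    of [T] with M is the trace norm of M. The bound is stated for [c *: T] because [T] will be
    multiplied by a cut-off. *)
Lemma jordan_decomposition M : M^T = M -> exists S T : 'M[R]_d,
  [/\ forall x, 0 <= quad_form S x,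
      forall x, 0 <= quad_form (M + S) x,
      S^T = S,
      \sum_k \sum_l T k l * M k l = \tr M + 2 * \tr S &
      [/\ T^T = T, forall k l, `|T k l| <= 1 &
          forall c : R, 0 <= c <= 1 -> schatten_norm +oo%E (c *: T) <= 1]].
Proof.
move=> Msym; have [lam [a [b [ab aA bA]]]] := symmetric_eigenvectors Msym.
have ME := resolution_eigen ab aA bA.
pose S := resolution_mx a b (fun i => Num.max 0 (- lam i)).
pose T := resolution_mx a b (fun i => Num.sg (lam i)).
pose n i := dotp (a i) (a i) + dotp (b i) (b i).
have trE f : \tr (resolution_mx a b f) = \sum_i f i * n i.
  rewrite /mxtrace; under eq_bigr do rewrite mxE.
  rewrite exchange_big/=; apply: eq_bigr => i _.
  by rewrite -mulr_sumr /n /dotp -big_split.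
have symE f : (resolution_mx a b f)^T = resolution_mx a b f.
  apply/matrixP => k l; rewrite !mxE; apply: eq_bigr => i _; ring.
have qE f x : (forall i, 0 <= f i) -> 0 <= quad_form (resolution_mx a b f) x.
  move=> f0; rewrite /quad_form resolution_bilinear; apply: sumr_ge0 => i _.
  by rewrite mulr_ge0// addr_ge0// -expr2 sqr_ge0.
have sg1 i : `|Num.sg (lam i)| <= 1 by rewrite normr_sg; case: (_ == _).
exists S, T; split.
- by move=> x; apply: qE => i; rewrite le_max lexx.
- move=> x; rewrite ME (_ : _ + S = resolution_mx a b (fun i => lam i + Num.max 0 (- lam i))).
    by apply: qE => i; case: (leP 0 (- lam i)); lra.
  by apply/matrixP => k l; rewrite !mxE -big_split/=; apply: eq_bigr => i _; rewrite mulrDl.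
- exact: symE.
- rewrite {2}ME !trE.
  transitivity (\sum_i Num.sg (lam i) * (\sum_k \sum_l (a i 0 k * a i 0 l + b i 0 k * b i 0 l) * M k l)).
    under [RHS]eq_bigr do rewrite mulr_sumr.
    rewrite [RHS]exchange_big/=; apply: eq_bigr => k _.
    under [RHS]eq_bigr do rewrite mulr_sumr.
    rewrite [RHS]exchange_big/=; apply: eq_bigr => l _.
    by rewrite mxE mulr_suml; apply: eq_bigr => i _; rewrite mulrA.
  rewrite mulr_sumr -big_split/=; apply: eq_bigr => i _.
  have -> : \sum_k \sum_l (a i 0 k * a i 0 l + b i 0 k * b i 0 l) * M k l = lam i * n i.
    rewrite exchange_big/= /n /dotp -big_split/= mulr_sumr; apply: eq_bigr => l _.
    have /rowP/(_ l) := aA i; rewrite !mxE => aE.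
    have /rowP/(_ l) := bA i; rewrite !mxE => bE.
    rewrite mulrDr !mulrA -aE -bE !mulr_suml -big_split/=; apply: eq_bigr => k _; ring.
  have -> : Num.sg (lam i) * (lam i * n i) = (lam i + 2 * Num.max 0 (- lam i)) * n i.
    rewrite mulrA; congr (_ * _); have [l|l|l] := ltgtP (lam i) 0.
    - by rewrite ltr0_sg// (max_idPr _) ?oppr_ge0 ?ltW//; ring.
    - by rewrite gtr0_sg// (max_idPl _) ?oppr_le0 ?ltW//; ring.
    - by rewrite l sgr0 oppr0 (max_idPl _)//; ring.
  by ring.
split; first exact: symE.
- move=> k l.
  have := le_bilinear_resolution (delta_mx 0 k) (delta_mx 0 l) ab sg1.
  have dd (j : 'I_d) : dotp (delta_mx 0 j) (delta_mx 0 j) = 1 :> R.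
    rewrite /dotp (bigD1 j)//= big1 => [|i /negbTE ij]; first by rewrite !mxE !eqxx mulr1 addr0.
    by rewrite !mxE ij andbF mul0r.
  rewrite !dd (_ : 2^-1 * (1 + 1) = 1); last by field.
  rewrite (bigD1 k)//= [X in _ + X]big1 => [|i /negbTE ik].
    rewrite addr0 (bigD1 l)//= [X in _ + X]big1 => [|i /negbTE il].
      by rewrite !mxE !eqxx/= !mulr1 !addr0.
    by rewrite [delta_mx 0 l 0 i]mxE il andbF mulr0.
  by rewrite big1// => j _; rewrite [delta_mx 0 k 0 i]mxE ik andbF mulr0 mul0r.
- move=> c /andP[c0 c1]; apply: schatten_inf_le1 => x.
  have -> : c *: T = resolution_mx a b (fun i => c * Num.sg (lam i)).
    by apply/matrixP => k l; rewrite !mxE mulr_sumr; apply: eq_bigr => i _; rewrite mulrA.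
  (* With [y] the image of [x], the bilinear bound reads [|y|^2 <= (|x|^2 + |y|^2) / 2]. *)
  rewrite symE; set Z := resolution_mx _ _ _; set y := x *m Z.
  have csg1 i : `|c * Num.sg (lam i)| <= 1.
    by rewrite normrM ger0_norm// mulr_ile1.
  have := le_bilinear_resolution x y ab csg1; rewrite -/Z.
  have -> : \sum_k \sum_l Z k l * x 0 k * y 0 l = dotp y y.
    rewrite exchange_big/=; apply: eq_bigr => l _; rewrite -mulr_suml; congr (_ * _).
    by rewrite /y mxE; apply: eq_bigr => k _; rewrite mulrC.
  by rewrite ger0_norm ?dotp_ge0//; lra.
Qed.

End schatten.

(** * Maxima of affine forms *)

Section integration_by_parts_rV.
Context {R : realType} {d : nat}.
Implicit Types (f g : 'rV[R]_d -> R).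

Lemma integral_by_parts i f g : Ck 1 f -> Ck 1 g -> compactly_supported g ->
  integral_rV (fun x => f x * partial i g x) =
  - integral_rV (fun x => g x * partial i f x).
Proof.
move=> f1 g1 sg.
have df x : derivable f x (delta_mx 0 i) by exact: (Ck_derivable f1).
have dg x : derivable g x (delta_mx 0 i) by exact: (Ck_derivable g1).
have cf := Ck_continuous f1.
have cpf : continuous (partial i f) by exact: Ck_continuous (Ck_partial i f1).
have cpg : continuous (partial i g) by exact: Ck_continuous (Ck_partial i g1).
have sfg : compactly_supported (fun x => f x * g x) by exact: compactly_supportedMl.
have pE : partial i (fun x => f x * g x) = fun x => f x * partial i g x + g x * partial i f x.
  by apply/funext => x; rewrite partialM.
have s1 : compactly_supported (fun x => f x * partial i g x).
  by apply: compactly_supportedMl => //; exact: compactly_supported_partial.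
have s2 : compactly_supported (fun x => g x * partial i f x).
  by under eq_fun do rewrite mulrC; exact: compactly_supportedMl.
have : integral_rV (partial i (fun x => f x * g x)) = 0.
  apply: integral_partial_eq0; [exact: sfg|by move=> x; exact: derivableM|].
  rewrite pE; apply: continuous_add; first by case: s1.
  by case: s2.
by rewrite pE integral_rVD// => /eqP; rewrite addr_eq0 => /eqP.
Qed.

(** Moving the derivatives one at a time reverses their order, whence the form
    [partial j (partial i f)] of the Hessian. *)
Lemma integral_by_parts2 i j f g : Ck 2 f -> Ck 2 g -> compactly_supported g ->
  integral_rV (fun x => f x * partial i (partial j g) x) =
  integral_rV (fun x => g x * partial j (partial i f) x).
Proof.
move=> f2 g2 sg.
have f1 := CkW f2; have g1 := CkW g2.
have sp : compactly_supported (partial j g).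
  by apply: compactly_supported_partial => //; exact: Ck_continuous (Ck_partial j g1).
apply: etrans (integral_by_parts i f1 (Ck_partial j g2) sp) _.
under eq_fun do rewrite mulrC.
by rewrite (integral_by_parts j (Ck_partial i f2) g1 sg) opprK.
Qed.

End integration_by_parts_rV.

Section max_affine.
Context {R : realType} {d : nat}.
Implicit Types (f g : 'rV[R]_d -> R).

(** A finite maximum, described by being an upper bound that is attained. This needs no default
    value, implies that [I] is inhabited, and passes to sums and maxima by taking products and sums
    of index types. *)
Definition max_affine f := exists (I : finType) (L : I -> 'rV[R]_d * R),
  forall x, (forall a, affine_form (L a) x <= f x) /\ exists a, f x = affine_form (L a) x.

Lemma max_affine_form l : max_affine (@affine_form R d l).
Proof. by exists unit, (fun=> l) => x; split => //; exists tt. Qed.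

Lemma max_affine_cst (c : R) : max_affine (fun=> c : R).
Proof.
rewrite (_ : (fun=> c) = affine_form (0 : 'rV[R]_d, c)); first exact: max_affine_form.
apply/funext => x; rewrite /affine_form /dotp big1 ?add0r// => i _.
by rewrite mxE mul0r.
Qed.

Lemma max_affineD f g : max_affine f -> max_affine g -> max_affine (fun x => f x + g x).
Proof.
move=> [I [L H]] [J [K G]].
exists (I * J)%type, (fun p => ((L p.1).1 + (K p.2).1, (L p.1).2 + (K p.2).2)) => x.
have [H1 [a aE]] := H x; have [G1 [b bE]] := G x; split.
  by move=> [p q]; rewrite affine_formD/= lerD.
by exists (a, b); rewrite affine_formD/= aE bE.
Qed.

Lemma max_affineZ (c : R) f : 0 <= c -> max_affine f -> max_affine (fun x => c * f x).
Proof.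
move=> c0 [I [L H]]; exists I, (fun p => (c *: (L p).1, c * (L p).2)) => x.
have [H1 [a aE]] := H x; split; first by move=> p; rewrite affine_formZ ler_wpM2l.
by exists a; rewrite affine_formZ aE.
Qed.

Lemma max_affine_max f g : max_affine f -> max_affine g ->
  max_affine (fun x => Num.max (f x) (g x)).
Proof.
move=> [I [L H]] [J [K G]].
exists (I + J)%type, (fun p => match p with inl a => L a | inr b => K b end) => x.
have [H1 [a aE]] := H x; have [G1 [b bE]] := G x; split.
  by move=> [p|q]; rewrite le_max ?H1 ?G1 ?orbT.
have [fg|fg] := leP (f x) (g x).
  by exists (inr b).
by exists (inl a).
Qed.

Lemma max_affine_sum (I : Type) (s : seq I) (F : I -> 'rV[R]_d -> R) :
  (forall i, max_affine (F i)) -> max_affine (fun x => \sum_(i <- s) F i x).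
Proof.
move=> H; elim: s => [|i s IH].
  by under eq_fun do rewrite big_nil; exact: max_affine_cst.
by under eq_fun do rewrite big_cons; exact: max_affineD.
Qed.

Lemma max_affine_bigmax (I : Type) (s : seq I) g (F : I -> 'rV[R]_d -> R) :
  max_affine g -> (forall i, max_affine (F i)) ->
  max_affine (fun x => \big[Num.max/g x]_(i <- s) F i x).
Proof.
move=> Hg H; elim: s => [|i s IH].
  by under eq_fun do rewrite big_nil.
by under eq_fun do rewrite big_cons; exact: max_affine_max.
Qed.

Lemma max_affine_piecewise f : max_affine f -> piecewise_affine f.
Proof.
move=> [I [L H]]; have [_ [a0 _]] := H 0.
rewrite (_ : f = fun x => \big[Num.max/affine_form (L a0) x]_(a <- index_enum I) affine_form (L a) x).
  elim: (index_enum I) => [|a s IH].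
    by under eq_fun do rewrite big_nil; exact: piecewise_affine_form.
  under eq_fun do rewrite big_cons.
  by apply: piecewise_affine_max => //; exact: piecewise_affine_form.
apply/funext => x; have [H1 [a aE]] := H x; apply/eqP; rewrite eq_le; apply/andP; split.
  by rewrite aE; exact: (le_bigmax _ (fun a => affine_form (L a) x) a).
by apply: bigmax_le => // i _.
Qed.

Lemma max_affine_continuous f : max_affine f -> continuous f.
Proof. by move=> /max_affine_piecewise[]. Qed.

End max_affine.

(** * Log-sum-exp smoothing *)

Section log_sum_exp.
Context {R : realType} {d : nat}.
Variables (I : finType) (L : I -> 'rV[R]_d * R) (a0 : I) (eps : R).
Hypothesis eps0 : 0 < eps.

(** [E a / Z] are Gibbs weights on the affine forms; [N i / Z] is the mean of the i-th slope and
    will be the i-th partial derivative of the smoothing. *)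
Let E a (x : 'rV[R]_d) : R := expR (eps^-1 * affine_form (L a) x).
Let Z (x : 'rV[R]_d) : R := \sum_a E a x.
Let N i (x : 'rV[R]_d) : R := \sum_a (L a).1 0 i * E a x.

Definition log_sum_exp (x : 'rV[R]_d) : R := eps * ln (Z x).

Let Z0 x : 0 < Z x.
Proof.
rewrite /Z (bigD1 a0)//= ltr_pwDl ?expR_gt0//.
by apply: sumr_ge0 => i _; exact: expR_ge0.
Qed.

Lemma Ck_affine_form k l : Ck k (@affine_form R d l).
Proof.
apply: CkD; last exact: Ck_cst.
by apply: Ck_sum => i; apply: CkZ; exact: Ck_coor.
Qed.

Lemma partial_affine_form i l x : partial i (@affine_form R d l) x = l.1 0 i.
Proof.
rewrite partialD; last exact: derivable_cst.
  rewrite {2}/partial derive_cst addr0 (partial_sum _ _ _ (F := fun j x => l.1 0 j * x 0 j)); last first.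
    by move=> j; apply: CkZ; exact: Ck_coor.
  under eq_bigr => j _.
    rewrite (@partialZ _ _ i (fun y => y 0 j)) ?partial_coor; last exact: (Ck_derivable (Ck_coor 1 j)).
    rewrite mulrC eq_sym; over.
  by rewrite (sum_delta i (fun j => l.1 0 j)).
apply: (@Ck_derivable _ _ 0); apply: Ck_sum => j; apply: CkZ; exact: Ck_coor.
Qed.

Let derive_E i a x : derivable (E a) x (delta_mx 0 i) /\
  partial i (E a) x = eps^-1 * (L a).1 0 i * E a x.
Proof.
have k1 : Ck 1 (fun x => eps^-1 * affine_form (L a) x) by apply: CkZ; exact: Ck_affine_form.
have [h1 h2] := partial_comp (Ck_derivable (i := i) (x := x) k1)
  (@ex_derive _ _ _ _ _ _ _ (is_derive_expR (eps^-1 * affine_form (L a) x))).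
split; first exact: h1.
rewrite [LHS]h2 derive1E derive_val partialZ ?partial_affine_form; last exact: (Ck_derivable (Ck_affine_form 1 _)).
by rewrite mulrC.
Qed.

Let Ck_E k a : Ck k (E a).
Proof.
elim: k => [|k IH].
  split => //; have c1 : continuous (fun x => eps^-1 * affine_form (L a) x).
    by apply: Ck_continuous; apply: CkZ; exact: (Ck_affine_form 0).
  by move=> x; apply: continuous_comp; [exact: c1|exact: continuous_expR].
split; first exact: Ck_continuous IH.
move=> i; split=> [x|]; first exact: (derive_E i a x).1.
rewrite (_ : partial i _ = fun x => eps^-1 * (L a).1 0 i * E a x); first exact: CkZ.
by apply/funext => x; rewrite (derive_E i a x).2.
Qed.

Let Ck_Z k : Ck k Z.
Proof. by apply: Ck_sum => a; exact: Ck_E. Qed.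

Let Ck_N k i : Ck k (N i).
Proof. by apply: Ck_sum => a; apply: CkZ; exact: Ck_E. Qed.

Let partial_Z i x : partial i Z x = eps^-1 * N i x.
Proof.
rewrite (partial_sum _ _ _ (fun a => Ck_E 1 a)) mulr_sumr.
by apply: eq_bigr => a _; rewrite (derive_E i a x).2 mulrA.
Qed.

Let partial_N i j x : partial j (N i) x =
  eps^-1 * \sum_a (L a).1 0 i * (L a).1 0 j * E a x.
Proof.
rewrite (partial_sum _ _ _ (fun a => CkZ ((L a).1 0 i) (Ck_E 1 a))) mulr_sumr.
apply: eq_bigr => a _; rewrite partialZ; last exact: (derive_E j a x).1.
by rewrite (derive_E j a x).2; ring.
Qed.

Let partial_lse i x : derivable log_sum_exp x (delta_mx 0 i) /\
  partial i log_sum_exp x = N i x * (Z x)^-1.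
Proof.
have [h1 h2] := partial_comp (Ck_derivable (i := i) (x := x) (Ck_Z 1))
  (@ex_derive _ _ _ _ _ _ _ (is_derive1_ln (Z0 x))).
split; first by apply: derivableM => //; exact: derivable_cst.
rewrite partialZ// h2 derive1E (@derive_val _ _ _ _ _ _ _ (is_derive1_ln (Z0 x))) partial_Z.
by field; rewrite !gt_eqF.
Qed.

Lemma Ck_log_sum_exp k : Ck k log_sum_exp.
Proof.
have clse : continuous log_sum_exp.
  have cZ := Ck_continuous (Ck_Z 0).
  apply: continuous_mul; first exact: cst_continuous.
  by move=> x; apply: continuous_comp; [exact: cZ|exact: continuous_ln].
case: k => [//|k]; split => // i; split=> [x|]; first exact: (partial_lse i x).1.
rewrite (_ : partial i _ = fun x => N i x * (Z x)^-1).
  by apply: CkM => //; apply: CkV => // x; rewrite gt_eqF.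
by apply/funext => x; rewrite (partial_lse i x).2.
Qed.

(* The Hessian of log-sum-exp is a covariance matrix. *)
Lemma partial2_log_sum_exp i j x : partial j (partial i log_sum_exp) x =
  eps^-1 * \sum_a E a x / Z x * (((L a).1 0 i - N i x / Z x) * ((L a).1 0 j - N j x / Z x)).
Proof.
rewrite (_ : partial i _ = fun x => N i x * (Z x)^-1); last first.
  by apply/funext => y; rewrite (partial_lse i y).2.
have Zn0 y : Z y != 0 by rewrite gt_eqF.
have dZ := Ck_derivable (i := j) (x := x) (Ck_Z 1).
rewrite partialM; [|exact: (Ck_derivable (Ck_N 1 i))|exact: derivableV].
rewrite {1}/partial deriveV// -/(partial j Z x) partial_Z partial_N.
set S := \sum_a _ * _ * E a x.
have -> : \sum_a E a x / Z x * (((L a).1 0 i - N i x / Z x) * ((L a).1 0 j - N j x / Z x)) =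
    (S - N i x / Z x * N j x - N j x / Z x * N i x + N i x / Z x * (N j x / Z x) * Z x) / Z x.
  set m := N i x / Z x; set n := N j x / Z x.
  transitivity ((\sum_a ((L a).1 0 i * (L a).1 0 j * E a x - m * ((L a).1 0 j * E a x)
      - n * ((L a).1 0 i * E a x) + m * n * E a x)) / Z x).
    by rewrite mulr_suml; apply: eq_bigr => a _; field.
  by rewrite !big_split/= !sumrN -!mulr_sumr.
by rewrite -[_ *: _]/(_ * _); field; rewrite ?Zn0 ?gt_eqF.
Qed.

(** Since the Hessian is a covariance, the pairing is the Gibbs average of [quad_form M] at the
    deviations of the slopes from their mean. *)
Lemma log_sum_exp_pairing_ge0 (M : 'M[R]_d) x : (forall v, 0 <= quad_form M v) ->
  0 <= \sum_i \sum_j M i j * partial j (partial i log_sum_exp) x.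
Proof.
move=> M0.
have -> : \sum_i \sum_j M i j * partial j (partial i log_sum_exp) x =
    eps^-1 * \sum_a E a x / Z x * quad_form M (\row_i ((L a).1 0 i - N i x / Z x)).
  under eq_bigr => i _ do under eq_bigr => j _ do
    rewrite partial2_log_sum_exp mulrCA mulr_sumr.
  under eq_bigr => i _ do rewrite -mulr_sumr exchange_big/=.
  rewrite -mulr_sumr exchange_big/=; congr (_ * _); apply: eq_bigr => a _.
  rewrite /quad_form mulr_sumr; apply: eq_bigr => i _; rewrite mulr_sumr.
  by apply: eq_bigr => j _; rewrite !mxE; ring.
rewrite mulr_ge0 ?invr_ge0 ?(ltW eps0)//; apply: sumr_ge0 => a _.
by rewrite mulr_ge0// divr_ge0 ?expR_ge0// ltW.
Qed.

Lemma log_sum_exp_bounds f x :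
  (forall a, affine_form (L a) x <= f x) -> (exists a, f x = affine_form (L a) x) ->
  f x <= log_sum_exp x <= f x + eps * ln #|I|%:R.
Proof.
move=> H1 [a aE].
have I0 : 0 < #|I|%:R :> R by rewrite ltr0n; apply/card_gt0P; exists a0.
have fE : f x = eps * ln (expR (eps^-1 * f x)) by rewrite expRK mulrA mulfV ?gt_eqF// mul1r.
have eE : 0 < expR (eps^-1 * f x) by exact: expR_gt0.
rewrite {1}fE [f x + _](_ : _ = eps * ln (expR (eps^-1 * f x) * #|I|%:R)); last first.
  by rewrite lnM ?posrE// mulrDr -fE.
rewrite !ler_pM2l// !ler_ln ?posrE ?mulr_gt0//; apply/andP; split.
  by rewrite /Z (bigD1 a)//= /E -aE lerDl; apply: sumr_ge0 => i _; exact: expR_ge0.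
rewrite mulr_natr -sumr_const; apply: ler_sum => b _.
by rewrite ler_expR ler_pM2l ?invr_gt0.
Qed.

End log_sum_exp.

(** * The Hessian pairing *)

Opaque integral_rV.

Section hessian_pairing.
Context {R : realType} {d : nat}.
Implicit Types (f g u : 'rV[R]_d -> R) (F : 'I_d -> 'I_d -> 'rV[R]_d -> R).

Definition hess_pairing_fun f F x : R :=
  \sum_i \sum_j f x * partial i (partial j (F i j)) x.

Definition hess_pairing f F : R := integral_rV (hess_pairing_fun f F).

Definition C2c (phi : 'rV[R]_d -> R) := Ck 2 phi /\ compactly_supported phi.

Definition lap f x : R := \sum_i partial i (partial i f) x.

Lemma C2c_partial2 i j phi : C2c phi -> compactly_supported (partial i (partial j phi)).
Proof.
move=> [k2 s]; apply: compactly_supported_partial; last first.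
  exact: (Ck_continuous (Ck_partial i (Ck_partial j k2))).
apply: compactly_supported_partial => //; exact: (Ck_continuous (Ck_partial j k2)).
Qed.

Lemma C2cD phi psi : C2c phi -> C2c psi -> C2c (fun x => phi x + psi x).
Proof. by move=> [k1 s1] [k2 s2]; split; [exact: CkD|exact: compactly_supportedD]. Qed.

Lemma C2cMl f phi : Ck 2 f -> C2c phi -> C2c (fun x => f x * phi x).
Proof.
move=> kf [k s]; split; first exact: CkM.
by apply: compactly_supportedMl => //; exact: Ck_continuous kf.
Qed.

Lemma C2cZ (c : R) phi : C2c phi -> C2c (fun x => c * phi x).
Proof. by apply: C2cMl; exact: Ck_cst. Qed.

Lemma C2c_sum (I : Type) (s : seq I) (G : I -> 'rV[R]_d -> R) :
  (forall i, C2c (G i)) -> C2c (fun x => \sum_(i <- s) G i x).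
Proof.
by move=> H; split; [apply: Ck_sum|apply: compactly_supported_sum] => i; case: (H i).
Qed.

Lemma partial2D i j f g x : Ck 2 f -> Ck 2 g ->
  partial i (partial j (fun y => f y + g y)) x =
  partial i (partial j f) x + partial i (partial j g) x.
Proof.
move=> f2 g2; rewrite -partialD.
- congr (partial i _ x); apply/funext => y; rewrite partialD//.
  + exact: (Ck_derivable f2).
  + exact: (Ck_derivable g2).
- exact: (Ck_derivable (Ck_partial j f2)).
- exact: (Ck_derivable (Ck_partial j g2)).
Qed.

Lemma partial2Z i j (c : R) f x : Ck 2 f ->
  partial i (partial j (fun y => c * f y)) x = c * partial i (partial j f) x.
Proof.
move=> f2; rewrite -partialZ; last exact: (Ck_derivable (Ck_partial j f2)).
congr (partial i _ x); apply/funext => y; rewrite partialZ//.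
exact: (Ck_derivable f2).
Qed.

Lemma partial2_sum i j (I : Type) (s : seq I) (G : I -> 'rV[R]_d -> R) x :
  (forall a, Ck 2 (G a)) -> partial i (partial j (fun y => \sum_(a <- s) G a y)) x =
  \sum_(a <- s) partial i (partial j (G a)) x.
Proof.
move=> H; elim: s => [|a s IH].
  rewrite big_nil (_ : (fun y => _) = (fun=> 0 * 0)); last by apply/funext => y; rewrite big_nil mul0r.
  by rewrite (partial2Z _ _ 0 (f := fun=> 0)) ?mul0r//; exact: Ck_cst.
have -> : (fun y => \sum_(b <- a :: s) G b y) = (fun y => G a y + \sum_(b <- s) G b y).
  by apply/funext => y; rewrite big_cons.
by rewrite (partial2D i j x (H a) (Ck_sum s H)) IH big_cons.
Qed.

Lemma hess_pairing_supported f F : continuous f -> (forall i j, C2c (F i j)) ->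
  compactly_supported (hess_pairing_fun f F).
Proof.
move=> cf FC; apply: compactly_supported_sum => i; apply: compactly_supported_sum => j.
by apply: compactly_supportedMl => //; exact: C2c_partial2.
Qed.

Lemma hess_pairingDr f F G : continuous f -> (forall i j, C2c (F i j)) ->
  (forall i j, C2c (G i j)) ->
  hess_pairing f (fun i j x => F i j x + G i j x) = hess_pairing f F + hess_pairing f G.
Proof.
move=> cf FC GC; rewrite /hess_pairing -integral_rVD; try exact: hess_pairing_supported.
congr integral_rV; apply/funext => x; rewrite /hess_pairing_fun -big_split/=.
apply: eq_bigr => i _; rewrite -big_split/=; apply: eq_bigr => j _.
by rewrite partial2D ?mulrDr//; [case: (FC i j)|case: (GC i j)].
Qed.

Lemma hess_pairingZr f (c : R) F : continuous f -> (forall i j, C2c (F i j)) ->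
  hess_pairing f (fun i j x => c * F i j x) = c * hess_pairing f F.
Proof.
move=> cf FC; rewrite /hess_pairing -integral_rVZ; last exact: hess_pairing_supported.
congr integral_rV; apply/funext => x; rewrite /hess_pairing_fun mulr_sumr.
apply: eq_bigr => i _; rewrite mulr_sumr; apply: eq_bigr => j _.
by rewrite partial2Z 1?mulrCA//; case: (FC i j).
Qed.

Lemma hess_pairing_sumr f (I : Type) (s : seq I) (F : I -> 'I_d -> 'I_d -> 'rV[R]_d -> R) :
  continuous f -> (forall a i j, C2c (F a i j)) ->
  hess_pairing f (fun i j x => \sum_(a <- s) F a i j x) = \sum_(a <- s) hess_pairing f (F a).
Proof.
move=> cf FC; rewrite /hess_pairing -integral_rV_sum => [|a]; last exact: hess_pairing_supported.
congr integral_rV; apply/funext => x; rewrite /hess_pairing_fun [RHS]exchange_big/=.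
apply: eq_bigr => i _; rewrite [RHS]exchange_big/=; apply: eq_bigr => j _.
by rewrite partial2_sum ?mulr_sumr// => a; case: (FC a i j).
Qed.

Lemma hess_pairingBl f g F : continuous f -> continuous g -> (forall i j, C2c (F i j)) ->
  hess_pairing (fun x => f x - g x) F = hess_pairing f F - hess_pairing g F.
Proof.
move=> cf cg FC; rewrite /hess_pairing -integral_rVB; try exact: hess_pairing_supported.
congr integral_rV; apply/funext => x; rewrite /hess_pairing_fun -sumrB.
by apply: eq_bigr => i _; rewrite -sumrB; apply: eq_bigr => j _; rewrite mulrBl.
Qed.

Lemma hess_pairing_smooth f F : Ck 2 f -> (forall i j, C2c (F i j)) ->
  hess_pairing f F =
  integral_rV (fun x => \sum_i \sum_j F i j x * partial j (partial i f) x).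
Proof.
move=> f2 FC; have cf := Ck_continuous f2.
have c2 i j : continuous (partial j (partial i f)) := Ck_continuous (Ck_partial j (Ck_partial i f2)).
have sF i j : compactly_supported (fun x => F i j x * partial j (partial i f) x).
  under eq_fun do rewrite mulrC; apply: compactly_supportedMl; first exact: c2.
  by case: (FC i j).
have sf i j : compactly_supported (fun x => f x * partial i (partial j (F i j)) x).
  by apply: compactly_supportedMl => //; exact: C2c_partial2.
rewrite [LHS](integral_rV_sum2 sf) [RHS](integral_rV_sum2 sF).
apply: eq_bigr => i _; apply: eq_bigr => j _.
by case: (FC i j) => k s; exact: integral_by_parts2.
Qed.

Lemma integral_norm_bound f g (e : R) : continuous f -> 0 <= e -> compactly_supported g ->
  (forall x, g x != 0 -> `|f x| <= e) ->
  `|integral_rV (fun x => f x * g x)| <= e * integral_rV (fun x => `|g x|).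
Proof.
move=> cf e0 sg H.
have sn : compactly_supported (fun x => `|g x|).
  case: sg => cg [r rH]; split; last by exists r => x bx; rewrite rH// normr0.
  by move=> x; apply: (@continuous_comp _ _ _ g); [exact: cg|exact: norm_continuous].
have sfg : compactly_supported (fun x => f x * g x) by exact: compactly_supportedMl.
rewrite -integral_rVZ// ler_norml -integral_rVN; last exact: compactly_supportedZ.
have B x : `|f x * g x| <= e * `|g x|.
  have [->|g0] := eqVneq (g x) 0; first by rewrite !normr0 mulr0 normr0 mulr0.
  by rewrite normrM ler_wpM2r// H.
apply/andP; split; apply: integral_rV_le => //.
- by apply: compactly_supportedN; exact: compactly_supportedZ.
- by move=> x; have := B x; rewrite ler_norml => /andP[].
- exact: compactly_supportedZ.
- by move=> x; have := B x; rewrite ler_norml => /andP[].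
Qed.

(** For the smoothing, integration by parts puts the derivatives on a convex function and the
    integrand is nonnegative. In the definition of the pairing they fall on [F], so the sign
    survives the uniform limit. *)
Lemma max_affine_pairing_ge0 G F : max_affine G -> (forall i j, C2c (F i j)) ->
  (forall x v, 0 <= quad_form (\matrix_(i, j) F i j x) v) -> 0 <= hess_pairing G F.
Proof.
move=> mG FC F0; have cG := max_affine_continuous mG.
have [I [L H]] := mG; have [_ [a0 _]] := H 0.
pose K := \sum_i \sum_j integral_rV (fun x => `|partial i (partial j (F i j)) x|).
have K0 : 0 <= K.
  by apply: sumr_ge0 => i _; apply: sumr_ge0 => j _; apply: integral_rV_ge0 => x.
have lnI : 0 <= ln #|I|%:R :> R.
  by rewrite ln_ge0// ler1n; apply/card_gt0P; exists a0.
rewrite -oppr_le0; apply/ler_addgt0Pl => e e0; rewrite addr0.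
(* The pairings of [G] and of its smoothing differ by at most [eps * ln #|I| * K]; the added ones
   keep the denominator positive. *)
pose eps := e / ((ln #|I|%:R + 1) * (K + 1)).
have D0 : 0 < (ln #|I|%:R + 1) * (K + 1) by rewrite mulr_gt0// ltr_wpDl.
have eps0 : 0 < eps by rewrite divr_gt0.
pose g := log_sum_exp L eps.
have g2 : Ck 2 g := Ck_log_sum_exp L a0 eps0 2.
have cg := Ck_continuous g2.
have gpos : 0 <= hess_pairing g F.
  rewrite hess_pairing_smooth//; apply: integral_rV_ge0 => x.
  have := log_sum_exp_pairing_ge0 L a0 eps0 (M := \matrix_(i, j) F i j x) x (F0 x).
  by under eq_bigr => i _ do under eq_bigr => j _ do rewrite mxE.
have : hess_pairing g F - hess_pairing G F <= e.
  rewrite -hess_pairingBl//.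
  have sd i j : compactly_supported (fun x => (g x - G x) * partial i (partial j (F i j)) x).
    by apply: compactly_supportedMl; [exact: continuous_sub|exact: C2c_partial2].
  rewrite /hess_pairing [integral_rV _](integral_rV_sum2 sd).
  apply: (@le_trans _ _ (eps * ln #|I|%:R * K)).
    rewrite /K mulr_sumr; apply: ler_sum => i _.
    rewrite mulr_sumr; apply: ler_sum => j _; apply: le_trans (ler_norm _) _.
    apply: integral_norm_bound => [|||x _].
    - exact: continuous_sub.
    - by rewrite mulr_ge0// ltW.
    - exact: C2c_partial2.
    - have [H1 H2] := H x; have /andP[h1 h2] := log_sum_exp_bounds a0 eps0 H1 H2.
      by rewrite ger0_norm ?subr_ge0// lerBlDl.
  rewrite /eps -mulrA mulrAC ler_pdivrMr// ler_pM2l//.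
  by apply: ler_pM => //; rewrite lerDl.
by move: gpos; lra.
Qed.

Definition id_field (chi : 'rV[R]_d -> R) : 'I_d -> 'I_d -> 'rV[R]_d -> R :=
  fun i j x => (i == j)%:R * chi x.

Lemma hess_pairing_id f chi : continuous f -> C2c chi ->
  hess_pairing f (id_field chi) = integral_rV (fun x => f x * lap chi x).
Proof.
move=> cf cc; congr integral_rV; apply/funext => x.
rewrite /hess_pairing_fun /lap mulr_sumr; apply: eq_bigr => i _.
rewrite (bigD1 i)//= [X in _ + X]big1 ?addr0 => [|j ji].
  rewrite /id_field eqxx (partial2Z _ _ 1) ?mul1r//; by case: cc.
by rewrite /id_field eq_sym (negbTE ji) (partial2Z _ _ 0) ?mul0r ?mulr0//; case: cc.
Qed.

Lemma partial2_closed_supp (S : set 'rV[R]_d) phi i j x : closed S ->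
  (forall y, ~ S y -> phi y = 0) -> ~ S x -> partial i (partial j phi) x = 0.
Proof.
move=> cS phi0 Sx.
have oS : \forall y \near x, ~ S y.
  by have := closed_openC cS; rewrite openE => /(_ x Sx).
rewrite /partial (@near_eq_derive _ _ _ _ (fun=> 0)) ?derive_cst//.
apply: filterS (near_join oS) => y oy.
rewrite (@near_eq_derive _ _ _ _ (fun=> 0)) ?derive_cst//.
by apply: filterS oy => z; exact: phi0.
Qed.

(* For G, H convex, [chi I - chi F] and [chi I + chi F] are positive
   semidefinite, so the total variation of G - H against F is at most the mass
   of the Laplacian of G + H. *)
Lemma pairing_difference_le u G H chi F (S : set 'rV[R]_d) : continuous u ->
  max_affine G -> max_affine H -> C2c chi -> (forall x, 0 <= chi x) ->
  (forall i j, Ck 2 (F i j)) ->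
  (forall x v, `|quad_form (\matrix_(i, j) F i j x) v| <= dotp v v) ->
  closed S -> (forall x, ~ S x -> chi x = 0) -> (forall x, S x -> u x = G x - H x) ->
  hess_pairing u (fun i j x => chi x * F i j x) <=
  integral_rV (fun x => (G x + H x) * lap chi x).
Proof.
move=> cu mG mH cc chi0 F2 F1 cS chiS uS.
have cG := max_affine_continuous mG; have cH := max_affine_continuous mH.
have FC i j : C2c (fun x => chi x * F i j x).
  by under eq_fun do rewrite mulrC; exact: C2cMl.
have IC i j : C2c (id_field chi i j) by exact: C2cZ.
have -> : hess_pairing u (fun i j x => chi x * F i j x) =
    hess_pairing G (fun i j x => chi x * F i j x) - hess_pairing H (fun i j x => chi x * F i j x).
  rewrite -hess_pairingBl//; congr integral_rV; apply/funext => x.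
  apply: eq_bigr => i _; apply: eq_bigr => j _.
  have [Sx|Sx] := pselect (S x); first by rewrite uS.
  by rewrite (partial2_closed_supp _ _ cS) ?mulr0// => y Sy; rewrite chiS// mul0r.
have qE (s : R) x v : quad_form (\matrix_(i, j) (id_field chi i j x + s * (chi x * F i j x))) v =
    chi x * (dotp v v + s * quad_form (\matrix_(i, j) F i j x) v).
  rewrite mulrDr /dotp /quad_form !mulr_sumr -big_split/=; apply: eq_bigr => i _.
  rewrite !mulr_sumr; under eq_bigr do rewrite mxE mulrDl mulrDl.
  rewrite big_split/=; congr (_ + _); last by apply: eq_bigr => j _; rewrite mxE; ring.
  rewrite (bigD1 i)//= big1 ?addr0 => [|j ji]; rewrite /id_field.
    by rewrite eqxx mul1r mulrA.
  by rewrite eq_sym (negbTE ji) !mul0r.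
have pos (s : R) g : max_affine g -> `|s| = 1 ->
    0 <= hess_pairing g (id_field chi) + s * hess_pairing g (fun i j x => chi x * F i j x).
  move=> mg s1; have cgg := max_affine_continuous mg.
  have sC i j : C2c (fun x => s * (chi x * F i j x)) by exact: C2cZ.
  rewrite -hess_pairingZr// -hess_pairingDr//.
  apply: max_affine_pairing_ge0 => // [i j|x v]; first exact: C2cD.
  rewrite qE mulr_ge0//.
  have : `|s * quad_form (\matrix_(i, j) F i j x) v| <= dotp v v by rewrite normrM s1 mul1r.
  by rewrite ler_norml; lra.
have := pos (-1) G mG; rewrite normrN1 => /(_ erefl) p1.
have := pos 1 H mH; rewrite normr1 => /(_ erefl) p2.
have -> : integral_rV (fun x => (G x + H x) * lap chi x) =
    hess_pairing G (id_field chi) + hess_pairing H (id_field chi).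
  rewrite !hess_pairing_id// -integral_rVD.
  - by congr integral_rV; apply/funext => x; rewrite mulrDl.
  - by apply: compactly_supportedMl => //; apply: compactly_supported_sum => i; exact: C2c_partial2.
  - by apply: compactly_supportedMl => //; apply: compactly_supported_sum => i; exact: C2c_partial2.
apply: lerD; first by move: p1; rewrite mulN1r subr_ge0.
by rewrite -subr_ge0 opprK; move: p2; rewrite mul1r.
Qed.

Lemma integral_lap f chi : Ck 2 f -> C2c chi ->
  integral_rV (fun x => f x * lap chi x) = integral_rV (fun x => chi x * lap f x).
Proof.
move=> f2 cc; apply: etrans (esym (hess_pairing_id (Ck_continuous f2) cc)) _.
have IC i j : C2c (id_field chi i j) by exact: C2cZ.
rewrite (hess_pairing_smooth f2 IC).
congr integral_rV; apply/funext => x; rewrite /lap mulr_sumr; apply: eq_bigr => i _.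
rewrite (bigD1 i)//= [X in _ + X]big1 ?addr0 => [|j ji]; rewrite /id_field.
  by rewrite eqxx mul1r.
by rewrite eq_sym (negbTE ji) !mul0r.
Qed.

End hessian_pairing.

(** * The variation as a supremum over admissible fields *)

Section variation.
Context {R : realType} {d : nat}.
Implicit Types (f : 'rV[R]_d -> R) (A : set 'rV[R]_d) (F : 'rV[R]_d -> 'M[R]_d).

Definition admissible A F := (forall i j, test_function A (fun y => F y i j)) /\
  (forall x, schatten_norm +oo%E (F x) <= 1).

Lemma test_function_C2c A phi : test_function A phi -> C2c phi.
Proof.
move=> tp; split; last exact: test_function_compactly_supported tp.
by case: tp => sp _ _; exact: sp.
Qed.

Lemma hs_variation_integral f A F : continuous f -> admissible A F ->
  (\int[lebesgue_rV d]_(x in A) (\sum_(i < d) \sum_(j < d)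
     f x * partial i (partial j (fun y => F y i j)) x)%:E)%E =
  (hess_pairing f (fun i j y => F y i j))%:E.
Proof.
move=> cf [tF _]; rewrite (integral_rVE (A := A))// => [|x Ax].
  by apply: hess_pairing_supported => // i j; exact: test_function_C2c (tF i j).
rewrite big1// => i _; rewrite big1// => j _.
by rewrite (test_function_out (test_function_partial i (test_function_partial j (tF i j))) Ax) mulr0.
Qed.

Lemma hs_variation_ge f A F : continuous f -> admissible A F ->
  ((hess_pairing f (fun i j y => F y i j))%:E <= hessian_schatten_variation 1%E f A)%E.
Proof.
move=> cf aF; apply: ereal_sup_ubound; exists F; last exact: hs_variation_integral.
by move: aF; rewrite /admissible hoelder_conjugate1.
Qed.

Lemma hs_variation_le f A (c : \bar R) : continuous f ->
  (forall F, admissible A F -> ((hess_pairing f (fun i j y => F y i j))%:E <= c)%E) ->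
  (hessian_schatten_variation 1%E f A <= c)%E.
Proof.
move=> cf H; apply: ge_ereal_sup => _ [F [F1 F2] <-].
have aF : admissible A F by move: F2; rewrite hoelder_conjugate1.
by rewrite hs_variation_integral// H.
Qed.

Lemma hs_variation_approx f A (c : R) : continuous f ->
  (c%:E < hessian_schatten_variation 1%E f A)%E ->
  exists2 F, admissible A F & c < hess_pairing f (fun i j y => F y i j).
Proof.
move=> cf /ereal_sup_gt[_ [F [F1 F2] <-]].
have aF : admissible A F by move: F2; rewrite hoelder_conjugate1.
by rewrite hs_variation_integral// lte_fin; exists F.
Qed.

End variation.

(** * Local convex splitting *)

Lemma continuous_maxf {R : realType} {T : topologicalType} (f g : T -> R) :
  continuous f -> continuous g -> continuous (fun x => Num.max (f x) (g x)).
Proof. by move=> cf cg x; apply: continuous_max; [exact: cf|exact: cg]. Qed.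

Lemma le_bigmax_mem {R : realType} (I : eqType) (s : seq I) (b : R) (F : I -> R) i :
  i \in s -> F i <= \big[Num.max/b]_(j <- s) F j.
Proof.
elim: s => [//|j s IH]; rewrite inE big_cons le_max => /orP[/eqP ->|/IH ->]; first by rewrite lexx.
by rewrite orbT.
Qed.

Lemma bigmin_le_mem {R : realType} (I : eqType) (s : seq I) (b : R) (F : I -> R) i :
  i \in s -> \big[Num.min/b]_(j <- s) F j <= F i.
Proof.
elim: s => [//|j s IH]; rewrite inE big_cons ge_min => /orP[/eqP ->|/IH ->]; first by rewrite lexx.
by rewrite orbT.
Qed.

Section convex_splitting.
Context {R : realType} {d : nat}.
Implicit Types (f w : 'rV[R]_d -> R) (c x v : 'rV[R]_d).

Definition sqdist c x : R := \sum_k (x 0 k - c 0 k) ^+ 2.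

Definition centered_quad (S : 'M[R]_d) c x : R :=
  \sum_k \sum_l S k l * ((x 0 k - c 0 k) * (x 0 l - c 0 l)).

Lemma Ck_centered_coor n c k : Ck n (fun x : 'rV[R]_d => x 0 k - c 0 k).
Proof. by apply: CkB; [exact: Ck_coor|exact: Ck_cst]. Qed.

Lemma partial_centered_coor i c k x :
  partial i (fun x : 'rV[R]_d => x 0 k - c 0 k) x = (i == k)%:R.
Proof.
rewrite partialD ?partial_coor; last exact: derivable_cst.
  by rewrite /partial derive_cst addr0.
exact: (Ck_derivable (Ck_coor 1 k)).
Qed.

Lemma Ck_centered_quad n S c : Ck n (centered_quad S c).
Proof.
apply: Ck_sum => k; apply: Ck_sum => l; apply: CkZ.
by apply: CkM; exact: Ck_centered_coor.
Qed.

Lemma partial_centered_quad i S c x : S^T = S ->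
  partial i (centered_quad S c) x = 2 * \sum_l S i l * (x 0 l - c 0 l).
Proof.
move=> Ssym; have k1 k : Ck 1 (fun x : 'rV[R]_d => x 0 k - c 0 k) := Ck_centered_coor 1 c k.
have k2 k l : Ck 1 (fun x : 'rV[R]_d => S k l * ((x 0 k - c 0 k) * (x 0 l - c 0 l))).
  by apply: CkZ; apply: CkM.
rewrite (partial_sum _ _ _ (fun k => Ck_sum (index_enum 'I_d) (k2 k))).
transitivity (\sum_k \sum_l (S k l * (x 0 k - c 0 k) * (i == l)%:R + S k l * (x 0 l - c 0 l) * (i == k)%:R)).
  apply: eq_bigr => k _; rewrite (partial_sum _ _ _ (k2 k)); apply: eq_bigr => l _.
  rewrite partialZ; last exact: (Ck_derivable (CkM (k1 k) (k1 l))).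
  rewrite partialM; try exact: Ck_derivable (k1 _).
  by rewrite !partial_centered_coor mulrDr !mulrA.
under eq_bigr do rewrite big_split/=.
rewrite big_split/= mulr_natl mulr2n; congr (_ + _).
  apply: eq_bigr => k _.
  under eq_bigr do rewrite mulrC eq_sym.
  by rewrite (sum_delta i (fun l => S k l * (x 0 k - c 0 k))) -[in LHS]Ssym mxE.
rewrite exchange_big/=; apply: eq_bigr => l _.
under eq_bigr do rewrite mulrC eq_sym.
by rewrite (sum_delta i (fun k => S k l * (x 0 l - c 0 l))).
Qed.

Lemma partial2_centered_quad i j S c x : S^T = S ->
  partial j (partial i (centered_quad S c)) x = 2 * S i j.
Proof.
move=> Ssym; rewrite (_ : partial i _ = fun x => 2 * \sum_l S i l * (x 0 l - c 0 l)); last first.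
  by apply/funext => y; rewrite partial_centered_quad.
have k1 l : Ck 1 (fun x : 'rV[R]_d => S i l * (x 0 l - c 0 l)).
  by apply: CkZ; exact: Ck_centered_coor.
rewrite partialZ; last exact: (Ck_derivable (Ck_sum (index_enum 'I_d) k1)).
rewrite (partial_sum _ _ _ k1); congr (_ * _).
transitivity (\sum_l (l == j)%:R * S i l); last by rewrite (sum_delta j (S i)).
apply: eq_bigr => l _; rewrite partialZ; last exact: (Ck_derivable (Ck_centered_coor 1 c l)).
by rewrite partial_centered_coor mulrC eq_sym.
Qed.

Lemma sqdistE c x : sqdist c x = centered_quad 1%:M c x.
Proof.
apply: eq_bigr => k _; rewrite (bigD1 k)//= big1 ?addr0 => [|l lk].
  by rewrite mxE eqxx mul1r expr2.
by rewrite mxE eq_sym (negbTE lk) mul0r.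
Qed.

(** The cube is the least integer power of the positive part that is of class C^2. The well is zero
    where the Hessian of [B] has to be sharp, and elsewhere its Hessian is at least
    [6 * (sqdist c x - s) ^ 2] times the identity. *)
Definition outer_well c (s : R) x : R := pos_pow 2 (sqdist c x - s).

Let q1 i c (s : R) x : derivable (fun x => sqdist c x - s) x (delta_mx 0 i) /\
  partial i (fun x => sqdist c x - s) x = 2 * (x 0 i - c 0 i).
Proof.
have -> : (fun x => sqdist c x - s) = (fun x => centered_quad 1%:M c x - s).
  by apply/funext => y; rewrite sqdistE.
have k1 := Ck_centered_quad 1 1%:M c.
split; first by apply: (@Ck_derivable _ _ 0); apply: CkB => //; exact: Ck_cst.
rewrite partialD; [|exact: (Ck_derivable k1)|exact: derivable_cst].
rewrite {2}/partial derive_cst addr0 partial_centered_quad ?trmx1//; congr (_ * _).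
rewrite (bigD1 i)//= big1 ?addr0 => [|l li]; first by rewrite mxE eqxx mul1r.
by rewrite mxE eq_sym (negbTE li) mul0r.
Qed.

Let partial_outer_well i c s x : derivable (outer_well c s) x (delta_mx 0 i) /\
  partial i (outer_well c s) x = 6 * (pos_pow 1 (sqdist c x - s) * (x 0 i - c 0 i)).
Proof.
have [d1 d2] := derive_pos_pow 1 (sqdist c x - s).
have [h1 h2] := partial_comp (q1 i c s x).1 d1.
by split => //; rewrite [LHS]h2 d2 (q1 i c s x).2; ring.
Qed.

Let pos1 i c s x : derivable (fun x => pos_pow 1 (sqdist c x - s)) x (delta_mx 0 i) /\
  partial i (fun x => pos_pow 1 (sqdist c x - s)) x = 4 * (pos_pow 0 (sqdist c x - s) * (x 0 i - c 0 i)).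
Proof.
have [d1 d2] := derive_pos_pow 0 (sqdist c x - s).
have [h1 h2] := partial_comp (q1 i c s x).1 d1.
by split => //; rewrite [LHS]h2 d2 (q1 i c s x).2; ring.
Qed.

Let partial_outer_wellE i c s : partial i (outer_well c s) =
  fun x => 6 * (pos_pow 1 (sqdist c x - s) * (x 0 i - c 0 i)).
Proof. by apply/funext => x; rewrite (partial_outer_well i c s x).2. Qed.

Lemma partial2_outer_well i j c s x : partial j (partial i (outer_well c s)) x =
  24 * (pos_pow 0 (sqdist c x - s) * ((x 0 i - c 0 i) * (x 0 j - c 0 j))) +
  6 * (pos_pow 1 (sqdist c x - s) * (i == j)%:R).
Proof.
have dy := Ck_derivable (i := j) (x := x) (Ck_centered_coor 1 c i).
have [p1 p2] := pos1 j c s x.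
rewrite partial_outer_wellE (@partialZ _ _ _ _ _ 6 (derivableM p1 dy)).
by rewrite partialM// p2 partial_centered_coor eq_sym; ring.
Qed.

Lemma Ck_outer_well c s : Ck 2 (outer_well c s).
Proof.
have cq : continuous (fun x => sqdist c x - s).
  apply: continuous_sub; last exact: cst_continuous.
  apply: continuous_sum => k; rewrite /GRing.exp/=.
  by apply: continuous_mul; exact: Ck_continuous (Ck_centered_coor 0 c k).
have cp n : continuous (fun x => pos_pow n (sqdist c x - s)).
  have cm : continuous (fun x => Num.max (sqdist c x - s) 0).
    exact: (continuous_maxf cq (@cst_continuous _ R^o 0)).
  apply: continuous_mul => //; elim: n => [|n IH].
    by under eq_fun do rewrite expr0; exact: cst_continuous.
  by under eq_fun do rewrite exprS; exact: continuous_mul.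
split; first exact: cp.
move=> i; split=> [x|]; first exact: (partial_outer_well i c s x).1.
have cy k : continuous (fun x => x 0 k - c 0 k) := Ck_continuous (Ck_centered_coor 0 c k).
rewrite partial_outer_wellE; split.
  apply: continuous_mul; first exact: cst_continuous.
  by apply: continuous_mul.
move=> j; split=> [x|].
  apply: derivableM; first exact: derivable_cst.
  apply: derivableM; first exact: (pos1 j c s x).1.
  exact: (Ck_derivable (Ck_centered_coor 1 c i)).
split => //; rewrite -partial_outer_wellE (_ : partial j _ = fun x =>
  24 * (pos_pow 0 (sqdist c x - s) * ((x 0 i - c 0 i) * (x 0 j - c 0 j))) +
  6 * (pos_pow 1 (sqdist c x - s) * (i == j)%:R)).
  apply: continuous_add; apply: continuous_mul; try exact: cst_continuous.
    by apply: continuous_mul => //; exact: continuous_mul.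
  by apply: continuous_mul => //; exact: cst_continuous.
by apply/funext => x; rewrite partial2_outer_well.
Qed.

Lemma bilinear_bound (E : 'I_d -> 'I_d -> R) (e : R) v : (forall i j, `|E i j| <= e) ->
  `|\sum_i \sum_j v 0 i * v 0 j * E i j| <= e * d%:R * dotp v v.
Proof.
move=> HE; case: (posnP d) => [d0|d0].
  rewrite big1 ?normr0 => [|i _]; last first.
    by suff : false by []; move: (ltn_ord i); move: (nat_of_ord i) => m; rewrite d0.
  rewrite /dotp big1 ?mulr0// => i _.
  by suff : false by []; move: (ltn_ord i); move: (nat_of_ord i) => m; rewrite d0.
have e0 : 0 <= e by apply: le_trans (HE (Ordinal d0) (Ordinal d0)).
apply: (@le_trans _ _ (\sum_(i < d) \sum_(j < d) e * (2^-1 * (v 0 i * v 0 i + v 0 j * v 0 j)))).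
  apply: le_trans (ler_norm_sum _ _ _) _; apply: ler_sum => i _.
  apply: le_trans (ler_norm_sum _ _ _) _; apply: ler_sum => j _.
  rewrite normrM [leRHS]mulrC; apply: ler_pM => //.
  set p := v 0 i; set q := v 0 j; rewrite ler_norml; apply/andP; split; rewrite -subr_ge0.
    have -> : p * q - - (2^-1 * (p * p + q * q)) = 2^-1 * (p + q) ^+ 2 by field.
    by rewrite mulr_ge0// sqr_ge0.
  have -> : 2^-1 * (p * p + q * q) - p * q = 2^-1 * (p - q) ^+ 2 by field.
  by rewrite mulr_ge0// sqr_ge0.
rewrite (eq_bigr (fun i => e / 2 * (d%:R * (v 0 i * v 0 i) + dotp v v))) => [|i _].
  rewrite -mulr_sumr big_split/= -mulr_sumr sumr_const card_ord -[dotp v v *+ d]mulr_natl -/(dotp v v).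
  by rewrite le_eqVlt; apply/orP; left; apply/eqP; field.
by rewrite -!mulr_sumr big_split/= sumr_const card_ord -[_ *+ d]mulr_natl mulrA.
Qed.

Lemma hess_formD f g x v : Ck 2 f -> Ck 2 g ->
  hess_form (fun y => f y + g y) x v = hess_form f x v + hess_form g x v.
Proof.
move=> f2 g2; rewrite /hess_form -big_split/=; apply: eq_bigr => i _.
by rewrite -big_split/=; apply: eq_bigr => j _; rewrite partial2D// mulrDr.
Qed.

(** [B] is half the quadratic form of the negative part [S] of the Hessian at [c], enlarged by
    [kappa * d] to absorb the oscillation of the Hessian while [sqdist c x <= 4 * s], plus a
    multiple of a well that vanishes up to [s] and takes over beyond [4 * s], where only the bound
    [M0] is available. In the error, [d] comes from the Laplacian of [w] and [2 * d ^ 2] from twice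
    the trace of the enlargement. *)
Lemma local_convex_splitting w (r s kappa M0 : R) c : Ck 2 w -> 0 < s ->
  0 <= kappa -> 0 <= M0 ->
  (forall x, box r x -> forall i j, `|partial j (partial i w) x| <= M0) ->
  (forall x, box r x -> sqdist c x <= 4 * s ->
     forall i j, `|partial j (partial i w) x - partial j (partial i w) c| <= kappa) ->
  exists (B : 'rV[R]_d -> R) (T : 'M[R]_d) (t : R), [/\ Ck 2 B,
    forall x v, box r x -> 0 <= hess_form B x v /\ 0 <= hess_form (fun y => w y + B y) x v,
    forall x, box r x -> sqdist c x <= s -> lap w x + 2 * lap B x <= t + kappa * (d%:R + 2 * d%:R ^+ 2),
    t = \sum_i \sum_j T i j * partial j (partial i w) c /\ 0 <= t &
    [/\ forall k l, `|T k l| <= 1 &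
        forall a : R, 0 <= a <= 1 -> schatten_norm +oo%E (a *: T) <= 1]].
Proof.
move=> w2 s0 kappa0 M00 HM Hk.
have [Hc HcE] : exists Hc : 'M[R]_d, forall i j, Hc i j = partial j (partial i w) c.
  by exists (\matrix_(i, j) partial j (partial i w) c) => i j; rewrite mxE.
(* The symmetric part has the same quadratic form and the same trace, and it has the eigenvectors
   that the decomposition uses. *)
have [M ME] : exists M : 'M[R]_d, M = 2^-1 *: (Hc + Hc^T) by exists (2^-1 *: (Hc + Hc^T)).
have MijE i j : M i j = 2^-1 * (Hc i j + Hc j i) by rewrite ME !mxE.
have Msym : M^T = M by rewrite ME linearZ/= linearD/= trmxK addrC.
have [S [T [S0 MS0 Ssym trT [Tsym T1 Tsch]]]] := jordan_decomposition Msym.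
(* A matrix with entries bounded by [kappa] has a quadratic form bounded by [kappa * d] times the
   identity. *)
pose k : R := kappa * d%:R.
pose S' := S + k%:M.
have S'sym : S'^T = S' by rewrite /S' linearD/= Ssym tr_scalar_mx.
(* Beyond [4 * s] one has [pos_pow 1 (sqdist c x - s) >= s ^ 2], so the well contributes at least
   [M0 * d], the bound for the Hessian of [w]. *)
pose K : R := M0 * d%:R / s ^+ 2.
have K0 : 0 <= K by rewrite divr_ge0 ?sqr_ge0// mulr_ge0.
pose B x := 2^-1 * centered_quad S' c x + K * outer_well c s x.
have b1 : Ck 2 (fun x => 2^-1 * centered_quad S' c x) by apply: CkZ; exact: Ck_centered_quad.
have b2 : Ck 2 (fun x => K * outer_well c s x) by apply: CkZ; exact: Ck_outer_well.
have B2 : Ck 2 B by exact: CkD.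
have pB i j x : partial j (partial i B) x = S' i j + K *
    (24 * (pos_pow 0 (sqdist c x - s) * ((x 0 i - c 0 i) * (x 0 j - c 0 j))) +
     6 * (pos_pow 1 (sqdist c x - s) * (i == j)%:R)).
  rewrite (partial2D _ _ _ b1 b2) (partial2Z _ _ _ _ (Ck_centered_quad 2 S' c)).
  rewrite (partial2Z _ _ _ _ (Ck_outer_well c s)).
  by rewrite partial2_centered_quad// partial2_outer_well mulKf.
have pos_ge0 n t : 0 <= pos_pow n t :> R.
  by rewrite pos_powE; case: ifP => // t0; rewrite exprn_ge0// ltW.
have hB x v : hess_form B x v = quad_form S v + k * dotp v v + K *
    (24 * (pos_pow 0 (sqdist c x - s) * (\sum_i (x 0 i - c 0 i) * v 0 i) ^+ 2) +
     6 * (pos_pow 1 (sqdist c x - s) * dotp v v)).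
  have -> : (\sum_i (x 0 i - c 0 i) * v 0 i) ^+ 2 =
      \sum_i \sum_j (x 0 i - c 0 i) * v 0 i * ((x 0 j - c 0 j) * v 0 j).
    by rewrite expr2 mulr_suml; apply: eq_bigr => i _; rewrite mulr_sumr.
  set p0 := pos_pow 0 _; set p1 := pos_pow 1 _.
  transitivity (\sum_i (\sum_j S i j * v 0 i * v 0 j + k * (v 0 i * v 0 i) +
      (K * (24 * (p0 * \sum_j (x 0 i - c 0 i) * v 0 i * ((x 0 j - c 0 j) * v 0 j))) +
       K * (6 * (p1 * (v 0 i * v 0 i)))))); last first.
    by rewrite !big_split/= -!mulr_sumr -mulrDr.
  apply: eq_bigr => i _.
  transitivity (\sum_j (S i j * v 0 i * v 0 j + (j == i)%:R * (k * (v 0 i * v 0 j)) +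
    (K * (24 * (p0 * ((x 0 i - c 0 i) * v 0 i * ((x 0 j - c 0 j) * v 0 j)))) +
    (j == i)%:R * (K * (6 * (p1 * (v 0 i * v 0 j))))))).
    apply: eq_bigr => j _; rewrite pB -/p0 -/p1 !mxE -mulr_natr [j == i]eq_sym; ring.
  rewrite !big_split/= (sum_delta i (fun j => k * (v 0 i * v 0 j))).
  rewrite (sum_delta i (fun j => K * (6 * (p1 * (v 0 i * v 0 j))))).
  by rewrite -!mulr_sumr.
have quadM v : quad_form M v = \sum_i \sum_j v 0 i * v 0 j * partial j (partial i w) c.
  rewrite /quad_form.
  transitivity (2^-1 * (\sum_i \sum_j v 0 i * v 0 j * Hc i j + \sum_i \sum_j v 0 j * v 0 i * Hc j i)).
    rewrite -big_split/= mulr_sumr; apply: eq_bigr => i _; rewrite -big_split/= mulr_sumr.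
    by apply: eq_bigr => j _; rewrite MijE; ring.
  rewrite [X in _ + X]exchange_big/= -mulr2n -[X in _ * X]mulr_natl mulKf//.
  by apply: eq_bigr => i _; apply: eq_bigr => j _; rewrite HcE.
pose t := \tr M + 2 * \tr S.
have tr_ge0 (A : 'M[R]_d) : (forall x, 0 <= quad_form A x) -> 0 <= \tr A.
  move=> A0; apply: sumr_ge0 => i _; have := A0 (delta_mx 0 i).
  rewrite /quad_form (bigD1 i)//= [X in _ + X]big1 ?addr0 => [|l /negbTE li]; last first.
    by rewrite big1// => j _; rewrite [delta_mx 0 i 0 l]mxE li andbF mulr0 mul0r.
  rewrite (bigD1 i)//= [X in _ + X]big1 ?addr0 => [|l /negbTE li]; last first.
    by rewrite [delta_mx 0 i 0 l]mxE li andbF mulr0.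
  by rewrite mxE !eqxx !mulr1.
exists B, T, t; split => //.
- move=> x v bx; have vv := dotp_ge0 v.
  have p0 := pos_ge0 0%N (sqdist c x - s); have p1 := pos_ge0 1%N (sqdist c x - s).
  have h0 : 0 <= K * (24 * (pos_pow 0 (sqdist c x - s) * (\sum_i (x 0 i - c 0 i) * v 0 i) ^+ 2) +
      6 * (pos_pow 1 (sqdist c x - s) * dotp v v)).
    apply: mulr_ge0 => //; apply: addr_ge0; apply: mulr_ge0 => //; apply: mulr_ge0 => //.
    exact: sqr_ge0.
  have k0 : 0 <= k by rewrite mulr_ge0.
  split.
    by rewrite hB addr_ge0// addr_ge0// mulr_ge0.
  rewrite hess_formD//; have [near|far] := leP (sqdist c x) (4 * s).
    have := bilinear_bound v (Hk x bx near).
    have -> : \sum_i \sum_j v 0 i * v 0 j * (partial j (partial i w) x - partial j (partial i w) c) =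
        hess_form w x v - quad_form M v.
      rewrite quadM /hess_form -sumrB; apply: eq_bigr => i _; rewrite -sumrB.
      by apply: eq_bigr => j _; rewrite mulrBr.
    rewrite ler_norml => /andP[h1 _]; rewrite hB.
    have h2 : 0 <= quad_form M v + quad_form S v.
      have := MS0 v; congr (0 <= _); rewrite /quad_form -big_split/=; apply: eq_bigr => i _.
      by rewrite -big_split/=; apply: eq_bigr => j _; rewrite mxE !mulrDl.
    rewrite -/k in h1; lra.
  have := bilinear_bound v (HM x bx); rewrite -/(hess_form w x v) ler_norml => /andP[h1 _].
  have h2 : M0 * d%:R * dotp v v <= K * (6 * (pos_pow 1 (sqdist c x - s) * dotp v v)).
    have h3 : s ^+ 2 <= pos_pow 1 (sqdist c x - s).
      have h4 : s <= sqdist c x - s by lra.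
      by rewrite pos_powE (lt_le_trans s0)// ler_pXn2r// nnegrE; [exact: ltW|exact: le_trans (ltW s0) h4].
    have -> : M0 * d%:R * dotp v v = K * (s ^+ 2 * dotp v v) by rewrite /K; field; rewrite gt_eqF.
    rewrite ler_wpM2l// (le_trans (_ : _ <= pos_pow 1 (sqdist c x - s) * dotp v v))//.
      by rewrite ler_wpM2r.
    rewrite -[leLHS]mul1r ler_wpM2r//; first by rewrite mulr_ge0.
    by rewrite ler1n.
  have h5 : 0 <= K * (24 * (pos_pow 0 (sqdist c x - s) * (\sum_i (x 0 i - c 0 i) * v 0 i) ^+ 2)).
    by apply: mulr_ge0 => //; apply: mulr_ge0 => //; apply: mulr_ge0 => //; exact: sqr_ge0.
  have h6 := S0 v; have h7 : 0 <= k * dotp v v by rewrite mulr_ge0.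
  rewrite hB [K * (_ + _)]mulrDr; lra.
- move=> x bx xs.
  have pz n : pos_pow n (sqdist c x - s) = 0 by rewrite pos_powE ltNge subr_le0 xs.
  have -> : lap B x = \tr S + kappa * d%:R ^+ 2.
    rewrite /lap; under eq_bigr do rewrite pB !pz !mul0r !mulr0 addr0 mulr0 addr0 !mxE eqxx mulr1n.
    by rewrite big_split/= sumr_const card_ord -[_ *+ d]mulr_natr /k -/(\tr S); ring.
  have h : lap w x <= \tr M + kappa * d%:R.
    rewrite mulr_natr -{3}(card_ord d) -sumr_const -big_split/=; apply: ler_sum => i _.
    have near : sqdist c x <= 4 * s by lra.
    have := Hk x bx near i i; rewrite ler_norml => /andP[_].
    rewrite MijE !HcE; move: (partial i (partial i w) x) (partial i (partial i w) c) => p q; lra.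
  rewrite /t; lra.
- split; last first.
    rewrite /t (_ : _ + _ = \tr (M + S) + \tr S); last by rewrite mxtraceD; ring.
    by rewrite addr_ge0// tr_ge0.
  rewrite /t -trT.
  transitivity (2^-1 * (\sum_i \sum_j T i j * Hc i j + \sum_i \sum_j T j i * Hc j i)).
    rewrite -big_split/= mulr_sumr; apply: eq_bigr => i _; rewrite -big_split/= mulr_sumr.
    apply: eq_bigr => j _; rewrite MijE.
    have -> : T j i = T i j by rewrite -{1}Tsym mxE.
    by ring.
  rewrite [X in _ + X]exchange_big/= -mulr2n -[X in _ * X]mulr_natl mulKf//.
  by apply: eq_bigr => i _; apply: eq_bigr => j _; rewrite HcE.
Qed.

(** The tangent plane at [y] is within [e] of [f] on an open set around [y], and compactness selects
    finitely many [y]. The tangent plane at the origin, which lies in the box, is the default value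
    of the maximum. *)
Lemma tangent_max_affine f (r e : R) : Ck 1 f -> 0 <= r -> 0 < e ->
  (forall x y, box r x -> box r y -> tangent f y x <= f x) ->
  exists G, max_affine G /\ forall x, box r x -> f x - e <= G x <= f x.
Proof.
move=> f1 r0 e0 H; have cf := Ck_continuous f1.
pose l y : 'rV[R]_d * R := (\row_i partial i f y, f y - \sum_i y 0 i * partial i f y).
have lE y x : affine_form (l y) x = tangent f y x.
  rewrite /affine_form /tangent /dotp /= addrCA; congr (_ + _).
  by rewrite -sumrB; apply: eq_bigr => i _; rewrite mxE; ring.
have := @box_compact R d r; rewrite compact_cover => /(_ _ (box r)
  (fun y => [set x | f x - tangent f y x < e])).
case.
- move=> y _; rewrite (_ : [set x | _] = (fun x => f x - tangent f y x) @^-1` [set t | t < e])//.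
  apply: open_comp; last exact: open_lt.
  move=> x _; apply: continuous_sub => //.
  have -> : tangent f y = affine_form (l y) by apply/funext => z; rewrite lE.
  exact: affine_form_continuous.
- move=> x bx; exists x => //=; rewrite /tangent big1 ?addr0 ?subrr// => i _.
  by rewrite subrr mul0r.
move=> D0 Dr cover; set D := finmap.enum_fset D0.
have b0 : box r (0 : 'rV[R]_d) by move=> k; rewrite mxE normr0.
exists (fun x => \big[Num.max/affine_form (l 0) x]_(y <- D) affine_form (l y) x).
split; first by apply: max_affine_bigmax => [|y]; exact: max_affine_form.
move=> x bx; apply/andP; split.
  have [y yD /= h] := cover x bx.
  apply: (@le_trans _ _ (affine_form (l y) x)); first by rewrite lE; lra.
  exact: (le_bigmax_mem (affine_form (l 0) x) (fun y => affine_form (l y) x) yD).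
rewrite big_seq; elim/big_ind: _ => [|a b ha hb|y yD]; first by rewrite lE; exact: H.
  by rewrite ge_max ha hb.
rewrite lE; apply: H => //.
by have := Dr y yD; rewrite in_setE.
Qed.

Lemma box_uniform_continuity f (r e : R) : continuous f -> 0 < e ->
  exists2 eta : R, 0 < eta & forall x y, box r x -> box r y ->
    (forall k, `|x 0 k - y 0 k| < eta) -> `|f x - f y| <= e.
Proof.
move=> cf e0; have e2 : 0 < e / 2 by rewrite divr_gt0.
have Hx x : exists2 del : R, 0 < del & forall y, ball x (2 * del) y -> `|f x - f y| < e / 2.
  have /cvgrPdist_lt/(_ _ e2)/nbhs_ballP[del /= del0 H] := cf x.
  exists (del / 2); first by rewrite divr_gt0.
  by move=> y; rewrite mulrC divfK// => xy; exact: H.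
have [del Hdel] := choice (fun x => let: ex_intro2 a b c := Hx x in ex_intro _ a (conj b c)).
have := @box_compact R d r; rewrite compact_cover => /(_ _ setT
  (fun y => ball y (del y))).
case.
- by move=> y _; exact: ball_open.
- by move=> x bx; exists x => //; apply: ballxx; exact: (Hdel x).1.
move=> D0 _ cover; set D := finmap.enum_fset D0.
exists (\big[Num.min/1]_(y <- D) del y).
  by elim/big_ind: _ => // [a b a0 b0|y _]; [rewrite lt_min a0 b0|exact: (Hdel y).1].
move=> x y bx by_ xy; have [z zD /= zx] := cover x bx.
have d0 := (Hdel z).1.
have hx : ball z (2 * del z) x.
  by apply: le_ball zx; lra.
have hy : ball z (2 * del z) y.
  rewrite mulr_natl mulr2n; apply: ball_triangle zx _; apply/rV_ballP; split => // k.
  apply: lt_le_trans (xy k) _.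
  exact: (bigmin_le_mem 1 del zD).
have := (Hdel z).2 x hx; have := (Hdel z).2 y hy.
rewrite !ltr_norml ler_norml => /andP[? ?] /andP[? ?]; apply/andP; split; lra.
Qed.

End convex_splitting.

(** * Gluing the local splittings by a maximum *)

Section patching.
Context {R : realType} {d : nat}.
Implicit Types (f g w : 'rV[R]_d -> R) (x y v : 'rV[R]_d).

Lemma box_segment (r t : R) x y : 0 <= t <= 1 -> box r x -> box r y ->
  box r (t *: (x - y) + y).
Proof.
move=> /andP[t0 t1] bx by_ l; have := bx l; have := by_ l; rewrite !mxE !ler_norml.
move: (x 0 l) (y 0 l) => a b /andP[b1 b2] /andP[a1 a2].
have -> : t * (a - b) + b = t * a + (1 - t) * b by ring.
have s0 : 0 <= 1 - t by rewrite subr_ge0.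
have h1 := ler_wpM2l t0 a1; have h2 := ler_wpM2l t0 a2.
have h3 := ler_wpM2l s0 b1; have h4 := ler_wpM2l s0 b2.
apply/andP; split; nra.
Qed.

Lemma convex_max_affine_approx f (r e : R) : Ck 2 f -> 0 <= r -> 0 < e ->
  (forall x v, box r x -> 0 <= hess_form f x v) ->
  exists G, max_affine G /\ forall x, box r x -> f x - e <= G x <= f x.
Proof.
move=> f2 r0 e0 H; apply: tangent_max_affine => //; first exact: CkW.
by move=> x y bx by_; apply: tangent_le => // t t01; apply: H; exact: box_segment.
Qed.

Lemma lap_supported (chi : 'rV[R]_d -> R) : C2c chi -> compactly_supported (lap chi).
Proof. by move=> cc; apply: compactly_supported_sum => i; exact: C2c_partial2. Qed.

(** The Laplacian is moved from [g] to the cut-off, where only the uniform distance to [f] matters.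
    This is how piecewise affine functions, which have no second derivatives, inherit the Laplacian
    bounds of their smooth models. *)
Lemma integral_lap_close f g chi (S : set 'rV[R]_d) (e : R) : continuous f -> Ck 2 g ->
  C2c chi -> closed S -> (forall x, ~ S x -> chi x = 0) -> 0 <= e ->
  (forall x, S x -> `|f x - g x| <= e) ->
  integral_rV (fun x => f x * lap chi x) <=
  integral_rV (fun x => chi x * lap g x) + e * integral_rV (fun x => `|lap chi x|).
Proof.
move=> cf g2 cc cS chi0 e0 fg; have cg := Ck_continuous g2.
have sl := lap_supported cc.
rewrite -lerBlDl; apply: le_trans (integral_norm_bound (continuous_sub cf cg) e0 sl _).
  apply: le_trans (ler_norm _).
  rewrite le_eqVlt; apply/orP; left; apply/eqP; apply: etrans (congr1 (fun z => _ - z) (esym (integral_lap g2 cc))) _.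
  apply: etrans (esym (integral_rVB (compactly_supportedMl cf sl) (compactly_supportedMl cg sl))) _.
  by congr integral_rV; apply/funext => x; rewrite mulrBl.
move=> x lx; apply: fg; apply: contrapT => Sx; move/eqP: lx; apply.
by rewrite /lap big1// => i _; exact: (partial2_closed_supp _ _ cS).
Qed.

Variables (w : 'rV[R]_d -> R) (r : R) (I : finType) (i0 : I).
Variables (B zeta chi : I -> 'rV[R]_d -> R) (core : I -> set 'rV[R]_d) (chi0 : 'rV[R]_d -> R).
Hypotheses (w2 : Ck 2 w) (r0 : 0 <= r) (B2 : forall k, Ck 2 (B k)).
Hypothesis convB : forall k x v, box r x ->
  0 <= hess_form (B k) x v /\ 0 <= hess_form (fun y => w y + B k y) x v.
Hypotheses (zetaM : forall k, max_affine (zeta k)) (zeta_ge0 : forall k x, 0 <= zeta k x)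
  (zeta_core : forall k x, core k x -> zeta k x = 0)
  (zeta_off : forall j k x, j != k -> core j x -> 1 <= zeta k x).
Hypotheses (core_closed : forall k, closed (core k)) (core_box : forall k, core k `<=` box r).
Hypotheses (chiC : forall k, C2c (chi k)) (chi_ge0 : forall k x, 0 <= chi k x)
  (chi_core : forall k x, ~ core k x -> chi k x = 0).
Hypotheses (chi0C : C2c chi0) (chi0_ge0 : forall x, 0 <= chi0 x)
  (chi0_box : forall x, ~ box r x -> chi0 x = 0).

(** Below, [u] is [G0 - H0] on the box with [H0] close to the sum of the [B k]; hence
    [G0 + H0 = u + 2 * H0] is uniformly close to [Q]. *)
Let Q x := w x + 2 * \sum_k B k x.

(* On [core k] the maximum of the differences [Ah_j - Bh_j - 2 eps zeta_j] is
   attained at [j = k], where the penalty vanishes; the maximum is a difference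
   of convex functions globally, and one with a sharper Laplacian bound there. *)
Lemma convex_patching (e : R) : 0 < e -> exists u, [/\ piecewise_affine u,
  forall x, box r x -> `|u x - w x| <= e,
  forall x, ~ box (r + 1) x -> u x = 0 &
  forall F : 'I_d -> 'I_d -> 'rV[R]_d -> R, (forall i j, Ck 2 (F i j)) ->
    (forall x v, `|quad_form (\matrix_(i, j) F i j x) v| <= dotp v v) ->
    (forall k, hess_pairing u (fun i j x => chi k x * F i j x) <=
       integral_rV (fun x => chi k x * lap (fun y => w y + 2 * B k y) x) + e) /\
    hess_pairing u (fun i j x => chi0 x * F i j x) <=
       integral_rV (fun x => chi0 x * lap Q x) + e].
Proof.
have aux (a b p : R) : 0 <= a -> 0 <= b -> 0 <= p -> [/\ 0 < 1 + p + 2 * a + b,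
    p <= 1 + p + 2 * a + b, 2 * a <= 1 + p + 2 * a + b & b <= 1 + p + 2 * a + b].
  by move=> a0 b0 p0; split; lra.
move=> e0.
have [Z Z0 HZ] : exists2 Z : R, 0 < Z & forall k x, box r x -> zeta k x <= Z.
  have cZ k := compact_bound (@box_compact R d r) (max_affine_continuous (zetaM k)).
  have [Zk HZk] := choice (fun k => let: ex_intro2 a b c := cZ k in ex_intro _ a (conj b c)).
  exists (\sum_k Zk k) => [|k x bx].
    by rewrite (bigD1 i0)//= ltr_pwDl ?(HZk i0).1// sumr_ge0// => k _; exact: ltW (HZk k).1.
  apply: le_trans (le_trans (ler_norm _) ((HZk k).2 x bx)) _.
  by rewrite (bigD1 k)//= lerDl sumr_ge0// => j _; exact: ltW (HZk j).1.
pose L f : R := integral_rV (fun x => `|lap f x|).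
have L0 f : 0 <= L f by apply: integral_rV_ge0.
pose N : R := #|I|%:R.
(* Uniform error in units of [eps]: 1 for the tangent planes and at most [2 * Z] for the penalty. *)
pose P : R := 1 + 2 * Z.
have P0 : 0 <= P by rewrite /P; lra.
have SL0 : 0 <= \sum_k L (chi k) by apply: sumr_ge0 => k _.
have N0 : 0 <= N by rewrite ler0n.
have PN0 : 0 <= P * (1 + 2 * N) * L chi0.
  by rewrite mulr_ge0// mulr_ge0//; lra.
(* The terms dominate what [eps] is multiplied by in the three estimates: the uniform distance to
   [w], the pairings on the cores, and the pairing with [chi0], where all [N] functions [H k]
   contribute. *)
pose D := 1 + P + 2 * (\sum_k L (chi k)) + P * (1 + 2 * N) * L chi0.
have [D0 DP DS DQ] : [/\ 0 < D, P <= D, 2 * \sum_k L (chi k) <= D & P * (1 + 2 * N) * L chi0 <= D].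
  exact: aux SL0 PN0 P0.
have DL k : 2 * L (chi k) <= D.
  by apply: le_trans DS; rewrite ler_pM2l// (bigD1 k)//= lerDl sumr_ge0.
pose eps := e / D; have eps0 : 0 < eps by rewrite divr_gt0.
have epsK K : K <= D -> eps * K <= e.
  by move=> KD; rewrite /eps mulrAC ler_pdivrMr// ler_pM2l.
have epsL K X : K * X <= D -> K * eps * X <= e by move=> KX; rewrite mulrAC mulrC; exact: epsK.
have wB2 k : Ck 2 (fun y => w y + B k y) by exact: (CkD w2 (B2 k)).
have exA k : exists G, max_affine G /\ forall x, box r x -> w x + B k x - eps <= G x <= w x + B k x.
  by apply: (convex_max_affine_approx (wB2 k) r0 eps0) => x v bx; exact: (convB k v bx).2.
have exB k : exists G, max_affine G /\ forall x, box r x -> B k x - eps <= G x <= B k x.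
  by apply: (convex_max_affine_approx (B2 k) r0 eps0) => x v bx; exact: (convB k v bx).1.
have [Ah HA] := choice exA; have [Bh HB] := choice exB.
pose H k x := Bh k x + 2 * eps * zeta k x.
have HM k : max_affine (H k).
  apply: max_affineD; first exact: (HB k).1.
  by apply: max_affineZ => //; rewrite mulr_ge0// ltW.
pose H0 x := \sum_k H k x.
(* Adding the common function [H0] to all differences [Ah k - H k] makes each of them convex; their
   maximum is then [G0 - H0] with [G0] convex. *)
pose g k x := Ah k x + \sum_(j <- rem k (index_enum I)) H j x.
have gE k x : g k x = Ah k x - H k x + H0 x.
  by rewrite /g /H0 (big_rem k (mem_index_enum k))/=; ring.
have gM k : max_affine (g k).
  by apply: max_affineD; [exact: (HA k).1|exact: max_affine_sum].
pose G0 x := \big[Num.max/g i0 x]_k g k x.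
have G0M : max_affine G0 by apply: max_affine_bigmax.
have H0M : max_affine H0 by exact: max_affine_sum.
pose u0 x := G0 x - H0 x.
have u0_ge k x : Ah k x - H k x <= u0 x.
  by rewrite lerBrDr -gE; exact: (le_bigmax _ (fun k => g k x) k).
have u0_le x b : (forall k, Ah k x - H k x <= b) -> u0 x <= b.
  move=> h; rewrite lerBlDr; apply: bigmax_le => [|k _]; by rewrite gE lerD2r.
have epsZ k x : box r x -> 0 <= 2 * eps * zeta k x <= 2 * eps * Z.
  move=> bx; have e2 : 0 <= 2 * eps by rewrite mulr_ge0// ltW.
  by apply/andP; split; [exact: mulr_ge0|apply: ler_wpM2l => //; exact: HZ].
have diff_bounds k x : box r x ->
    w x - P * eps <= Ah k x - H k x <= w x + eps - 2 * eps * zeta k x.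
  move=> bx; have /andP[a1 a2] := (HA k).2 x bx; have /andP[b1 b2] := (HB k).2 x bx.
  have /andP[z1 z2] := epsZ k x bx; rewrite /H /P.
  move: (2 * eps * zeta k x) z1 z2 => z z1 z2.
  by apply/andP; split; lra.
have H_close k x : box r x -> `|H k x - B k x| <= P * eps.
  move=> bx; have /andP[b1 b2] := (HB k).2 x bx.
  have /andP[z1 z2] := epsZ k x bx; rewrite /H /P.
  move: (2 * eps * zeta k x) z1 z2 => z z1 z2.
  by rewrite ler_norml; apply/andP; split; lra.
have u0w x : box r x -> `|u0 x - w x| <= P * eps.
  move=> bx; rewrite ler_distl; apply/andP; split.
    by have /andP[h _] := diff_bounds i0 x bx; exact: le_trans h (u0_ge i0 x).
  apply: u0_le => k; have /andP[_ h] := diff_bounds k x bx.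
  apply: le_trans h _; have /andP[z1 _] := epsZ k x bx.
  move: (2 * eps * zeta k x) z1 => z z1.
  have : 0 <= Z * eps by rewrite mulr_ge0// ltW.
  rewrite /P; lra.
have u0_core k x : core k x -> u0 x = Ah k x - Bh k x.
  move=> kx; have bx := core_box kx.
  have -> : Bh k x = H k x by rewrite /H zeta_core// mulr0 addr0.
  apply/eqP; rewrite eq_le u0_ge andbT; apply: u0_le => j.
  have [->//|jk] := eqVneq j k.
  have /andP[_ h1] := diff_bounds j x bx; have /andP[a1 a2] := (HA k).2 x bx.
  have /andP[b1 b2] := (HB k).2 x bx.
  have hH : H k x = Bh k x by rewrite /H zeta_core// mulr0 addr0.
  have z1 : 2 * eps <= 2 * eps * zeta j x.
    have e2 : 0 <= 2 * eps by rewrite mulr_ge0// ltW.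
    by rewrite ler_peMr// (@zeta_off k)// eq_sym.
  rewrite hH; move: (2 * eps * zeta j x) z1 h1 => z z1 h1; lra.
have u0P : piecewise_affine u0 by apply: piecewise_affineB; exact: max_affine_piecewise.
(* Clipping provides compact support; the cut-offs live in the box, so the pairings do not see
   it. *)
have [u uP [uE u_out]] := piecewise_affine_clip r u0P.
exists u; split => //.
  move=> x bx; rewrite uE//; apply: le_trans (u0w x bx) _.
  by rewrite mulrC epsK.
move=> F F2 F1; have cu : continuous u by case: uP.
split=> [k|].
  have [MA hA] := HA k; have [MB hB] := HB k.
  have uAB x : core k x -> u x = Ah k x - Bh k x.
    by move=> kx; rewrite uE; [exact: u0_core|exact: core_box kx].
  have h1 := pairing_difference_le cu MA MB (chiC k) (chi_ge0 k) F2 F1 (@core_closed k)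
    (@chi_core k) uAB.
  apply: le_trans h1 _.
  have w2B : Ck 2 (fun y => w y + 2 * B k y) by exact: (CkD w2 (CkZ 2 (B2 k))).
  have cAB : continuous (fun x => Ah k x + Bh k x).
    by apply: continuous_add; exact: max_affine_continuous.
  have e2 : 0 <= 2 * eps by rewrite mulr_ge0// ltW.
  apply: le_trans (integral_lap_close cAB w2B (chiC k) (@core_closed k) (@chi_core k) e2 _) _.
    move=> x kx; have bx := core_box kx.
    have /andP[a1 a2] := hA x bx; have /andP[b1 b2] := hB x bx.
    by rewrite ler_norml; apply/andP; split; lra.
  exact: lerD (lexx _) (epsL _ _ (DL k)).
have cbox : closed (@box R d r) by apply: compact_closed; [exact: norm_hausdorff|exact: box_compact].
apply: le_trans (pairing_difference_le cu G0M H0M chi0C chi0_ge0 F2 F1 cbox chi0_box uE) _.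
have Q2 : Ck 2 Q by exact: (CkD w2 (CkZ 2 (Ck_sum (index_enum I) B2))).
have cGH : continuous (fun x => G0 x + H0 x).
  by apply: continuous_add; exact: max_affine_continuous.
have e2 : 0 <= P * (1 + 2 * N) * eps.
  by apply: mulr_ge0; [apply: mulr_ge0 => //; lra|exact: ltW].
apply: le_trans (integral_lap_close cGH Q2 chi0C cbox chi0_box e2 _) _.
  move=> x bx; have -> : G0 x + H0 x - Q x = (u0 x - w x) + 2 * \sum_k (H k x - B k x).
    by rewrite /u0 /Q sumrB -/(H0 x); ring.
  apply: le_trans (ler_normD _ _) _.
  have -> : P * (1 + 2 * N) * eps = P * eps + 2 * \sum_(k : I) P * eps.
    by rewrite sumr_const -mulr_natl -/N; ring.
  apply: lerD; first exact: u0w.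
  rewrite normrM ger0_norm// ler_wpM2l//; apply: le_trans (ler_norm_sum _ _ _) _.
  by apply: ler_sum => k _; exact: H_close.
exact: lerD (lexx _) (epsL _ _ DQ).
Qed.

End patching.

(** * Partition of unity of a grid of cubes *)

Section integral_measure.
Context {R : realType} {d : nat}.
Implicit Types (f : 'rV[R]_d -> R) (A : set 'rV[R]_d).

Lemma measurable_compactly_supported A f : compactly_supported f ->
  measurable_fun A (EFin \o f).
Proof.
move=> [cf _]; apply/measurable_EFinP; apply: measurable_funTS.
exact: continuous_measurable_rV.
Qed.

Lemma measure_le_integral A f : measurable A -> compactly_supported f ->
  (forall x, 0 <= f x) -> (forall x, A x -> 1 <= f x) ->
  (lebesgue_rV d A <= (integral_rV f)%:E)%E.
Proof.
move=> mA sf f0 fA; have mf := @measurable_compactly_supported setT f sf.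
have fT x : ~ setT x -> f x = 0 by move=> /(_ I).
rewrite -(integral_rVE sf fT) -[leLHS]mul1e -integral_cst//.
apply: (@le_trans _ _ (\int[lebesgue_rV d]_(x in A) (EFin \o f) x)%E).
  by apply: ge0_le_integral => //; exact: measurable_compactly_supported.
apply: ge0_subset_integral => //.
by move=> x _; rewrite /= lee_fin.
Qed.

Lemma integral_le_measure A f : measurable A -> compactly_supported f ->
  (forall x, 0 <= f x <= 1) -> (forall x, ~ A x -> f x = 0) ->
  ((integral_rV f)%:E <= lebesgue_rV d A)%E.
Proof.
move=> mA sf f01 fA.
rewrite -(integral_rVE sf fA) -[leRHS]mul1e -integral_cst//.
apply: ge0_le_integral => //.
- by move=> x Ax; rewrite lee_fin; have /andP[] := f01 x.
- exact: measurable_compactly_supported.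
- by move=> x Ax; rewrite lee_fin; have /andP[] := f01 x.
Qed.

Lemma measurable_cube c r : measurable (@cube R d c r).
Proof.
apply: (@measurable_forall_coor _ _ (fun l => [set t | `|t - c 0 l| <= r])) => l.
rewrite (_ : [set _ | _] = `[c 0 l - r, c 0 l + r]%classic)//.
by apply/seteqP; split => t; rewrite /= in_itv/= ler_distl.
Qed.

Lemma lebesgue_cube c (r : R) : 0 <= r -> lebesgue_rV d (cube c r) = ((2 * r) ^+ d)%:E.
Proof.
move=> r0; rewrite (_ : cube c r =
    [set x : 'rV[R]_d | forall l, [set` `[c 0 l - r, c 0 l + r]] (x 0 l)]).
  rewrite (@lebesgue_rV_box R d (fun l => `[c 0 l - r, c 0 l + r]%classic))//.
  rewrite (eq_bigr (fun=> (2 * r)%:E)) => [|i _].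
    by rewrite prodEFin prodr_const card_ord.
  rewrite lebesgue_measure_itv/= lte_fin; case: ltP => h.
    by rewrite -EFinD; congr EFin; ring.
  by congr EFin; lra.
by apply/seteqP; split => x h l; have := h l; rewrite /= in_itv/= ler_distl.
Qed.

End integral_measure.

Section grid.
Context {R : realType} {d : nat}.
Variables (m : R) (n : nat).
Hypotheses (m0 : 0 < m) (n0 : (0 < n)%N).

(** Half the side of the cubes: [n] sides of length [2 * rho] fill [[- m, m]]. *)
Let rho : R := m / n%:R.

Let rho0 : 0 < rho. Proof. by rewrite divr_gt0// ltr0n. Qed.

Let rhon : n%:R * rho = m. Proof. by rewrite mulrC divfK// gt_eqF// ltr0n. Qed.

Definition grid_center (k : {ffun 'I_d -> 'I_n}) : 'rV[R]_d :=
  \row_l ((2 * (k l)%:R + 1) * rho - m).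

Lemma grid_cube_subset k : cube (grid_center k) rho `<=` box m.
Proof.
move=> x xk l; have := xk l; rewrite mxE ler_distl ler_norml.
have h : (k l)%:R + 1 <= n%:R :> R by rewrite natr1 ler_nat ltn_ord.
have h0 : 0 <= (k l)%:R :> R by rewrite ler0n.
have := ler_wpM2r (ltW rho0) h; rewrite rhon.
have : 0 <= (k l)%:R * rho by rewrite mulr_ge0// ltW.
move: (k l)%:R (x 0 l) => a t; move: rho rho0 => r r0 h1 h2 /andP[h3 h4].
apply/andP; split; lra.
Qed.

(** Two different cells differ in some coordinate, in which their centers are at least [2 * rho]
    apart. *)
Lemma grid_core_separated (e : R) k k' x : k != k' -> cube (grid_center k') (rho - e) x ->
  exists l, rho + e <= `|x 0 l - grid_center k 0 l|.
Proof.
move=> kk' xk'; have [l kl] : exists l, k l != k' l.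
  apply/existsP; apply: contraNT kk'; rewrite negb_exists => /forallP h.
  by apply/eqP/ffunP => l; apply/eqP/negPn; exact: h.
exists l; have := xk' l; rewrite !mxE ler_distl => /andP[h1 h2].
have : (k l < k' l)%N || (k' l < k l)%N by rewrite -neq_ltn.
rewrite lter_normr; case/orP => h.
  have hR : (k l)%:R + 1 <= (k' l)%:R :> R by rewrite natr1 ler_nat.
  have h3 := ler_wpM2r (ltW rho0) hR; apply/orP; left.
  move: h1 h2 h3; clear hR; move: (k l)%:R (k' l)%:R (x 0 l) rho => a b t r. lra.
have hR : (k' l)%:R + 1 <= (k l)%:R :> R by rewrite natr1 ler_nat.
have h3 := ler_wpM2r (ltW rho0) hR; apply/orP; right.
move: h1 h2 h3; clear hR; move: (k l)%:R (k' l)%:R (x 0 l) rho => a b t r; lra.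
Qed.

Lemma grid_cores_disjoint (e : R) k k' x : 0 < e -> cube (grid_center k) (rho - e) x ->
  cube (grid_center k') (rho - e) x -> k = k'.
Proof.
move=> e0 xk xk'; apply/eqP/negPn/negP => kk'.
have [l] := grid_core_separated kk' xk'; rewrite leNgt => /negP; apply.
by apply: le_lt_trans (xk l) _; rewrite ltrD2l gtrN.
Qed.

(** Compares the volume of the enlarged box, which carries the outer cut-off, with that of the cubes
    on which the inner cut-offs equal 1; their half-side is [rho - 2 * del], one [del] for the gap
    and one for the transition. The difference is continuous in [del] and vanishes at 0. *)
Lemma grid_small_gap (e : R) : 0 < e -> exists2 del : R, 0 < del <= 1 &
  2 * del <= rho /\ (2 * (m + del)) ^+ d - (n%:R * (2 * (rho - 2 * del))) ^+ d <= e.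
Proof.
move=> e0; pose g (t : R) := (2 * (m + t)) ^+ d - (n%:R * (2 * (rho - 2 * t))) ^+ d.
have cX (f : R -> R) : continuous f -> continuous (fun t => f t ^+ d).
  by move=> cf t; apply: (@continuous_comp _ _ _ f (fun x : R => x ^+ d)); [exact: cf|exact: exprn_continuous].
have cst (a : R) : continuous (fun _ : R => a) by exact: cst_continuous.
have cid : continuous (fun t : R => t) by move=> t; exact: cvg_id.
have cg : continuous g.
  apply: continuous_sub; apply: cX; first by apply: continuous_mul => //; exact: continuous_add.
  apply: continuous_mul => //; apply: continuous_mul => //.
  by apply: continuous_sub => //; exact: continuous_mul.
have g0 : g 0 = 0.
  by rewrite /g mulr0 subr0 addr0 mulrCA rhon subrr.
have /cvgrPdist_lt/(_ _ e0)/nbhs_ballP[eta /= eta0 H] := cg 0.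
have [del [d0 d1 d2 d3]] : exists del : R, [/\ 0 < del, del <= 1, 2 * del <= rho & del < eta].
  exists (Num.min (eta / 2) (Num.min 1 (rho / 2))).
  have h1 : 0 < eta / 2 by rewrite divr_gt0.
  have h2 : 0 < rho / 2 by rewrite divr_gt0.
  have [ha hb] : Num.min (eta / 2) (Num.min 1 (rho / 2)) <= eta / 2 /\
      Num.min (eta / 2) (Num.min 1 (rho / 2)) <= Num.min 1 (rho / 2).
    by split; rewrite ge_min lexx ?orbT.
  split.
  - by rewrite !lt_min h1 h2 ltr01.
  - by apply: le_trans hb _; rewrite ge_min lexx.
  - have : Num.min 1 (rho / 2) <= rho / 2 by rewrite ge_min lexx orbT.
    by move: hb; lra.
  - by move: ha; lra.
exists del; first by rewrite d0.
split=> //; have := H del; rewrite /ball /= sub0r normrN gtr0_norm// => /(_ d3).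
rewrite g0 sub0r normrN => /ltW; apply: le_trans; exact: ler_norm.
Qed.

(** [chi0] is the outer cut-off minus the inner ones. It is nonnegative because the inner ones live
    on disjoint cores, all contained in [box m], where the outer one equals 1. *)
Lemma grid_partition (e : R) : 0 < e ->
  exists (del : R) (chi : {ffun 'I_d -> 'I_n} -> 'rV[R]_d -> R) (chi0 : 'rV[R]_d -> R),
  [/\ 0 < del,
      forall k, [/\ smooth (chi k), forall x, 0 <= chi k x &
        forall x, ~ cube (grid_center k) (rho - del) x -> chi k x = 0],
      [/\ smooth chi0, forall x, 0 <= chi0 x & forall x, ~ box (m + 1) x -> chi0 x = 0],
      forall x, \sum_k chi k x <= 1 /\ (box m x -> \sum_k chi k x + chi0 x = 1) &
      integral_rV chi0 <= e].
Proof.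
move=> e0; have [del /andP[del0 del1] [drho gap]] := grid_small_gap e0.
pose chi k : 'rV[R]_d -> R := cube_bump (grid_center k) (rho - del) del.
pose theta : 'rV[R]_d -> R := cube_bump 0 (m + del) del.
pose chi0 x := theta x - \sum_k chi k x.
have chi_out k x : ~ cube (grid_center k) (rho - del) x -> chi k x = 0.
  exact: cube_bump_eq0.
have cube0 (r : R) (x : 'rV[R]_d) : cube 0 r x <-> box r x.
  by split=> h l; have := h l; rewrite mxE subr0.
have theta1 x : box m x -> theta x = 1.
  by move=> bx; apply: cube_bump_eq1 => //; rewrite addrK; apply/cube0.
have sum1 x k : cube (grid_center k) (rho - del) x -> \sum_j chi j x = chi k x.
  move=> xk; rewrite (bigD1 k)//= big1 ?addr0// => j jk; apply: chi_out => xj.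
  by move/negP: jk; apply; apply/eqP; exact: grid_cores_disjoint xj xk.
have box_core k x : cube (grid_center k) (rho - del) x -> box m x.
  move=> xk; apply: (@grid_cube_subset k) => l; apply: le_trans (xk l) _.
  by rewrite gerBl ltW.
have sum_le x : \sum_k chi k x <= 1 /\ \sum_k chi k x <= theta x.
  have [[k xk]|h] := pselect (exists k, cube (grid_center k) (rho - del) x).
    rewrite (sum1 x k xk) theta1; last exact: box_core xk.
    by split; exact: cube_bump_le1.
  rewrite big1 => [|k _]; first by rewrite ler01 cube_bump_ge0.
  by apply: chi_out => xk; apply: h; exists k.
have chi0_out x : ~ box (m + 1) x -> chi0 x = 0.
  move=> bx; rewrite /chi0 [theta x]cube_bump_eq0// ?sub0r.
    rewrite big1 ?oppr0// => k _; apply: chi_out => /box_core b; apply: bx => l.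
    by apply: le_trans (b l) _; rewrite lerDl.
  move=> /cube0 b; by apply: bx => l; apply: le_trans (b l) _; rewrite lerD2l.
have chis k : smooth (chi k) by exact: cube_bump_smooth.
have chi0s : smooth chi0 by move=> i; apply: CkB; [exact: cube_bump_smooth|apply: Ck_sum => k; exact: chis].
exists del, chi, chi0; split => //.
- move=> k; split; [exact: chis|by move=> x; exact: cube_bump_ge0|exact: chi_out].
- split; [exact: chi0s|by move=> x; rewrite subr_ge0; case: (sum_le x)|exact: chi0_out].
- move=> x; split; first by case: (sum_le x).
  by move=> bx; rewrite /chi0 theta1// addrC subrK.
have supp c r (r0 : 0 < del) : compactly_supported (cube_bump c r del : 'rV[R]_d -> R).
  apply: (@test_function_compactly_supported _ _ setT).
  by apply: (cube_test_function (c := c) (r := r)) => //; [exact: cube_bump_smooth|move=> x; exact: cube_bump_eq0].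
have schi k : compactly_supported (chi k) by exact: supp.
have stheta : compactly_supported theta by exact: supp.
have -> : integral_rV chi0 = integral_rV theta - \sum_k integral_rV (chi k).
  apply: etrans (integral_rVB stheta (compactly_supported_sum _ schi)) _.
  by congr (_ - _); exact: integral_rV_sum.
apply: le_trans gap; apply: lerB.
  rewrite -lee_fin -(@lebesgue_cube _ _ 0); last by rewrite addr_ge0// ltW.
  apply: integral_le_measure => //; first exact: measurable_cube.
  - by move=> x; rewrite cube_bump_ge0 cube_bump_le1.
  - by move=> x; exact: cube_bump_eq0.
have -> : (n%:R * (2 * (rho - 2 * del))) ^+ d =
    \sum_(k : {ffun 'I_d -> 'I_n}) (2 * (rho - 2 * del)) ^+ d.
  by rewrite sumr_const card_ffun !card_ord exprMn -[RHS]mulr_natl natrX.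
apply: ler_sum => k _; rewrite -lee_fin -(@lebesgue_cube _ _ (grid_center k)); last first.
  by rewrite subr_ge0.
apply: measure_le_integral => //; first exact: measurable_cube.
- by move=> x; exact: cube_bump_ge0.
- move=> x xk; rewrite [chi k x]cube_bump_eq1// => l; apply: le_trans (xk l) _.
  by lra.
Qed.

End grid.

Section uniform_families.
Context {R : realType} {d : nat}.

Lemma box_bound_family (I : finType) (f : I -> 'rV[R]_d -> R) (r : R) :
  (forall i, continuous (f i)) ->
  exists2 M : R, 0 <= M & forall i x, box r x -> `|f i x| <= M.
Proof.
move=> cf; have c i := compact_bound (@box_compact R d r) (cf i).
have [M HM] := choice (fun i => let: ex_intro2 a b c := c i in ex_intro _ a (conj b c)).
have M0 i : 0 <= M i by exact: ltW (HM i).1.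
exists (\sum_i M i) => [|i x bx]; first exact: sumr_ge0.
by apply: le_trans ((HM i).2 x bx) _; rewrite (bigD1 i)//= lerDl sumr_ge0.
Qed.

Lemma box_uniform_continuity_family (I : finType) (f : I -> 'rV[R]_d -> R) (r e : R) :
  (forall i, continuous (f i)) -> 0 < e ->
  exists2 eta : R, 0 < eta & forall x y, box r x -> box r y ->
    (forall k, `|x 0 k - y 0 k| < eta) -> forall i, `|f i x - f i y| <= e.
Proof.
move=> cf e0; have c i := box_uniform_continuity r (cf i) e0.
have [eta H] := choice (fun i => let: ex_intro2 a b c := c i in ex_intro _ a (conj b c)).
exists (\big[Num.min/1]_i eta i).
  by elim/big_ind: _ => // [a b a0 b0|i _]; [rewrite lt_min a0 b0|exact: (H i).1].
move=> x y bx by_ xy i; apply: (H i).2 => // k; apply: lt_le_trans (xy k) _.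
exact: bigmin_le_mem (mem_index_enum i).
Qed.

End uniform_families.

(** * Lower bound for the variation of w *)

Section variation_lower_bound.
Context {R : realType} {d : nat}.
Implicit Types (f g w : 'rV[R]_d -> R) (A : set 'rV[R]_d).

Lemma test_function0 A : test_function A (fun=> 0 : R).
Proof.
have h : closure [set x : 'rV[R]_d | (0 : R) != 0] = set0.
  rewrite (_ : [set x | _] = set0) ?closure0//.
  by apply/seteqP; split => x //=; rewrite eqxx.
by split; [move=> k; exact: Ck_cst|rewrite h; exact: compact0|rewrite h].
Qed.

Lemma test_functionD A f g : test_function A f -> test_function A g ->
  test_function A (fun x => f x + g x).
Proof.
move=> [sf cf fA] [sg cg gA].
have sub : closure [set x | f x + g x != 0] `<=`
    closure [set x | f x != 0] `|` closure [set x | g x != 0].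
  rewrite -closureU; apply: closureS => x /= h.
  have [fx|fx] := eqVneq (f x) 0; last by left.
  by right; move: h; rewrite fx add0r.
split; first by move=> k; exact: CkD.
- by apply: subclosed_compact sub; [exact: closed_closure|exact: compactU].
- by apply: subset_trans sub _; rewrite subUset.
Qed.

Lemma test_function_sum A (I : Type) (s : seq I) (F : I -> 'rV[R]_d -> R) :
  (forall i, test_function A (F i)) -> test_function A (fun x => \sum_(i <- s) F i x).
Proof.
move=> H; elim: s => [|i s IH].
  by under eq_fun do rewrite big_nil; exact: test_function0.
by under eq_fun do rewrite big_cons; exact: test_functionD.
Qed.

Variables (I : eqType) (i0 : I) (s : seq I) (c : I -> 'rV[R]_d) (r kappa : R).
Variables (chi : I -> 'rV[R]_d -> R) (T : I -> 'M[R]_d) (w : 'rV[R]_d -> R).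
Variable Omega : set 'rV[R]_d.
Hypotheses (us : uniq s) (w2 : Ck 2 w).
Hypotheses (chis : forall i, smooth (chi i)) (chi01 : forall i x, 0 <= chi i x <= 1)
  (chi_out : forall i x, ~ cube (c i) r x -> chi i x = 0)
  (disj : forall i j x, cube (c i) r x -> cube (c j) r x -> i = j)
  (sub : forall i, i \in s -> cube (c i) r `<=` Omega).
Hypotheses (T1 : forall i k l, `|T i k l| <= 1)
  (T2 : forall i (a : R), 0 <= a <= 1 -> schatten_norm +oo%E (a *: T i) <= 1).
Hypothesis close : forall i x k l, i \in s -> cube (c i) r x ->
  `|partial l (partial k w) x - partial l (partial k w) (c i)| <= kappa.

Let t i := \sum_k \sum_l T i k l * partial l (partial k w) (c i).

(** Tests [w] against [chi i] times the sign matrix [T i] on the i-th cube. As the cubes are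
    disjoint, each value of the field is some [T i] times a factor in [0, 1], hence has norm at most
    1; each of the [d ^ 2] entries of the Hessian costs at most [kappa]. This converts the trace
    norms [t i], which will bound the variation of the approximation from above, into the variation
    of [w]. *)
Lemma variation_lower_bound :
  ((\sum_(i <- s) (t i - d%:R ^+ 2 * kappa) * integral_rV (chi i))%:E <=
   hessian_schatten_variation 1%E w Omega)%E.
Proof.
have cw := Ck_continuous w2.
pose chi' i x := (i \in s)%:R * chi i x.
have chi'T i k l : test_function Omega (fun x => chi' i x * T i k l).
  have [is_|is_] := boolP (i \in s); last first.
    by rewrite /chi' (negbTE is_); under eq_fun do rewrite !mul0r; exact: test_function0.
  rewrite /chi' is_; apply: (cube_test_function (c := c i) (r := r)) (sub is_).
    by move=> n; apply: CkM; [apply: CkM; [exact: Ck_cst|exact: chis]|exact: Ck_cst].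
  by move=> x xi; rewrite chi_out// mulr0 mul0r.
have chiC i k l : C2c (fun x => chi' i x * T i k l) by exact: test_function_C2c (chi'T i k l).
pose F x : 'M[R]_d := \matrix_(k, l) \sum_(i <- s) chi' i x * T i k l.
have FE x k l : F x k l = \sum_(i <- s) chi' i x * T i k l by rewrite mxE.
have aF : admissible Omega F.
  split=> [k l|x].
    by under eq_fun do rewrite FE; exact: test_function_sum.
  have [[i [is_ xi]]|h] := pselect (exists i, i \in s /\ cube (c i) r x).
    have -> : F x = chi i x *: T i; last exact: T2.
    apply/matrixP => k l; rewrite FE mxE (big_rem i is_)/= big1_seq => [|j /andP[_ jr]].
      by rewrite addr0 /chi' is_ mul1r.
    have ji : j != i by move: jr; rewrite mem_rem_uniq// inE => /andP[].
    rewrite /chi' chi_out ?mulr0 ?mul0r// => xj.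
    by move: ji; rewrite (disj xj xi) eqxx.
  (* Outside the cubes the field is zero, written as a multiple of [T i0] so that [T2] applies. *)
  have -> : F x = 0 *: T i0; last by apply: T2; rewrite lexx ler01.
  apply/matrixP => k l; rewrite FE mxE mul0r big1_seq// => j /andP[_ js].
  by rewrite /chi' chi_out ?mulr0 ?mul0r// => xj; apply: h; exists j.
apply: le_trans (hs_variation_ge cw aF); rewrite lee_fin.
have -> : (fun i j y => F y i j) = fun k l x => \sum_(i <- s) chi' i x * T i k l.
  by apply/funext => k; apply/funext => l; apply/funext => x; rewrite FE.
rewrite (hess_pairing_sumr s cw chiC) big_seq [leRHS]big_seq; apply: ler_sum => i is_.
have cchi : compactly_supported (chi i).
  apply: (@test_function_compactly_supported _ _ Omega).
  by apply: (cube_test_function (chis i) (@chi_out i)); exact: sub.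
have -> : hess_pairing w (fun k l x => chi' i x * T i k l) =
    integral_rV (fun x => (\sum_k \sum_l T i k l * partial l (partial k w) x) * chi i x).
  apply: etrans (hess_pairing_smooth w2 (chiC i)) _; congr integral_rV; apply/funext => x.
  rewrite mulr_suml; apply: eq_bigr => k _; rewrite mulr_suml; apply: eq_bigr => l _.
  by rewrite /chi' is_ mul1r -mulrA mulrC.
apply: le_trans (_ : integral_rV (fun x => (t i - d%:R ^+ 2 * kappa) * chi i x) <= _).
  by rewrite (integral_rVZ _ cchi).
apply: integral_rV_le => [||x].
- exact: compactly_supportedZ.
- apply: compactly_supportedMl cchi; apply: continuous_sum => k; apply: continuous_sum => l.
  apply: continuous_mul; first exact: cst_continuous.
  exact: Ck_continuous (Ck_partial l (Ck_partial k w2)).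
have [xi|xi] := pselect (cube (c i) r x); last by rewrite chi_out// !mulr0.
apply: ler_wpM2r; first by case/andP: (chi01 i x).
rewrite lerBlDr -lerBlDl /t -sumrB.
have -> : d%:R ^+ 2 * kappa = \sum_(k < d) \sum_(l < d) kappa.
  by rewrite sumr_const card_ord sumr_const card_ord -mulrnA -[RHS]mulr_natl natrM expr2.
apply: ler_sum => k _; rewrite -sumrB; apply: ler_sum => l _.
rewrite -mulrBr; apply: le_trans (ler_norm _) _; rewrite normrM distrC.
by rewrite -[leRHS]mul1r ler_pM// close.
Qed.

End variation_lower_bound.

(** * Cubes that meet the boundary *)

Section touching_cubes.
Context {R : realType} {d : nat}.
Implicit Types (p q x : 'rV[R]_d) (A : set 'rV[R]_d).

Definition neighborhood (kappa : R) A := \bigcup_(a in A) ball a kappa.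

Lemma open_neighborhood kappa A : open (neighborhood kappa A).
Proof. by apply: bigcup_open => a _; exact: ball_open. Qed.

(** If the segment avoided the boundary, the parameters mapped into the interior of [A] would be
    those mapped into its closure: an open, closed and nonempty part of [0, 1], hence all of it. *)
Lemma segment_boundary A p q : A p -> ~ A q ->
  exists2 s : R, 0 <= s <= 1 & boundary A (s *: (q - p) + p).
Proof.
move=> Ap Aq; apply: contrapT => H.
pose g (s : R) := s *: (q - p) + p.
have cg : continuous g.
  apply: continuous_to_rV => l; rewrite (_ : (fun s => _) = fun s => s * (q 0 l - p 0 l) + p 0 l).
    apply: continuous_add; last exact: cst_continuous.
    by apply: continuous_mul; [move=> s; exact: cvg_id|exact: cst_continuous].
  by apply/funext => s; rewrite !mxE.
have H' s : 0 <= s <= 1 -> ~ boundary A (g s) by move=> s01 b; apply: H; exists s.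
have g0 : g 0 = p by rewrite /g scale0r add0r.
have g1 : g 1 = q by rewrite /g scale1r subrK.
have int0 : A° p.
  apply: contrapT => h; apply: (H' 0); first by rewrite lexx ler01.
  by rewrite g0; split => //; exact: subset_closure.
have E : `[0, 1]%classic `&` g @^-1` A° = `[0, 1]%classic.
  apply: (@segment_connected R 0 1).
  - by exists 0 => //; split; rewrite /= ?in_itv/= ?lexx ?ler01// g0.
  - exists (g @^-1` A°) => //; apply: open_comp; first by move=> s _; exact: (cg s).
    exact: open_interior.
  - exists (g @^-1` closure A).
      by apply: (preimage_closed _ (@closed_closure _ A)) => s _; exact: cg.
    apply/seteqP; split => s [s01 gs]; split => //.
      by apply: subset_closure; exact: interior_subset.
    apply: contrapT => h; apply: (H' s); last by split.
    by move: s01; rewrite /= in_itv.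
have : (`[0, 1]%classic : set R) 1 by rewrite /= in_itv/= lexx ler01.
rewrite -E => -[_]; rewrite /= g1 => h; apply: Aq; exact: interior_subset.
Qed.

Lemma cube_boundary c (r : R) A p q : cube c r p -> A p -> cube c r q -> ~ A q ->
  exists2 b, cube c r b & boundary A b.
Proof.
move=> cp Ap cq Aq; have [s /andP[s0 s1] b] := segment_boundary Ap Aq.
exists (s *: (q - p) + p) => // l; have := cp l; have := cq l; rewrite !mxE !ler_norml.
move: (p 0 l) (q 0 l) (c 0 l) => x y z /andP[y1 y2] /andP[x1 x2].
have -> : s * (y - x) + x - z = s * (y - z) + (1 - s) * (x - z) by ring.
have s1' : 0 <= 1 - s by rewrite subr_ge0.
have h1 := ler_wpM2l s0 y1; have h2 := ler_wpM2l s0 y2.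
have h3 := ler_wpM2l s1' x1; have h4 := ler_wpM2l s1' x2.
by apply/andP; split; lra.
Qed.

End touching_cubes.

Section cubes.
Context {R : realType} {d : nat}.
Implicit Types (f w : 'rV[R]_d -> R) (c x : 'rV[R]_d).

Lemma affine_form_scaled_coor l (a b : R) x :
  affine_form (a *: delta_mx 0 l, b) x = a * x 0 l + b.
Proof.
rewrite /affine_form /dotp /=; congr (_ + _).
rewrite (bigD1 l)//= big1 ?addr0 => [|i il]; rewrite !mxE eqxx ?eqxx/=; first by rewrite mulr1.
by rewrite (negbTE il) mulr0 mul0r.
Qed.

Lemma cube_penalty c (r e : R) : 0 < e -> exists zeta : 'rV[R]_d -> R,
  [/\ max_affine zeta, forall x, 0 <= zeta x, forall x, cube c r x -> zeta x = 0 &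
      forall x l, r + e <= `|x 0 l - c 0 l| -> 1 <= zeta x].
Proof.
move=> e0; pose g l (a : R) x := affine_form (a / e *: delta_mx 0 l : 'rV[R]_d, (- (a * c 0 l) - r) / e) x.
have gE l a x : g l a x = (a * (x 0 l - c 0 l) - r) / e.
  by rewrite /g affine_form_scaled_coor; field; rewrite gt_eqF.
exists (fun x => \big[Num.max/0]_l Num.max (g l 1 x) (g l (-1) x)); split.
- apply: (@max_affine_bigmax _ _ _ _ (fun=> 0)); first exact: max_affine_cst.
  by move=> l; apply: max_affine_max; exact: max_affine_form.
- by move=> x; exact: bigmax_ge_id.
- move=> x xc; apply/eqP; rewrite eq_le bigmax_ge_id andbT.
  apply: bigmax_le => // l _; have := xc l; rewrite ler_norml => /andP[h1 h2].
  by rewrite ge_max !gE !pmulr_lle0 ?invr_gt0//; apply/andP; split; lra.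
- move=> x l h.
  apply: le_trans (le_bigmax _ (fun l => Num.max (g l 1 x) (g l (-1) x)) l).
  rewrite le_max !gE !ler_pdivlMr// mul1r mul1r mulN1r.
  by move: h; rewrite lter_normr => /orP[h|h]; apply/orP; [left|right]; lra.
Qed.

Lemma sqdist_cube c (r : R) x : cube c r x -> sqdist c x <= d%:R * r ^+ 2.
Proof.
move=> xc; rewrite mulr_natl -[in leRHS](card_ord d) -sumr_const; apply: ler_sum => l _.
have r0 : 0 <= r := le_trans (normr_ge0 _) (xc l).
by rewrite -real_normK ?num_real// ler_pXn2r ?nnegrE//; exact: xc.
Qed.

Lemma sqdist_coor c (r : R) x l : 0 <= r -> (0 < d)%N -> sqdist c x <= 4 * (d%:R * r ^+ 2) ->
  `|x 0 l - c 0 l| <= 2 * d%:R * r.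
Proof.
move=> r0 d0 h; have d1 : 1 <= d%:R :> R by rewrite ler1n.
have h1 : `|x 0 l - c 0 l| ^+ 2 <= 4 * (d%:R * r ^+ 2).
  apply: le_trans h; rewrite real_normK ?num_real// /sqdist (bigD1 l)//= lerDl.
  by apply: sumr_ge0 => k _; exact: sqr_ge0.
rewrite -(@ler_pXn2r _ 2) ?nnegrE//; last by rewrite !mulr_ge0.
apply: le_trans h1 _; rewrite !exprMn -mulrA -natrX ler_pM2l//.
by rewrite ler_wpM2r ?sqr_ge0// -[leLHS]mulr1 expr2 ler_wpM2l.
Qed.

Lemma lapD2 f g x : Ck 2 f -> Ck 2 g ->
  lap (fun y => f y + 2 * g y) x = lap f x + 2 * lap g x.
Proof.
move=> f2 g2; rewrite /lap mulr_sumr -big_split/=; apply: eq_bigr => i _.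
by rewrite (partial2D i i x f2 (CkZ 2 g2)) (partial2Z i i 2 x g2).
Qed.

Lemma lap_continuous f : Ck 2 f -> continuous (lap f).
Proof.
move=> f2; apply: continuous_sum => i.
exact: Ck_continuous (Ck_partial i (Ck_partial i f2)).
Qed.

Lemma exists_mesh (m z : R) : 0 < z -> exists2 n : nat, (0 < n)%N & m / n%:R < z.
Proof.
move=> z0; exists (Num.bound (m / z)).+1 => //.
rewrite ltr_pdivrMr ?ltr0n// mulrC -ltr_pdivrMr//.
have [h|h] := leP 0 (m / z).
  by rewrite (lt_le_trans (archi_boundP h))// ler_nat.
by rewrite (lt_le_trans h)// ler0n.
Qed.

End cubes.

Lemma sum_filter_split {R : realType} (I : finType) (P Q : pred I) (a X : I -> R) (b c e : R) :
  \sum_(k <- [seq k <- index_enum I | P k]) a k +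
  b * (\sum_(k <- [seq k <- index_enum I | Q k]) X k) + c * (\sum_k X k) + #|I|%:R * e =
  \sum_k ((if P k then a k else 0) + b * (if Q k then X k else 0) + c * X k + e).
Proof.
by rewrite !big_split/= -!mulr_sumr -!big_mkcond !big_filter sumr_const mulr_natl.
Qed.

(** * Approximation at a fixed scale *)

Section approximation.
Context {R : realType} {d : nat}.
Variables (d0 : (0 < d)%N) (w : 'rV[R]_d -> R) (w2 : Ck 2 w).

Let D : R := d%:R + 2 * d%:R ^+ 2.

(* [p = (B, T, t)]: [B] and [w + B] are convex, [T] is the sign of the Hessian of
   [w] at [c] and [t] is its trace norm. *)
Let local_data (r rho kappa : R) (c : 'rV[R]_d) (p : ('rV[R]_d -> R) * 'M[R]_d * R) :=
  [/\ Ck 2 p.1.1,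
    forall x v, box r x -> 0 <= hess_form p.1.1 x v /\ 0 <= hess_form (fun y => w y + p.1.1 y) x v,
    forall x, box r x -> cube c rho x -> lap w x + 2 * lap p.1.1 x <= p.2 + kappa * D,
    p.2 = \sum_i \sum_j p.1.2 i j * partial j (partial i w) c /\ 0 <= p.2 &
    [/\ forall k l, `|p.1.2 k l| <= 1 &
        forall a : R, 0 <= a <= 1 -> schatten_norm +oo%E (a *: p.1.2) <= 1]].

Lemma local_data_exists (r kappa z : R) : 0 < kappa -> 0 < z -> exists2 eta : R, 0 < eta <= z &
  (forall (rho : R) c, 0 < rho < eta -> box r c -> exists p, local_data r rho kappa c p) /\
  (forall (rho : R) c x i j, 0 < rho < eta -> box r c -> box r x -> cube c rho x ->
     `|partial j (partial i w) x - partial j (partial i w) c| <= kappa).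
Proof.
move=> k0 z0; pose h (ij : 'I_d * 'I_d) := partial ij.2 (partial ij.1 w).
have ch ij : continuous (h ij) := Ck_continuous (Ck_partial ij.2 (Ck_partial ij.1 w2)).
have [M M0 HM] := box_bound_family r ch.
have [e e0 He] := box_uniform_continuity_family r ch k0.
have d1 : 1 <= d%:R :> R by rewrite ler1n.
have dd : 0 < 2 * d%:R :> R by rewrite mulr_gt0// ltr0n.
(* The points with [sqdist c x <= 4 * (d * rho ^ 2)] differ from [c] by at most [2 * d * rho] in
   each coordinate; this has to stay below the modulus of continuity [e]. *)
exists (Num.min z (e / (2 * d%:R))).
  by rewrite lt_min z0 divr_gt0//= ge_min lexx.
have small (rho : R) : 0 < rho < Num.min z (e / (2 * d%:R)) -> 0 < rho /\ 2 * d%:R * rho < e.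
  by move=> /andP[r0]; rewrite lt_min ltr_pdivlMr// [rho * _]mulrC => /andP[_ ->].
split=> [rho c /small[rho0 rhoe] bc|rho c x i j /small[rho0 rhoe] bc bx xc].
  (* With [s = d * rho ^ 2], the ball [sqdist c x <= s] contains the cube of half-side [rho]. *)
  have s0 : 0 < d%:R * rho ^+ 2 by rewrite mulr_gt0 ?ltr0n// exprn_gt0.
  have H1 x : box r x -> forall i j, `|partial j (partial i w) x| <= M.
    by move=> bx i j; exact: (HM (i, j) x bx).
  have H2 x : box r x -> sqdist c x <= 4 * (d%:R * rho ^+ 2) ->
      forall i j, `|partial j (partial i w) x - partial j (partial i w) c| <= kappa.
    move=> bx near i j; apply: (He x c bx bc _ (i, j)) => l.
    by apply: le_lt_trans rhoe; apply: sqdist_coor near => //; exact: ltW.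
  have [B [T [t [B2 B3 B4 B5 B6]]]] :=
    local_convex_splitting w2 s0 (ltW k0) M0 H1 H2.
  exists (B, T, t); split => // x bx xc; apply: B4 => //; exact: sqdist_cube.
apply: (He x c bx bc _ (i, j)) => l; apply: le_lt_trans (xc l) _; apply: le_lt_trans rhoe.
have d2 : 1 <= 2 * d%:R :> R by lra.
by apply: ler_peMl => //; exact: ltW.
Qed.

(** [u] precedes [Omega] and [C] in the quantifiers. The neighborhood of [Omega] enters because a
    cube that meets [Omega] may have its center outside, and the one of the boundary because cubes
    that meet both [Omega] and its complement are estimated by [C] alone. *)
Lemma CPWL_approximation (m kappa : R) : 0 < m -> 0 < kappa ->
  exists u : 'rV[R]_d -> R, [/\ CPWL setT u, continuous u,
    forall x, box m x -> `|u x - w x| <= kappa &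
    forall (Omega : set 'rV[R]_d) (C : R), open Omega -> Omega `<=` box m -> 0 <= C ->
      (forall x, neighborhood kappa Omega x ->
         \sum_i \sum_j `|partial j (partial i w) x| <= C) ->
      (hessian_schatten_variation 1%E u Omega <=
       hessian_schatten_variation 1%E w Omega + kappa%:E +
       C%:E * lebesgue_rV d (neighborhood kappa (boundary Omega)))%E].
Proof.
have aux (A Y a n e2 f k : R) : (n + 1) * e2 <= k / 3 -> a <= k / 3 -> f <= k / 3 ->
    (A + Y + a + n * e2) + (f + e2) <= A + k + Y.
  by rewrite mulrDl mul1r; move: (n * e2) => b; lra.
move=> m0 kappa0.
pose Vol : R := (2 * m) ^+ d.
(* On a cube inside [Omega] the upper bound is [t + kappa' * D] and the lower one
   [t - d ^ 2 * kappa']; [K * kappa'] is their distance. *)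
pose K : R := d%:R ^+ 2 + D.
have K0 : 0 <= K by rewrite /K /D !addr_ge0 ?mulr_ge0 ?exprn_ge0 ?ler0n.
have Vol0 : 0 <= Vol by rewrite exprn_ge0// mulr_ge0// ltW.
(* Three errors share the budget [kappa]: the oscillation of the Hessian over the volume [Vol], the
   gaps weighted by [C0], and [e2] for each of the [N] cubes and once for the gaps. *)
have frac (a : R) : 0 <= a -> 0 < kappa / (3 * (a + 1)) /\ a * (kappa / (3 * (a + 1))) <= kappa / 3.
  move=> a0; have a1 : 0 < a + 1 by lra.
  split; first by rewrite divr_gt0// mulr_gt0.
  have -> : a * (kappa / (3 * (a + 1))) = kappa / 3 * (a / (a + 1)) by field; rewrite gt_eqF.
  rewrite -[leRHS]mulr1 ler_wpM2l//; first by rewrite divr_ge0// ltW.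
  by rewrite ler_pdivrMr// mul1r lerDl.
have [k1_0 k1E] := frac (K * Vol) (mulr_ge0 K0 Vol0).
set kappa' := kappa / _ in k1_0 k1E.
(* A half-side below [kappa / 2] puts each cube that contains a boundary point into the neighborhood
   of radius [kappa] of that point. *)
have k2 : 0 < kappa / 2 by rewrite divr_gt0.
have [eta /andP[eta0 eta_k] [loc mod_w]] := local_data_exists (m + 1) k1_0 k2.
have [n n0 mesh] := exists_mesh m eta0.
set rho := m / n%:R in mesh.
have rho0 : 0 < rho by rewrite divr_gt0// ltr0n.
have rho_eta : 0 < rho < eta by rewrite rho0.
pose I := {ffun 'I_d -> 'I_n}; pose i0 : I := [ffun=> Ordinal n0].
pose c : I -> 'rV[R]_d := grid_center m (n := n).
have cubeS k : cube (c k) rho `<=` box m by exact: grid_cube_subset.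
have boxS : (box m : set 'rV[R]_d) `<=` box (m + 1).
  by move=> x bx l; apply: le_trans (bx l) _; rewrite lerDl.
have cc k : cube (c k) rho (c k) by move=> l; rewrite subrr normr0 ltW.
have bc k : box (m + 1) (c k) by exact/boxS/(cubeS k)/cc.
have exp k : exists p, local_data (m + 1) rho kappa' (c k) p := loc rho (c k) rho_eta (bc k).
have [p Hp] := choice exp.
pose B k := (p k).1.1; pose T k := (p k).1.2; pose t k := (p k).2.
have B2 k : Ck 2 (B k) by case: (Hp k).
have convB k x v : box (m + 1) x ->
    0 <= hess_form (B k) x v /\ 0 <= hess_form (fun y => w y + B k y) x v.
  by case: (Hp k) => _ h _ _ _; exact: h.
have lapB k x : cube (c k) rho x -> lap w x + 2 * lap (B k) x <= t k + kappa' * D.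
  by move=> xc; case: (Hp k) => _ _ h _ _; apply: h => //; exact/boxS/(cubeS k).
have tE k : t k = \sum_i \sum_j T k i j * partial j (partial i w) (c k).
  by case: (Hp k) => _ _ _ [h _] _.
have T1 k i j : `|T k i j| <= 1 by case: (Hp k) => _ _ _ _ [h _]; exact: h.
have T2 k (a : R) : 0 <= a <= 1 -> schatten_norm +oo%E (a *: T k) <= 1.
  by case: (Hp k) => _ _ _ _ [_ h]; exact: h.
pose SB x := \sum_k B k x.
have SB2 : Ck 2 SB := Ck_sum (index_enum I) B2.
have Q2 : Ck 2 (fun x => w x + 2 * SB x) := CkD w2 (CkZ 2 SB2).
(* [C0] depends on the grid and the [B k] but not on the gaps, so the measure of the gaps can now be
   made small against it. *)
have [C0 C0_0 HC0] := compact_bound (@box_compact R d (m + 1)) (lap_continuous Q2).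
have [e1_0 e1E] := frac C0 (ltW C0_0); set e1 := kappa / _ in e1_0 e1E.
have [del [chi [chi0 [del0 chiP [chi0s chi0_ge0 chi0_out] sum_chi chi0_int]]]] :=
  @grid_partition R d m n m0 n0 e1 e1_0.
rewrite -/rho -/c in chiP.
pose core k := cube (c k) (rho - del).
have core_cube k x : core k x -> cube (c k) rho x.
  by move=> xk l; apply: le_trans (xk l) _; rewrite gerBl ltW.
have core_box k : core k `<=` box (m + 1) by move=> x /core_cube/cubeS/boxS.
have chis k : smooth (chi k) by case: (chiP k).
have chi_ge0 k x : 0 <= chi k x by case: (chiP k).
have chi_out k x : ~ core k x -> chi k x = 0 by case: (chiP k) => _ _; exact.
have chiT k : test_function setT (chi k).
  exact: (cube_test_function (chis k) (@chi_out k) (@subsetT _ _)).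
have chi0T : test_function setT chi0.
  apply: (cube_test_function (c := 0) (r := m + 1) chi0s) => // x h; apply: chi0_out => b.
  by apply: h => l; rewrite mxE subr0.
have chiC k : C2c (chi k) := test_function_C2c (chiT k).
have chi0C : C2c chi0 := test_function_C2c chi0T.
have schi k : compactly_supported (chi k) by case: (chiC k).
have del2 : 0 < 2 * del by rewrite mulr_gt0.
(* The penalty vanishes up to distance [rho - del] from the center and reaches 1 at [rho + del],
   where the neighboring cores begin. *)
have [zeta Hzeta] := choice (fun k => cube_penalty (c k) (rho - del) del2).
have zM k : max_affine (zeta k) by case: (Hzeta k).
have z0 k x : 0 <= zeta k x by case: (Hzeta k).
have zcore k x : core k x -> zeta k x = 0 by case: (Hzeta k) => _ _ h _; exact: h.
have zoff j k x : j != k -> core j x -> 1 <= zeta k x.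
  move=> jk xj; have kj : k != j by rewrite eq_sym.
  have [l hl] := grid_core_separated m0 n0 kj xj; case: (Hzeta k) => _ _ _ h.
  apply: (h x l); apply: le_trans hl; rewrite -/rho; lra.
pose N : R := #|I|%:R.
have [e2_0 e2E] := frac (N + 1) (addr_ge0 (ler0n _ _) ler01).
set e2 := kappa / _ in e2_0 e2E.
have e2k : e2 <= kappa.
  apply: le_trans (_ : (N + 1) * e2 <= _).
    by apply: ler_peMl; [exact: ltW|rewrite lerDr ler0n].
  by apply: le_trans e2E _; rewrite ler_pdivrMr// ler_peMr ?(ltW kappa0)// ler1n.
have m1 : 0 <= m + 1 by rewrite addr_ge0// ltW.
have core_closed k : closed (core k) by exact: cube_closed.
have [u [uP uw u_out upper]] := convex_patching i0 w2 m1 B2 convB zM z0 zcore zoff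
  core_closed core_box chiC chi_ge0 chi_out chi0C chi0_ge0 chi0_out e2_0.
have cu : continuous u by case: uP.
exists u; split => //.
- exact: piecewise_affine_CPWL d0 uP u_out.
- by move=> x bx; exact: le_trans (uw x (boxS x bx)) e2k.
move=> Omega C oO Om C_ge0 HC.
(* Three kinds of cubes: those inside [Omega] are compared with [w], those that touch its complement
   are charged to the neighborhood of the boundary, and those that miss [Omega] contribute
   nothing. *)
pose hits k := `[< cube (c k) rho `&` Omega !=set0 >].
pose inside k := hits k && `[< cube (c k) rho `<=` Omega >].
pose touch k := hits k && ~~ inside k.
pose s1 := [seq k <- index_enum I | inside k].
pose s2 := [seq k <- index_enum I | touch k].
pose X k := integral_rV (chi k).
have X0 k : 0 <= X k by exact: integral_rV_ge0.
pose A := \sum_(k <- s1) (t k - d%:R ^+ 2 * kappa') * X k.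
pose Y := \sum_(k <- s2) X k.
have AV : (A%:E <= hessian_schatten_variation 1%E w Omega)%E.
  have us1 : uniq s1 by rewrite filter_uniq// index_enum_uniq.
  have sub1 k : k \in s1 -> core k `<=` Omega.
    rewrite mem_filter => /andP[/andP[_ /asboolP h] _] x /core_cube; exact: h.
  have chi01 k x : 0 <= chi k x <= 1.
    rewrite chi_ge0 (le_trans _ (sum_chi x).1)// (bigD1 k)//= lerDl.
    by apply: sumr_ge0 => j _; exact: chi_ge0.
  have disj i j x : core i x -> core j x -> i = j by exact: (grid_cores_disjoint m0 n0 del0).
  have close k x i j : k \in s1 -> core k x ->
      `|partial j (partial i w) x - partial j (partial i w) (c k)| <= kappa'.
    by move=> _ /core_cube xk; exact: (mod_w rho _ _ i j rho_eta (bc k) (boxS x (cubeS k x xk)) xk).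
  have := variation_lower_bound i0 us1 w2 chis chi01 chi_out disj sub1 T1 T2 close.
  by rewrite /A; under eq_bigr => k _ do rewrite -tE.
have suppS (s : seq I) : compactly_supported (fun x => \sum_(k <- s) chi k x).
  exact: compactly_supported_sum.
(* The cut-offs of the touching cubes add up to at most 1 and vanish outside the neighborhood, since
   each of these cubes contains a boundary point. *)
have YV : (Y%:E <= lebesgue_rV d (neighborhood kappa (boundary Omega)))%E.
  have -> : Y = integral_rV (fun x => \sum_(k <- s2) chi k x).
    exact: esym (integral_rV_sum s2 schi).
  apply: integral_le_measure => //.
  - by apply: open_measurable_rV; exact: open_neighborhood.
  - move=> x; apply/andP; split; first by apply: sumr_ge0 => k _; exact: chi_ge0.
    apply: le_trans (sum_chi x).1; rewrite /s2 big_filter [leRHS](bigID touch)/= lerDl.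
    by apply: sumr_ge0 => k _; exact: chi_ge0.
  - move=> x xN; rewrite big_seq big1// => k; rewrite mem_filter => /andP[/andP[/asboolP[q [qk qO]] ni] _].
    apply: chi_out => /core_cube xk; apply: xN.
    have [y [yk yO]] : exists y, cube (c k) rho y /\ ~ Omega y.
      apply: contrapT => h; move/negP: ni; apply; rewrite /inside; apply/andP; split.
        by apply/asboolP; exists q.
      by apply/asboolP => y yk; apply: contrapT => yO; apply: h; exists y.
    have [b bk bO] := cube_boundary qk qO yk yO.
    exists b => //; apply/rV_ballP; split => // l.
    have h1 := bk l; have h2 := xk l.
    apply: le_lt_trans (ler_distD (c k 0 l) _ _) _; rewrite [`|c k 0 l - _|]distrC.
    by apply: le_lt_trans (lerD h1 h2) _; move: mesh eta_k; lra.
have XVol : \sum_k X k <= Vol.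
  have -> : \sum_k X k = integral_rV (fun x => \sum_k chi k x).
    exact: esym (integral_rV_sum (index_enum I) schi).
  rewrite -lee_fin -(lebesgue_box (ltW m0)); apply: integral_le_measure => //.
  - exact: measurable_box.
  - move=> x; rewrite (sum_chi x).1 andbT.
    by apply: sumr_ge0 => k _; exact: chi_ge0.
  - move=> x bx; rewrite big1// => k _; apply: chi_out => /core_cube xk.
    by apply: bx; exact: cubeS xk.
have hits_le k : hits k -> t k <= C.
  move=> /asboolP[q [qk qO]]; apply: le_trans (HC (c k) _).
    rewrite tE; apply: ler_sum => i _; apply: ler_sum => j _.
    apply: le_trans (ler_norm _) _; rewrite normrM -[leRHS]mul1r.
    by apply: ler_wpM2r.
  exists q => //; apply/rV_ballP; split => // l; apply: le_lt_trans (qk l) _.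
  by move: mesh eta_k kappa0; lra.
apply: (hs_variation_le cu) => F aF.
pose F' i j y := F y i j.
have FT i j : test_function Omega (F' i j) by exact: aF.1.
have F2 i j : Ck 2 (F' i j) := (test_function_C2c (FT i j)).1.
have Fq x v : `|quad_form (\matrix_(i, j) F' i j x) v| <= dotp v v.
  rewrite (_ : \matrix_(i, j) _ = F x); first exact: schatten_inf_quad_form (aF.2 x).
  by apply/matrixP => i j; rewrite mxE.
have [up_k up_0] := upper F' F2 Fq.
have FC k i j : C2c (fun x => chi k x * F' i j x).
  apply: C2cMl; first exact: chis.
  exact: test_function_C2c (FT i j).
have F0C i j : C2c (fun x => chi0 x * F' i j x).
  apply: C2cMl; first exact: chi0s.
  exact: test_function_C2c (FT i j).
(* The cut-offs sum to 1 on [box m], which contains [Omega]; outside [Omega] the field vanishes. *)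
have split_F : hess_pairing u F' = \sum_k hess_pairing u (fun i j x => chi k x * F' i j x) +
    hess_pairing u (fun i j x => chi0 x * F' i j x).
  apply: etrans (_ : _ = hess_pairing u (fun i j x => \sum_k chi k x * F' i j x + chi0 x * F' i j x)) _.
    congr (hess_pairing u _); apply/funext => i; apply/funext => j; apply/funext => x.
    have [Ox|Ox] := pselect (Omega x); last by rewrite (test_function_out (FT i j) Ox) big1 ?mulr0 ?addr0// => k _; rewrite mulr0.
    by rewrite -mulr_suml -mulrDl (sum_chi x).2 ?mul1r//; exact: Om.
  apply: etrans (hess_pairingDr cu (fun i j => C2c_sum (index_enum I) (fun k => FC k i j)) F0C) _.
  by congr (_ + _); exact: hess_pairing_sumr.
apply: (@le_trans _ _ (A + kappa + C * Y)%:E); last first.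
  rewrite !EFinD EFinM; apply: leeD; first exact: leeD.
  by apply: lee_wpmul2l => //; rewrite lee_fin.
rewrite lee_fin; apply: le_trans (_ : (A + C * Y + K * kappa' * \sum_k X k + N * e2) + (C0 * e1 + e2) <= _).
  apply: etrans (congr1 (fun z => z <= _) split_F) _; apply: lerD.
    apply: le_trans (_ : \sum_k ((if inside k then (t k - d%:R ^+ 2 * kappa') * X k else 0) +
        C * (if touch k then X k else 0) + K * kappa' * X k + e2) <= _); last first.
      by rewrite -(sum_filter_split inside touch).
    apply: ler_sum => k _; have Xk := X0 k.
    have KX : 0 <= K * kappa' * X k by rewrite mulr_ge0// mulr_ge0// ltW.
    have [hk|hk] := boolP (hits k); last first.
      have -> : hess_pairing u (fun i j x => chi k x * F' i j x) = 0.
        rewrite -[RHS](mul0r (hess_pairing u (fun i j x => chi k x * F' i j x))).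
        rewrite -(hess_pairingZr 0 cu (FC k)); congr (hess_pairing u _).
        apply/funext => i; apply/funext => j; apply/funext => x; rewrite mul0r.
        have [Ox|Ox] := pselect (Omega x); last by rewrite (test_function_out (FT i j) Ox) mulr0.
        rewrite chi_out ?mul0r// => /core_cube xk; move/negP: hk; apply.
        by apply/asboolP; exists x.
      by rewrite /inside /touch (negbTE hk)/= mulr0 !add0r addr_ge0// ltW.
    apply: le_trans (up_k k) _; rewrite lerD2r.
    apply: le_trans (_ : (t k + kappa' * D) * X k <= _).
      apply: le_trans (_ : integral_rV (fun x => (t k + kappa' * D) * chi k x) <= _); last first.
        by rewrite (integral_rVZ _ (schi k)).
      apply: integral_rV_le => [||x].
      - under eq_fun do rewrite mulrC; apply: compactly_supportedMl => //.
        by apply: lap_continuous; exact: (CkD w2 (CkZ 2 (B2 k))).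
      - exact: compactly_supportedZ.
      have [xk|xk] := pselect (core k x); last by rewrite chi_out// !(mulr0, mul0r).
      rewrite mulrC; apply: ler_wpM2r => //; rewrite (lapD2 x w2 (B2 k)).
      by apply: lapB; exact: core_cube.
    (* Inside, [t + kappa' * D] equals [t - d ^ 2 * kappa' + K * kappa'], the term of [A] plus the
       allowed error; a touching cube only uses [t <= C]. *)
    rewrite /touch hk /=; case: (boolP (inside k)) => ik /=.
      rewrite mulr0 addr0 -mulrDl; apply: ler_wpM2r => //.
      by rewrite /K [(_ + D) * _]mulrDl addrA subrK lerD2l [D * _]mulrC.
    rewrite add0r -mulrDl; apply: ler_wpM2r => //; apply: lerD; first exact: hits_le.
    by rewrite mulrC; apply: ler_wpM2r; [exact: ltW|rewrite /K lerDr exprn_ge0].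
  apply: le_trans up_0 _; rewrite lerD2r.
  apply: le_trans (_ : C0 * integral_rV chi0 <= _); last by apply: ler_wpM2l => //; exact: ltW.
  have schi0 : compactly_supported chi0 by case: chi0C.
  apply: le_trans (_ : integral_rV (fun x => C0 * chi0 x) <= _); last by rewrite integral_rVZ.
  apply: integral_rV_le => [||x].
  - under eq_fun do rewrite mulrC; apply: compactly_supportedMl => //.
    exact: (lap_continuous Q2).
  - exact: compactly_supportedZ.
  have [bx|bx] := pselect (box (m + 1) x); last by rewrite chi0_out// !(mulr0, mul0r).
  rewrite mulrC; apply: ler_wpM2r => //; apply: le_trans (ler_norm _) _; exact: HC0.
have hV : K * kappa' * \sum_k X k <= kappa / 3.
  apply: le_trans k1E; rewrite mulrAC; apply: ler_wpM2r; first exact: ltW.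
  exact: ler_wpM2l.
exact: aux e2E hV e1E.
Qed.

End approximation.

(** * Convergence *)

(** The lower hypothesis is the form in which semicontinuity is obtained. Infinite limits are
    included, so that finiteness of the variation of [w] does not enter. *)
Lemma ereal_squeeze_cvg {R : realType} (a b : nat -> \bar R) (l : \bar R) :
  (forall x : R, (x%:E < l)%E -> \forall j \near \oo, (x%:E <= a j)%E) ->
  (\forall j \near \oo, (a j <= b j)%E) -> b @ \oo --> l -> a @ \oo --> l.
Proof.
case: l => [r| |] lower upper bl.
- have [bf br] := (fine_cvgP _ _).1 bl.
  have up e : 0 < e -> \forall j \near \oo, (a j <= (r + e)%:E)%E.
    move=> e0; move/cvgrPdist_le/(_ e e0): br; move: bf upper; apply: filterS3 => j bf ab.
    rewrite /= ler_distlC => /andP[_ h]; apply: le_trans ab _.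
    by rewrite -(fineK bf) lee_fin.
  have lo e : 0 < e -> \forall j \near \oo, ((r - e)%:E <= a j)%E.
    by move=> e0; apply: lower; rewrite lte_fin gtrBl.
  apply/fine_cvgP; split.
    move: (up 1 ltr01) (lo 1 ltr01); apply: filterS2 => j h1 h2.
    by rewrite fin_numElt (lt_le_trans _ h2) ?ltNyr// (le_lt_trans h1)// ltry.
  apply/cvgrPdist_le => e e0; move: (up e e0) (lo e e0); apply: filterS2 => j h1 h2.
  have af : a j \is a fin_num.
    by rewrite fin_numElt (lt_le_trans _ h2) ?ltNyr// (le_lt_trans h1)// ltry.
  by rewrite /= ler_distlC; move: h1 h2; rewrite -(fineK af) !lee_fin => -> ->.
- by apply/cvgeyPge => A; apply: lower; rewrite ltry.
- apply/cvgeNyPle => A; move/cvgeNyPle/(_ A): bl; move: upper; apply: filterS2 => j.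
  exact: le_trans.
Qed.

Section final_estimates.
Context {R : realType} {d : nat}.
Implicit Types (f w : 'rV[R]_d -> R) (Omega K : set 'rV[R]_d).

Lemma pairing_uniform_bound f F (A : set 'rV[R]_d) (e : R) : continuous f -> 0 <= e ->
  (forall i j, test_function A (F i j)) -> (forall x, A x -> `|f x| <= e) ->
  `|hess_pairing f F| <=
  e * \sum_i \sum_j integral_rV (fun x => `|partial i (partial j (F i j)) x|).
Proof.
move=> cf e0 FT fe.
have sp i j : compactly_supported (partial i (partial j (F i j))).
  exact: C2c_partial2 (test_function_C2c (FT i j)).
have sd i j : compactly_supported (fun x => f x * partial i (partial j (F i j)) x).
  exact: compactly_supportedMl.
rewrite /hess_pairing [integral_rV _](integral_rV_sum2 sd).
apply: le_trans (ler_norm_sum _ _ _) _; rewrite mulr_sumr; apply: ler_sum => i _.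
apply: le_trans (ler_norm_sum _ _ _) _; rewrite mulr_sumr; apply: ler_sum => j _.
apply: integral_norm_bound => // x px; apply: fe; apply: contrapT => Ax; move/eqP: px; apply.
exact: (test_function_out (test_function_partial i (test_function_partial j (FT i j))) Ax).
Qed.

Lemma Lnorm_infty_le (f : 'rV[R]_d -> R) (e : R) : 0 <= e -> (forall x, `|f x| <= e) ->
  (Lnorm (lebesgue_rV d) +oo%E (fun x => (f x)%:E) <= e%:E)%E.
Proof.
move=> e0 fe; rewrite unlock; case: ifPn => _; last by rewrite lee_fin.
by apply/ess_supP; apply: aeW => x; rewrite /= lee_fin; exact: fe.
Qed.

Lemma closed_boundary (T : topologicalType) (A : set T) : closed (boundary A).
Proof.
apply: closedI; first exact: closed_closure.
by apply: open_closedC; exact: open_interior.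
Qed.

Lemma harmonic_lt (e : R) : 0 < e -> exists n : nat, forall j, (n <= j)%N -> j.+1%:R^-1 < e.
Proof.
move=> e0; have [n n0 h] := exists_mesh 1 e0.
exists n => j nj; apply: le_lt_trans h; rewrite mul1r lef_pV2 ?posrE ?ltr0n//.
by rewrite ler_nat ltnW.
Qed.

Lemma neighborhood_subbox (A : set 'rV[R]_d) (r kappa : R) : A `<=` box r -> kappa <= 1 ->
  neighborhood kappa A `<=` box (r + 1).
Proof.
move=> Ar k1 x [a Aa /rV_ballP[_ ax]] l.
rewrite -[x 0 l](subrK (a 0 l)) addrC; apply: le_trans (ler_normD _ _) _.
apply: lerD; first exact: Ar.
by rewrite distrC (le_trans (ltW (ax l))).
Qed.

(** A closed set is the intersection of its neighborhoods; being bounded, these have finite measure,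
    and continuity from above applies. *)
Lemma lebesgue_neighborhood_cvg (A : set 'rV[R]_d) (r : R) : closed A -> A `<=` box r -> 0 <= r ->
  lebesgue_rV d (neighborhood j.+1%:R^-1 A) @[j --> \oo] --> lebesgue_rV d A.
Proof.
move=> cA Ar r0; pose N j := neighborhood (j.+1%:R^-1 : R) A.
have mN j : measurable (N j) by apply: open_measurable_rV; exact: open_neighborhood.
have NA : \bigcap_j N j = A.
  apply/seteqP; split => x.
    move=> Nx; rewrite (closure_id A).1// => U /nbhs_ballP[e /= e0 eU].
    have [n hn] := harmonic_lt e0; have [a Aa ax] := Nx n I.
    exists a; split => //; apply: eU; apply: ball_sym; apply: le_ball ax.
    exact: ltW (hn n _).
  by move=> Ax j _; exists x => //; apply: ballxx; rewrite invr_gt0 ltr0n.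
rewrite -[in X in _ --> X]NA; apply: nonincreasing_cvg_mu => //.
- apply: (@le_lt_trans _ _ (lebesgue_rV d (box (r + 1)))).
    apply: le_measure; rewrite ?inE; [exact: (mN 0%N)|exact: measurable_box|].
    by apply: neighborhood_subbox => //; rewrite invr1.
  by rewrite [X in (X < _)%E]lebesgue_box ?ltry// addr_ge0.
- exact: bigcapT_measurable.
- move=> i j ij; apply/subsetPset => x [a Aa ax]; exists a => //; apply: le_ball ax.
  by rewrite lef_pV2 ?posrE ?ltr0n// ler_nat.
Qed.

Lemma box_le (r s : R) : r <= s -> (box r : set 'rV[R]_d) `<=` box s.
Proof. by move=> rs x bx l; exact: le_trans (bx l) rs. Qed.

Variables (w : 'rV[R]_d -> R) (w2 : Ck 2 w) (u : nat -> 'rV[R]_d -> R).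
Hypothesis cu : forall j, continuous (u j).
Hypothesis uw : forall j x, box j.+1%:R x -> `|u j x - w x| <= j.+1%:R^-1.
Hypothesis upper : forall j (Omega : set 'rV[R]_d) (C : R), open Omega ->
  Omega `<=` box j.+1%:R -> 0 <= C ->
  (forall x, neighborhood j.+1%:R^-1 Omega x ->
    \sum_i \sum_k `|partial k (partial i w) x| <= C) ->
  (hessian_schatten_variation 1%E (u j) Omega <=
   hessian_schatten_variation 1%E w Omega + (j.+1%:R^-1)%:E +
   C%:E * lebesgue_rV d (neighborhood j.+1%:R^-1 (boundary Omega)))%E.

Let harmonic_cvg : (j.+1%:R^-1 : R)%:E @[j --> \oo] --> 0%E.
Proof. by apply: cvg_EFin; [exact: nearW|exact: cvg_harmonic]. Qed.

Lemma cvg_Linfty_loc_boxes : cvg_Linfty_loc u w.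
Proof.
move=> K cK; have [n Kn] := compact_subbox cK.
apply: (@squeeze_cvge _ _ _ _ (fun=> 0%E) _ (fun j => (j.+1%:R^-1)%:E)).
- exists n => // j /= nj; rewrite Lnorm_ge0/=; apply: Lnorm_infty_le => [|x].
    by rewrite invr_ge0.
  rewrite indicE; have [/set_mem Kx|_] := boolP (x \in K); last by rewrite mul0r normr0 invr_ge0.
  by rewrite mul1r; apply: uw; apply: box_le (Kn x Kx); rewrite ler_nat ltnW.
- exact: cvg_cst.
- exact: harmonic_cvg.
Qed.

(** A field that is nearly optimal for [w] is kept fixed and tested against [u j]: its second
    derivatives are integrable, so uniform convergence on the box passes to the pairing. *)
Lemma variation_lsc Omega (n : nat) (c : R) : Omega `<=` box n%:R ->
  (c%:E < hessian_schatten_variation 1%E w Omega)%E ->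
  \forall j \near \oo, (c%:E <= hessian_schatten_variation 1%E (u j) Omega)%E.
Proof.
move=> On cV; have cw := Ck_continuous w2.
have [F aF cF] := hs_variation_approx cw cV.
pose F' i j y := F y i j; have FT i j : test_function Omega (F' i j) by exact: aF.1.
pose L := \sum_i \sum_j integral_rV (fun x => `|partial i (partial j (F' i j)) x|).
have L0 : 0 <= L.
  by apply: sumr_ge0 => i _; apply: sumr_ge0 => j _; apply: integral_rV_ge0 => x.
have g0 : 0 < (hess_pairing w F' - c) / (L + 1) by rewrite divr_gt0 ?subr_gt0// ltr_wpDl.
have [N hN] := harmonic_lt g0.
exists (maxn n N) => // j /=; rewrite geq_max => /andP[nj Nj].
have Vge := hs_variation_ge (@cu j) aF.
apply: le_trans Vge; rewrite lee_fin.
have cuw : continuous (fun x => u j x - w x) by exact: continuous_sub.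
have FC i k : C2c (F' i k) by exact: test_function_C2c (FT i k).
have h0 : 0 <= j.+1%:R^-1 :> R by rewrite invr_ge0.
have : `|hess_pairing (fun x => u j x - w x) F'| <= j.+1%:R^-1 * L.
  apply: (pairing_uniform_bound cuw h0 FT) => x Ox.
  by apply: uw; apply: box_le (On x Ox); rewrite ler_nat ltnW.
rewrite (hess_pairingBl (@cu j) cw FC) ler_norml => /andP[h _].
have : j.+1%:R^-1 * L <= hess_pairing w F' - c.
  apply: le_trans (_ : (hess_pairing w F' - c) / (L + 1) * (L + 1) <= _); last first.
    by rewrite divfK// gt_eqF// ltr_wpDl.
  by apply: ler_pM => //; [exact/ltW/hN|rewrite lerDl].
rewrite -/(F'); move: h; move: (hess_pairing w F') (hess_pairing (u j) F') (_ * L) => a b q; lra.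
Qed.

Lemma variation_cvg Omega : open Omega -> bounded_set Omega ->
  lebesgue_rV d (boundary Omega) = 0%E ->
  hessian_schatten_variation 1%E (u j) Omega @[j --> \oo] -->
    hessian_schatten_variation 1%E w Omega.
Proof.
move=> oO /bounded_subbox[n On] O0.
pose h (ij : 'I_d * 'I_d) := partial ij.2 (partial ij.1 w).
have ch ij : continuous (h ij) := Ck_continuous (Ck_partial ij.2 (Ck_partial ij.1 w2)).
(* The neighborhoods have radius at most 1 and stay in [box (n%:R + 1)], so one constant [C] serves
   all large [j]. *)
have [M M0 HM] := box_bound_family (n%:R + 1) ch.
pose C := \sum_(i < d) \sum_(j < d) M.
have C0 : 0 <= C by apply: sumr_ge0 => i _; exact: sumr_ge0.
have bO : boundary Omega `<=` box n%:R.
  have -> : (box n%:R : set 'rV[R]_d) = closure (box n%:R).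
    apply/closure_id; apply: compact_closed; [exact: norm_hausdorff|exact: box_compact].
  by move=> x [cx _]; exact: closureS On x cx.
apply: (@ereal_squeeze_cvg _ _ (fun j => hessian_schatten_variation 1%E w Omega +
   (j.+1%:R^-1)%:E + C%:E * lebesgue_rV d (neighborhood j.+1%:R^-1 (boundary Omega)))%E).
- by move=> c; exact: variation_lsc On.
- exists n => // j /= nj; apply: upper => //.
    by apply: subset_trans On _; apply: box_le; rewrite ler_nat ltnW.
  move=> x xN; apply: ler_sum => i _; apply: ler_sum => k _; apply: (HM (i, k)).
  apply: neighborhood_subbox xN => //; by rewrite invf_le1 ?ltr0n// ler1n.
- rewrite -[X in _ --> X]adde0 -[X in _ --> (X + _)%E]adde0.
  apply: cvgeD.
  + by rewrite adde0 fin_num_adde_defl.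
  + apply: cvgeD; [exact: fin_num_adde_defl|exact: cvg_cst|exact: harmonic_cvg].
  + rewrite -(mule0 C%:E); apply: cvgeZl => //.
    by rewrite -O0; apply: lebesgue_neighborhood_cvg bO _ => //; exact: closed_boundary.
Qed.

End final_estimates.

Unset Implicit Arguments.
Set Strict Implicit.
Set Printing Implicit Defensive.

Theorem theorem2p2 (R : realType) (d : nat) (d_gt0 : (0 < d)%N)
    (w : 'rV[R]_d -> R) (w_C2 : Ck 2 w) :
  exists u : nat -> 'rV[R]_d -> R,
    [/\ forall j, CPWL setT (u j),
        cvg_Linfty_loc u w &
        forall Omega : set 'rV[R]_d,
          open Omega -> bounded_set Omega ->
          lebesgue_rV d (boundary Omega) = 0%E ->
          hessian_schatten_variation 1%E (u j) Omega @[j --> \oo] -->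
            hessian_schatten_variation 1%E w Omega].
Proof.
(* The box grows like [j.+1] while the precision is [j.+1%:R^-1], so every bounded set is eventually
   covered. *)
pose good j (u : 'rV[R]_d -> R) := [/\ CPWL setT u, continuous u,
  forall x, box j.+1%:R x -> `|u x - w x| <= j.+1%:R^-1 &
  forall (Omega : set 'rV[R]_d) (C : R), open Omega -> Omega `<=` box j.+1%:R -> 0 <= C ->
    (forall x, neighborhood j.+1%:R^-1 Omega x ->
      \sum_i \sum_k `|partial k (partial i w) x| <= C) ->
    (hessian_schatten_variation 1%E u Omega <=
     hessian_schatten_variation 1%E w Omega + (j.+1%:R^-1)%:E +
     C%:E * lebesgue_rV d (neighborhood j.+1%:R^-1 (boundary Omega)))%E].
have ex j : exists u, good j u.
  by apply: CPWL_approximation => //; rewrite ?invr_gt0 ltr0n.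
have [u Hu] := choice ex.
have cu j : continuous (u j) by case: (Hu j).
have uw j x : box j.+1%:R x -> `|u j x - w x| <= j.+1%:R^-1 by case: (Hu j) => _ _ h _; exact: h.
exists u; split; first by move=> j; case: (Hu j).
  exact: cvg_Linfty_loc_boxes uw.
move=> Omega; apply: variation_cvg w_C2 _ cu uw _ Omega => j Omega C.
by case: (Hu j) => _ _ _; exact.
Qed.
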